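(* For each $\varepsilon\in(0,1]$ let $\{\phi_k(\varepsilon)\}_{k\in\mathbb N}$ be a family of real numbers and let $n(\varepsilon)\in\mathbb N$, with $n(\varepsilon)\to\infty$ as $\varepsilon\to0$. Define $$F_\varepsilon=\Bigl(\sum_{k=1}^{n(\varepsilon)}\mu(k)\,\phi_k(\varepsilon)\,\varphi_{1/k}\Bigr)\star\psi_\varepsilon,\qquad \varepsilon\in(0,1].$$ If the net $(F_\varepsilon)$ is moderate, is associated to $-\iota(\chi)$, and there is a constant $M$ with $\|F_\varepsilon\|_{L^2(0,1)}\le M$ for all $\varepsilon\in(0,1]$, then the Riemann hypothesis is true.
   Context: The Riemann hypothesis is the assertion that all non-trivial zeros of the Riemann zeta function lie on $\operatorname{Re}(s)=1/2$. $\mu$ is the Möbius function, $\{t\}=t-\lfloor t\rfloor$ is the fractional part, $\varphi_{\theta}(x)=\{\theta/x\}$ for $\theta\in(0,1]$ and $x\in(0,1)$, and $\chi=\mathbf 1_{(0,1)}$. Mollifier: fix $\psi\in C_c^\infty(\mathbb R)$ with $\operatorname{supp}\psi\subset[-1,0]$, $\psi\ge0$, $\int_{\mathbb R}\psi=1$, and put $\psi_\varepsilon(y)=\frac1\varepsilon\psi\bigl(\frac{\log y}{\varepsilon}\bigr)$ for $y>0$, $\varepsilon\in(0,1]$. Multiplicative regularization: for a bounded measurable function $f$ on $(0,1)$, extended by $0$ outside $(0,1)$, $$(f\star\psi_\varepsilon)(x)=\int_0^\infty f(x/y)\,\psi_\varepsilon(y)\,\frac{dy}{y},\qquad x\in(0,1).$$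 This is a smooth function on $(0,1)$. A net $(u_\varepsilon)_{0<\varepsilon\le1}\subset C^\infty(0,1)$ is moderate if for every compact $K\subset(0,1)$ and every integer $m\ge0$ there exist $C,N>0$ such that $\sup_{x\in K}|u_\varepsilon^{(m)}(x)|\le C\varepsilon^{-N}$ for all $0<\varepsilon\le1$. It is negligible if for every compact $K\subset(0,1)$, every integer $m\ge 0$ and every $p\in\mathbb N$ there is $C_p$ with $\sup_{x\in K}|u_\varepsilon^{(m)}(x)|\le C_p\varepsilon^{p}$ for all $0<\varepsilon\le1$. The algebra $G(0,1)$ is the quotient of moderate nets by negligible nets, and $\iota:L^\infty(0,1)\to G(0,1)$ is $\iota(f)=[(f\star\psi_\varepsilon)_\varepsilon]$. A moderate net $(u_\varepsilon)$ is associated to $[(v_\varepsilon)]\in G(0,1)$ if $\lim_{\varepsilon\to0^+}\int_0^1(u_\varepsilon-v_\varepsilon)\,\varphi\,dx=0$ for every $\varphi\in C_c^\infty(0,1)$. In particular, $(F_\varepsilon)$ is associated to $-\iota(\chi)$ if $\lim_{\varepsilon\to0^+}\int_0^1\bigl(F_\varepsilon+\chi\star\psi_\varepsilon\bigr)\varphi\,dx=0$ for every $\varphi\in C_c^\infty(0,1)$. *)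

(* Defs.v *)
From HB Require Import structures.
From mathcomp Require Import all_boot all_order all_algebra.
From mathcomp Require Import complex.
From mathcomp Require Import all_classical all_reals all_analysis.

Set Implicit Arguments.
Unset Strict Implicit.
Unset Printing Implicit Defensive.

Import Order.TTheory GRing.Theory Num.Theory.
Import numFieldNormedType.Exports.

Local Open Scope classical_set_scope.
Local Open Scope ring_scope.

(* In a positive integer, squarefree means that each of its prime divisors has
   multiplicity one; the value at 0 is the junk value 0. *)
Definition moebius (n : nat) : int :=
  if (0 < n)%N && all (fun p => logn p n == 1%N) (primes n)
  then (-1) ^+ size (primes n) else 0.

Section Zeta.
Context {R : realType}.

Definition cexp (z : R[i]) : R[i] :=
  ((expR (complex.Re z) * cos (complex.Im z)) +i*
   (expR (complex.Re z) * sin (complex.Im z)))%C.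

(* k ^ (- s), for k >= 1 *)
Definition dirichlet_term (s : R[i]) (k : nat) : R[i] :=
  cexp (- s * (ln (k%:R : R))%:C%C).

(* [R[i]^o] is [R[i]] with its norm topology. *)
Definition analytic_at (f : R[i] -> R[i]) (z0 : R[i]) : Prop :=
  exists a : nat -> R[i], \forall z \near (z0 : R[i]^o),
    series (fun n => a n * (z - z0) ^+ n : R[i]^o) @ \oo --> (f z : R[i]^o).

(* The analytic continuation of the Dirichlet series to the plane minus 1. It
   exists and is unique there; the value at 1, a pole, is left unspecified. *)
Definition is_riemann_zeta (zeta : R[i] -> R[i]) : Prop :=
  (forall s, 1 < complex.Re s ->
     series (fun n => dirichlet_term s n.+1 : R[i]^o) @ \oo
       --> (zeta s : R[i]^o)) /\
  (forall s, s != 1 -> analytic_at zeta s).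

Definition trivial_zero (s : R[i]) : Prop :=
  exists n : nat, s = - (2 * n.+1)%:R.

End Zeta.

(* All realTypes being isomorphic, the choice of R is immaterial. *)
Definition riemann_hypothesis (R : realType) : Prop :=
  forall zeta : R[i] -> R[i], is_riemann_zeta zeta ->
  forall s : R[i], s != 1 -> zeta s = 0 -> ~ trivial_zero s ->
    complex.Re s = 2^-1.

Section Mollification.
Context {R : realType}.

Local Notation mu := (@lebesgue_measure R).

Definition smooth_on (A : set R) (f : R -> R) : Prop :=
  forall (m : nat) (x : R), A x -> derivable (derive1n m f) x 1.

Definition tsupport (f : R -> R) : set R := closure [set x | f x != 0].

Definition is_mollifier (psi : R -> R) : Prop :=
  [/\ smooth_on setT psi,
      tsupport psi `<=` `[-1, 0],
      forall y, 0 <= psi y &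
      (\int[mu]_y (psi y)%:E = 1)%E].

Definition scaled_mollifier (psi : R -> R) (eps y : R) : R :=
  eps^-1 * psi (ln y / eps).

(* The patch [f \_ `]0, 1[] is the extension of f by 0 outside (0,1). *)
Definition mollify (psi : R -> R) (eps : R) (f : R -> R) (x : R) : R :=
  \int[mu]_(y in `]0, +oo[)
    ((f \_ `]0, 1[) (x / y) * scaled_mollifier psi eps y / y).

(* A net is indexed by eps in (0,1]; its values for other eps are junk. *)
Definition moderate (u : R -> R -> R) : Prop :=
  (forall eps, 0 < eps <= 1 -> smooth_on `]0, 1[ (u eps)) /\
  (forall K : set R, compact K -> K `<=` `]0, 1[ -> forall m : nat,
     exists C N : R, [/\ 0 < C, 0 < N &
       forall eps, 0 < eps <= 1 -> forall x, K x ->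
         `|derive1n m (u eps) x| <= C * eps `^ (- N)]).

Definition test_function (phi : R -> R) : Prop :=
  [/\ smooth_on setT phi, compact (tsupport phi) & tsupport phi `<=` `]0, 1[].

(* Here v is a representative of an element of the algebra G(0,1); the notion
   does not depend on its choice. *)
Definition associated (u v : R -> R -> R) : Prop :=
  forall phi, test_function phi ->
    (\int[mu]_(x in `]0, 1[) ((u eps x - v eps x) * phi x))
      @[eps --> 0^'+] --> (0 : R).

(* The standard representative of the class iota(f). *)
Definition iota_net (psi : R -> R) (f : R -> R) : R -> R -> R :=
  fun eps => mollify psi eps f.

Definition chi : R -> R := \1_(`]0, 1[ : set R).

Definition frac_part (t : R) : R := t - (Num.floor t)%:~R.

Definition vphi (theta x : R) : R := frac_part (theta / x).

Definition L2norm01 (f : R -> R) : \bar R :=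
  Lnorm mu 2%:E (fun x => ((f \_ `]0, 1[) x)%:E).

Definition moebius_net (psi : R -> R) (phi : nat -> R -> R) (n : R -> nat)
    (eps : R) : R -> R :=
  mollify psi eps (fun x =>
    \sum_(1 <= k < (n eps).+1) (moebius k)%:~R * phi k eps * vphi k%:R^-1 x).

End Mollification.

(* Main.v *)
Require Import Defs.
From HB Require Import structures.
From mathcomp Require Import all_boot all_order all_algebra.
From mathcomp Require Import complex.
From mathcomp Require Import all_classical all_reals all_analysis.
From mathcomp Require Import measurable_realfun ring lra.

Set Implicit Arguments.
Unset Strict Implicit.
Unset Printing Implicit Defensive.

Import Order.TTheory GRing.Theory Num.Theory.
Import numFieldNormedType.Exports.

Local Open Scope classical_set_scope.
Local Open Scope ring_scope.

(** Suppose that zeta vanishes at s, with Re s > 1/2 and s <> 1. The Mellin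
    transform of the fractional part is elementary apart from a multiple of
    zeta(s): for 0 < theta <= b, [frac_mellin] gives
      s (s - 1) int_0^b {theta/x} x^(s-1) dx
        = s theta b^(s-1) - (s - 1) theta^s zeta(s).
    At the zero the last term disappears. Hence the Mellin transform at s of a
    real linear combination of the functions {theta/x} on (0,1) is A / (s - 1),
    where A is real: the same combination of the numbers theta. The
    regularization multiplies it by the Mellin moment m_eps(s) of the mollifier
    ([net_mellin]), and m_eps(s) tends to 1 ([kernel_moment]); so
    (s - 1) int_0^1 F_eps x^(s-1) dx = A_eps m_eps(s) with A_eps real.

    On the other hand x^(s-1) is square integrable because Re s > 1/2, so the
    bound on the L2 norms and the association with the opposite of chi force
    int_0^1 F_eps x^(s-1) dx to tend to - int_0^1 x^(s-1) dx = - 1/s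
    ([mellin_weak]). Therefore (s - 1)/s is a limit of products of a real number
    by a number tending to 1: it is real, and s is real. But zeta has no zero on
    the positive half line: by the same formula with theta = b = 1, a zero x
    would give (x - 1) M = 1 with 0 <= M <= 1/x ([zeta_real_neq0]). This
    excludes all zeros with Re s > 1/2 ([net_zeta_neq0]).

    The zeros with Re s < 1/2 are moved to the other side by the functional
    equation. It is proved for every function that continues the Dirichlet
    series ([zeta_xi]), by Riemann's method. In the coordinate u = ln x, the
    function zeta times a Gamma factor is the Laplace transform of the theta
    series, for Re s > 2; Jacobi's identity [theta_eq] folds the line onto a
    half line and yields an entire function xi with xi (1 - s) = xi s. Jacobi's
    identity itself comes from integrating the derivative of a Gaussian against
    the sawtooth x - floor x - 1/2. Integration by parts gives the theta series
    ([sum_side]); the Fourier series of the sawtooth, whose partial sums are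
    bounded ([sawser_bound]), gives the dual theta series ([fourier_side]),
    since the Fourier transform of a Gaussian is a Gaussian ([gaussLE]).
    Finally the Gamma factor does not vanish ([Gam_neq0]): a zero w would make
    all the w + n zeros, but the Gamma distributions of large parameter are too
    concentrated for that.

    The complex analysis consists of functions that are sums of power series
    near a point ([canal]), of the identity theorem along a segment
    ([identity_segment]) and of the analyticity of Laplace transforms
    ([lap_analytic]), of which Mellin transforms and the Gamma function are
    instances. *)

(** * The complex modulus, convergence and the exponential *)

Section ComplexBasics.
Context {R : realType}.
Local Notation C := R[i].
Implicit Types (z w s : C) (u v : nat -> C).

(** The norm of [R[i]] takes complex values; estimates are carried out with this
    real-valued modulus. *)
Definition cabs (z : C) : R :=
  Num.sqrt (complex.Re z ^+ 2 + complex.Im z ^+ 2).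

Lemma normC_cabs z : `|z| = (cabs z)%:C%C.
Proof. exact: normc_def. Qed.

Lemma cabs_ge0 z : 0 <= cabs z.
Proof. exact: sqrtr_ge0. Qed.

Lemma cabsM z w : cabs (z * w) = cabs z * cabs w.
Proof.
by apply: (@complexI R); rewrite rmorphM/= -!normC_cabs normrM.
Qed.

Lemma cabsN z : cabs (- z) = cabs z.
Proof. by apply: (@complexI R); rewrite -!normC_cabs normrN. Qed.

Lemma cabsD z w : cabs (z + w) <= cabs z + cabs w.
Proof. by rewrite -lecR rmorphD/= -!normC_cabs ler_normD. Qed.

Lemma cabs_eq0 z : (cabs z == 0) = (z == 0).
Proof. by rewrite -(inj_eq (@complexI R)) -normC_cabs normr_eq0. Qed.

Lemma cabs0 : cabs 0 = 0.
Proof. by apply/eqP; rewrite cabs_eq0. Qed.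

Lemma cabs_gt0 z : (0 < cabs z) = (z != 0).
Proof. by rewrite lt0r cabs_eq0 cabs_ge0 andbT. Qed.

Lemma cabsX z n : cabs (z ^+ n) = cabs z ^+ n.
Proof. by apply: (@complexI R); rewrite rmorphXn/= -!normC_cabs normrX. Qed.

Lemma cabsR (x : R) : cabs x%:C%C = `|x|.
Proof. by rewrite /cabs/= expr0n/= addr0 sqrtr_sqr. Qed.

Lemma realCM (x y : R) : (x * y)%:C%C = x%:C%C * y%:C%C :> C.
Proof. exact: rmorphM. Qed.

Lemma cabsB z w : cabs (z - w) = cabs (w - z).
Proof. by rewrite -cabsN opprB. Qed.

Lemma cabs1 : cabs 1 = 1.
Proof. by apply: (@complexI R); rewrite -normC_cabs normr1. Qed.

Lemma cabsV z : cabs z^-1 = (cabs z)^-1.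
Proof. by apply: (@complexI R); rewrite fmorphV/= -!normC_cabs normfV. Qed.

Lemma cabs_nat n : cabs n%:R = n%:R.
Proof. by apply: (@complexI R); rewrite -normC_cabs normr_nat rmorph_nat. Qed.

Lemma cabs_sum (I : Type) (r : seq I) (P : pred I) (F : I -> C) :
  cabs (\sum_(i <- r | P i) F i) <= \sum_(i <- r | P i) cabs (F i).
Proof.
elim/big_rec2: _ => [|i x y _ le]; first by rewrite cabs0.
by rewrite (le_trans (cabsD _ _))// lerD2l.
Qed.

Lemma normr_Re_le z : `|complex.Re z| <= cabs z.
Proof. by rewrite -sqrtr_sqr ler_wsqrtr// lerDl sqr_ge0. Qed.

Lemma normr_Im_le z : `|complex.Im z| <= cabs z.
Proof. by rewrite -sqrtr_sqr ler_wsqrtr// lerDr sqr_ge0. Qed.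

Lemma ReD z w : complex.Re (z + w) = complex.Re z + complex.Re w.
Proof. by case: z w => [? ?] [? ?]. Qed.
Lemma ImD z w : complex.Im (z + w) = complex.Im z + complex.Im w.
Proof. by case: z w => [? ?] [? ?]. Qed.
Lemma ReN z : complex.Re (- z) = - complex.Re z.
Proof. by case: z => [? ?]. Qed.
Lemma ImN z : complex.Im (- z) = - complex.Im z.
Proof. by case: z => [? ?]. Qed.
Lemma ReM z w : complex.Re (z * w) =
  complex.Re z * complex.Re w - complex.Im z * complex.Im w.
Proof. by case: z w => [? ?] [? ?]. Qed.
Lemma ImM z w : complex.Im (z * w) =
  complex.Re z * complex.Im w + complex.Im z * complex.Re w.
Proof. by case: z w => [? ?] [? ?]. Qed.

Lemma Re_realM (x : R) z : complex.Re (x%:C%C * z) = x * complex.Re z.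
Proof. by rewrite ReM /= mul0r subr0. Qed.
Lemma Im_realM (x : R) z : complex.Im (x%:C%C * z) = x * complex.Im z.
Proof. by rewrite ImM /= mul0r addr0. Qed.

Lemma Re_nat n : complex.Re (n%:R : C) = n%:R.
Proof. by rewrite -(rmorph_nat (real_complex R)). Qed.
Lemma Im_nat n : complex.Im (n%:R : C) = 0.
Proof. by rewrite -(rmorph_nat (real_complex R)). Qed.

Lemma Re_sum (I : Type) (r : seq I) (P : pred I) (F : I -> C) :
  complex.Re (\sum_(i <- r | P i) F i) = \sum_(i <- r | P i) complex.Re (F i).
Proof. by elim/big_rec2: _ => [//|i x y _ <-]; rewrite ReD. Qed.
Lemma Im_sum (I : Type) (r : seq I) (P : pred I) (F : I -> C) :
  complex.Im (\sum_(i <- r | P i) F i) = \sum_(i <- r | P i) complex.Im (F i).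
Proof. by elim/big_rec2: _ => [//|i x y _ <-]; rewrite ImD. Qed.

Lemma cabs_le_ReIm z : cabs z <= `|complex.Re z| + `|complex.Im z|.
Proof.
rewrite -[leRHS]ger0_norm ?addr_ge0// -sqrtr_sqr ler_wsqrtr//.
rewrite sqrrD !real_normK ?num_real//.
by rewrite lerD2r lerDl mulrn_wge0// mulr_ge0.
Qed.

Lemma complex_eq z w : complex.Re z = complex.Re w ->
  complex.Im z = complex.Im w -> z = w.
Proof. by case: z w => [? ?] [? ?] /= -> ->. Qed.

Definition ccvg u (l : C) : Prop := (u : nat -> R[i]^o) @ \oo --> (l : R[i]^o).

Lemma ccvgP u l : ccvg u l <->
  forall e : R, 0 < e -> exists N, forall n, (N <= n)%N -> cabs (u n - l) < e.
Proof.
rewrite /ccvg; split.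
  move=> /cvgrPdist_lt H e e0.
  have e0' : 0 < e%:C%C :> R[i] by rewrite ltcR.
  have [N _ HN] := H _ e0'; exists N => n Nn.
  by have := HN n Nn; rewrite /= normC_cabs ltcR cabsB.
move=> H; apply/cvgrPdist_lt => e e0.
have [ea eb] : complex.Im e = 0 /\ 0 < complex.Re e.
  by move: e0; rewrite ltcE/= => /andP[/eqP-> ->].
have [N HN] := H _ eb.
exists N => // n Nn /=.
have -> : e = (complex.Re e)%:C%C by case: (e) ea => ? ? /= ->.
by rewrite normC_cabs ltcR cabsB HN.
Qed.

Lemma ccvg_ReIm u l : ccvg u l <->
  (fun n => complex.Re (u n)) @ \oo --> complex.Re l /\
  (fun n => complex.Im (u n)) @ \oo --> complex.Im l.
Proof.
split.
  move=> /ccvgP H; split; apply/cvgrPdist_lt => e e0; have [N HN] := H _ e0;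
    exists N => // n Nn /=; apply: le_lt_trans (HN n Nn); rewrite cabsB.
    by rewrite -ReN -ReD normr_Re_le.
  by rewrite -ImN -ImD normr_Im_le.
move=> [/cvgrPdist_lt H1 /cvgrPdist_lt H2]; apply/ccvgP => e e0.
have e20 : 0 < e / 2 by rewrite divr_gt0.
have [N1 _ HN1] := H1 _ e20; have [N2 _ HN2] := H2 _ e20.
exists (maxn N1 N2) => n; rewrite geq_max => /andP[n1 n2].
rewrite cabsB (le_lt_trans (cabs_le_ReIm _))// [ltRHS]splitr ltrD//.
  by rewrite ReD ReN; exact: HN1.
by rewrite ImD ImN; exact: HN2.
Qed.

Lemma ccvg_cst z : ccvg (fun=> z) z.
Proof. exact: cvg_cst. Qed.

Lemma ccvgD u v a b : ccvg u a -> ccvg v b -> ccvg (fun n => u n + v n) (a + b).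
Proof. exact: cvgD. Qed.

Lemma ccvgM u v a b : ccvg u a -> ccvg v b -> ccvg (fun n => u n * v n) (a * b).
Proof. exact: cvgM. Qed.

Lemma ccvgN u a : ccvg u a -> ccvg (fun n => - u n) (- a).
Proof. exact: cvgN. Qed.

Lemma ccvg_unique u a b : ccvg u a -> ccvg u b -> a = b.
Proof.
move=> /ccvg_ReIm[a1 a2] /ccvg_ReIm[b1 b2]; apply: complex_eq.
  exact: (cvg_unique _ a1 b1).
exact: (cvg_unique _ a2 b2).
Qed.

Lemma ccvg_eq u v a : ccvg u a -> (forall n, u n = v n) -> ccvg v a.
Proof. by move=> + /funext <-. Qed.

Lemma ccvg0_squeeze u (b : nat -> R) : (forall n, cabs (u n) <= b n) ->
  b @ \oo --> 0 -> ccvg u 0.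
Proof.
move=> ub /cvgrPdist_lt b0; apply/ccvgP => e e0; have [N _ HN] := b0 _ e0.
exists N => n Nn; rewrite subr0 (le_lt_trans (ub n))//.
by have := HN n Nn; rewrite /= sub0r normrN; apply: le_lt_trans; rewrite ler_norm.
Qed.

Lemma ccvg_shift u l k : ccvg (fun n => u (n + k)%N) l <-> ccvg u l.
Proof.
rewrite /ccvg; split => [|] H; first by rewrite -(cvg_shiftn k).
by rewrite (cvg_shiftn k).
Qed.

Lemma ccvg_bounded u l : ccvg u l -> exists K : R, forall n, cabs (u n) <= K.
Proof.
move=> /ccvgP/(_ _ ltr01)[N HN].
exists (\sum_(i < N) cabs (u i) + (1 + cabs l)) => n.
have [nN|Nn] := ltnP n N.
  rewrite (bigD1 (Ordinal nN))//= -addrA lerDl addr_ge0//.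
    by apply: sumr_ge0 => i _; exact: cabs_ge0.
  by rewrite addr_ge0// cabs_ge0.
rewrite -[leLHS]add0r lerD//; first by apply: sumr_ge0 => i _; exact: cabs_ge0.
have -> : u n = (u n - l) + l by rewrite subrK.
by rewrite (le_trans (cabsD _ _))// lerD2r ltW// HN.
Qed.

Lemma cexpD z w : cexp (z + w) = cexp z * cexp w.
Proof.
case: z w => [a b] [c d]; rewrite /cexp/=; apply: complex_eq => /=.
  by rewrite expRD cosD; ring.
by rewrite expRD sinD; ring.
Qed.

Lemma cexp0 : cexp (0 : C) = 1.
Proof. by rewrite /cexp/= expR0 cos0 sin0 mulr1 mulr0. Qed.

Lemma cabs_cexp z : cabs (cexp z) = expR (complex.Re z).
Proof.
rewrite /cabs/cexp/= !exprMn -mulrDr cos2Dsin2 mulr1 sqrtr_sqr ger0_norm// expR_ge0.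
Qed.

Lemma cexpR (x : R) : cexp x%:C%C = (expR x)%:C%C.
Proof. by rewrite /cexp/= cos0 sin0 mulr1 mulr0. Qed.

Lemma expr8_ge0 n : 0 <= (8^-1 : R) ^+ n.
Proof. by rewrite exprn_ge0// invr_ge0. Qed.

(** The product of the partial sums exceeds the partial sum of the Cauchy product
    by coefficients of degree at least N, each of which is at most
    (n + 1) A B 8^-n <= A B 4^-n. The truncated series are read as values at 1
    of polynomials, so that the coefficients of their product are those of the
    Cauchy product. *)
Lemma ccvg_cauchy (a b : nat -> C) (A B : R) la lb :
  (forall n, cabs (a n) <= A * 8^-1 ^+ n) ->
  (forall n, cabs (b n) <= B * 8^-1 ^+ n) ->
  ccvg (series a) la -> ccvg (series b) lb ->
  ccvg (series (fun n => \sum_(i < n.+1) a i * b (n - i)%N)) (la * lb).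
Proof.
move=> aA bB ala blb.
have A0 : 0 <= A by have := aA 0%N; rewrite expr0 mulr1; apply: le_trans; exact: cabs_ge0.
have B0 : 0 <= B by have := bB 0%N; rewrite expr0 mulr1; apply: le_trans; exact: cabs_ge0.
pose c n := \sum_(i < n.+1) a i * b (n - i)%N.
suff H : ccvg (fun N => series a N * series b N - series c N) 0.
  have := ccvgD (ccvgM ala blb) (ccvgN H); rewrite subr0.
  by move=> H1; apply: (ccvg_eq H1) => n; rewrite opprB addrC subrK.
apply: (@ccvg0_squeeze _ (fun N => geometric (A * B) 2^-1 N)); last first.
  by apply: cvg_geometric; rewrite ger0_norm ?invr_ge0// invf_lt1// ltr1n.
move=> N /=.
pose p : {poly C} := \poly_(i < N) a i.
pose q : {poly C} := \poly_(i < N) b i.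
have sp (f : nat -> C) : (\poly_(i < N) f i).[1] = series f N.
  rewrite horner_poly /series/= big_mkord; apply: eq_bigr => i _.
  by rewrite expr1n mulr1.
have -> : series a N * series b N = \sum_(0 <= n < N + N) (p * q)`_n.
  rewrite -!sp -hornerM (@horner_coef_wide _ (N + N)); last first.
    rewrite (leq_trans (size_polyMleq _ _))// (leq_trans (leq_pred _))//.
    by rewrite leq_add// size_poly.
  by rewrite big_mkord; apply: eq_bigr => i _; rewrite expr1n mulr1.
rewrite (@big_cat_nat _ _ _ N)//= ?leq_addr//.
have -> : \sum_(0 <= n < N) (p * q)`_n = series c N.
  rewrite /series/= !big_mkord; apply: eq_bigr => n _.
  rewrite coefM; apply: eq_bigr => i _; rewrite !coef_poly.
  have iN : (i < N)%N by rewrite (leq_ltn_trans _ (ltn_ord n))// -ltnS.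
  have niN : (n - i < N)%N by rewrite (leq_ltn_trans _ (ltn_ord n))// leq_subr.
  by rewrite iN niN.
rewrite [series c N + _]addrC addrK.
have pA i : cabs p`_i <= A * 8^-1 ^+ i.
  rewrite coef_poly; case: ifP => // _; rewrite cabs0.
  exact: mulr_ge0 (expr8_ge0 _).
have qB i : cabs q`_i <= B * 8^-1 ^+ i.
  rewrite coef_poly; case: ifP => // _; rewrite cabs0.
  exact: mulr_ge0 (expr8_ge0 _).
have pq n : cabs (p * q)`_n <= A * B * 4^-1 ^+ n.
  rewrite coefM (le_trans (cabs_sum _ _ _))//.
  rewrite (@le_trans _ _ (\sum_(i < n.+1) A * B * 8^-1 ^+ n))//.
    apply: ler_sum => i _; rewrite cabsM.
    rewrite (le_trans (ler_pM (cabs_ge0 _) (cabs_ge0 _) (pA i) (qB _)))//.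
    by rewrite mulrACA -exprD subnKC// -ltnS.
  rewrite sumr_const card_ord -[_ *+ n.+1]mulr_natr.
  rewrite (_ : _ * n.+1%:R = A * B * (8^-1 ^+ n * n.+1%:R)); last by rewrite mulrA.
  apply: ler_wpM2l; first exact: mulr_ge0.
  have -> : (8^-1 : R) ^+ n = 4^-1 ^+ n * 2^-1 ^+ n.
    by rewrite -exprMn; congr (_ ^+ _); field.
  rewrite -mulrA ler_piMr// ?exprn_ge0// ?invr_ge0//.
  rewrite exprVn ler_pdivrMl ?exprn_gt0// mulr1 -natrX ler_nat.
  exact: ltn_expl.
rewrite (le_trans (cabs_sum _ _ _))//.
rewrite (@le_trans _ _ (\sum_(N <= i < N + N) A * B * 4^-1 ^+ N))//.
  rewrite big_nat [leRHS]big_nat; apply: ler_sum => i /andP[Ni _].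
  rewrite (le_trans (pq i))// ler_wpM2l ?mulr_ge0//.
  by apply: ler_wiXn2l => //; rewrite ?invr_ge0// invf_le1// ler1n.
rewrite big_const_nat addnK iter_addr_0 -[_ *+ N]mulr_natr.
rewrite (_ : _ * N%:R = A * B * (4^-1 ^+ N * N%:R)); last by rewrite mulrA.
apply: ler_wpM2l; first exact: mulr_ge0.
have -> : (4^-1 : R) ^+ N = 2^-1 ^+ N * 2^-1 ^+ N.
  by rewrite -exprMn; congr (_ ^+ _); field.
rewrite -mulrA ler_piMr ?exprn_ge0 ?invr_ge0//.
rewrite exprVn ler_pdivrMl ?exprn_gt0// mulr1 -natrX ler_nat ltnW//.
exact: ltn_expl.
Qed.

Lemma series_exp_coeff_le (x : R) n : 0 <= x -> series (exp_coeff x) n <= expR x.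
Proof.
move=> x0; have nd : nondecreasing_seq (series (exp_coeff x)).
  apply/nondecreasing_seqP => k; rewrite /series/= big_nat_recr//= lerDl.
  exact: exp_coeff_ge0.
exact: (nondecreasing_cvgn_le nd (is_cvg_series_exp_coeff _) n).
Qed.

Lemma exp_coeff_le_expR (x : R) n : 0 <= x -> x ^+ n / n`!%:R <= expR x.
Proof.
move=> x0; apply: le_trans (series_exp_coeff_le n.+1 x0).
rewrite /series/= big_nat_recr//= lerDr sumr_ge0// => i _.
exact: exp_coeff_ge0.
Qed.

Lemma exp_coeff_le8 (x : R) : 0 <= x -> exists B : R, forall n,
  x ^+ n / n`!%:R <= B * 8^-1 ^+ n.
Proof.
move=> x0; exists (expR (8 * x)) => n.
have x80 : 0 <= 8 * x by rewrite mulr_ge0.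
rewrite exprVn ler_pdivlMr ?exprn_gt0// mulrAC -exprMn [x * 8]mulrC.
exact: exp_coeff_le_expR.
Qed.

Lemma cexp_series_bound w : exists B : R, forall n,
  cabs (w ^+ n / n`!%:R) <= B * 8^-1 ^+ n.
Proof.
have [B HB] := exp_coeff_le8 (cabs_ge0 w); exists B => n.
by rewrite cabsM cabsX cabsV cabs_nat.
Qed.

End ComplexBasics.

Lemma Re_iX (R : realType) (y : R) n :
  complex.Re (('i * y%:C) ^+ n / n`!%:R : R[i])%C = cos_coeff y n /\
  complex.Im (('i * y%:C) ^+ n / n`!%:R : R[i])%C = sin_coeff y n.
Proof.
have -> : (('i * y%:C) ^+ n / n`!%:R = 'i ^+ n * (y ^+ n / n`!%:R)%:C :> R[i])%C.
  by rewrite exprMn rmorphM/= rmorphXn fmorphV/= rmorph_nat mulrA.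
have -> : ('i ^+ n = (((~~ odd n)%:R * (-1) ^+ n./2)%:C
    + 'i * ((odd n)%:R * (-1) ^+ n./2)%:C) :> R[i])%C.
  rewrite -[n in LHS]odd_double_half addnC exprD -mul2n exprM sqr_i.
  case: (odd n); rewrite /= ?expr1 ?expr0 ?mul0r ?mul1r ?mulr1.
    by rewrite rmorph0 add0r rmorphXn rmorphN1 mulrC.
  by rewrite rmorph0 mulr0 addr0 rmorphXn rmorphN1.
rewrite ReM ImM ReD ImD ReM ImM /= !mulr0 !mul0r !mul1r !subr0 !add0r !addr0.
rewrite /cos_coeff /sin_coeff/=.
split.
  by rewrite -!mulrA.
case: (boolP (odd n)) => [on|_]; last by rewrite !mul0r.
by rewrite -!mulrA; case: n on => //= n on; rewrite uphalf_half (negPf on) add0n.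
Qed.

(** The exponential being given by exp, cos and sin of the real and imaginary
    parts, its power series is the Cauchy product of those of exp x and of
    cos y + i sin y. *)
Lemma cexp_series (R : realType) (w : R[i]) :
  ccvg (series (fun n => w ^+ n / n`!%:R)) (cexp w).
Proof.
have Hx (x : R) : ccvg (series (fun n => (x%:C ^+ n / n`!%:R : R[i])%C)) (expR x)%:C%C.
  have E n : (series (fun n => (x%:C ^+ n / n`!%:R : R[i])%C) n
      = (series (exp_coeff x) n)%:C)%C.
    rewrite /series/= rmorph_sum/=; apply: eq_bigr => i _.
    by rewrite rmorphM/= rmorphXn fmorphV/= rmorph_nat.
  apply/ccvg_ReIm; split.
    rewrite (_ : (fun n => _) = series (exp_coeff x)) //.
      exact: is_cvg_series_exp_coeff.
    by apply/funext => n; rewrite E.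
  by rewrite (_ : (fun n => _) = cst 0); [exact: cvg_cst|apply/funext => n; rewrite E].
have Hy (y : R) : ccvg (series (fun n => (('i * y%:C) ^+ n / n`!%:R : R[i])%C))
    (cos y +i* sin y)%C.
  apply/ccvg_ReIm; split => /=.
    rewrite (_ : (fun n => _) = series (cos_coeff y)); last first.
      apply/funext => n; rewrite /series/= Re_sum; apply: eq_bigr => i _.
      by rewrite (Re_iX y i).1.
    by rewrite cos.unlock; exact: is_cvg_series_cos_coeff.
  rewrite (_ : (fun n => _) = series (sin_coeff y)); last first.
    apply/funext => n; rewrite /series/= Im_sum; apply: eq_bigr => i _.
    by rewrite (Re_iX y i).2.
  by rewrite sin.unlock; exact: is_cvg_series_sin_coeff.
case: w => x y.
have [A HA] := cexp_series_bound (x%:C%C : R[i]).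
have [B HB] := cexp_series_bound (('i * y%:C)%C : R[i]).
have -> : cexp (x +i* y)%C = (expR x)%:C%C * (cos y +i* sin y)%C.
  by apply: complex_eq; rewrite /= !mul0r ?subr0 ?addr0.
apply: (ccvg_eq (ccvg_cauchy HA HB (Hx x) (Hy y))) => N.
apply: eq_bigr => n _.
have -> : (x +i* y)%C = 'i%C * y%:C%C + x%:C%C.
  by rewrite [LHS]complexE addrC.
rewrite exprDn mulr_suml; apply: eq_bigr => i _.
have ni : (i <= n)%N by rewrite -ltnS.
have f0 k : k`!%:R != 0 :> R[i] by rewrite pnatr_eq0 -lt0n fact_gt0.
have b0 : 'C(n, i)%:R != 0 :> R[i] by rewrite pnatr_eq0 -lt0n bin_gt0.
have := bin_fact ni => /(congr1 (fun k => k%:R : R[i])); rewrite !natrM => <-.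
rewrite -[_ *+ 'C(n, i)]mulr_natr.
move: (_ ^+ i) (_ ^+ (n - i)) => P Q.
move: (f0 i) (f0 (n - i)%N) b0; move: (i`!%:R) ((n - i)`!%:R) ('C(n, i)%:R) => u v b u0 v0 b0.
by field; rewrite u0 v0 b0.
Qed.

Arguments ccvg_cst {R} z.
Arguments cexp_series {R} w.

(** * Analytic functions and the identity theorem *)

Section PowerSeries.
Context {R : realType}.
Local Notation C := R[i].
Implicit Types (f g : C -> C) (z : C).

(** Analyticity at a point, with a radius r and the decay 8^-n of the terms at
    distance r. The decay leaves room for the factor n + 1 <= 2^n of a Cauchy
    product: a product only halves the radius. *)
Definition canal f z0 := exists (a : nat -> C) (r B : R), [/\ 0 < r,
  (forall n, cabs (a n) * r ^+ n <= B * 8^-1 ^+ n) &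
  forall h, cabs h <= r ->
    ccvg (series (fun n => a n * h ^+ n)) (f (z0 + h))].

(** The terms of a convergent series are bounded; dividing the radius by 8 turns
    this bound into the decay 8^-n. *)
Lemma analytic_canal f z0 : analytic_at f z0 -> canal f z0.
Proof.
move=> [a /nbhs_ballP[e /= e0 He]].
have [ea eb] : complex.Im e = 0 /\ 0 < complex.Re e.
  by move: e0; rewrite ltcE/= => /andP[/eqP-> ->].
have {}He h : cabs h < complex.Re e ->
    ccvg (series (fun n => a n * h ^+ n)) (f (z0 + h)).
  move=> hr; have := He (z0 + h); rewrite addrAC subrr add0r; apply.
  rewrite /ball/= opprD addNKr normrN normC_cabs.
  have -> : e = (complex.Re e)%:C%C by case: (e) ea => ? ? /= ->.
  by rewrite ltcR.
set r0 := complex.Re e / 2.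
have r00 : 0 < r0 by rewrite divr_gt0.
have r0e : r0 < complex.Re e by rewrite /r0; lra.
have [K HK] : exists K : R, forall n, cabs (a n) * r0 ^+ n <= K.
  have /He Hc : cabs r0%:C%C < complex.Re e by rewrite cabsR gtr0_norm.
  have [K HK] := ccvg_bounded Hc.
  exists (K + K) => n.
  have -> : cabs (a n) * r0 ^+ n = cabs (a n * r0%:C%C ^+ n).
    by rewrite cabsM cabsX cabsR gtr0_norm.
  have -> : a n * r0%:C%C ^+ n = series (fun n => a n * r0%:C%C ^+ n) n.+1
     - series (fun n => a n * r0%:C%C ^+ n) n.
    by rewrite /series/= big_nat_recr//= [X in X - _]addrC addrK.
  by rewrite (le_trans (cabsD _ _))// cabsN lerD.
exists a, (r0 / 8), K; split; first by rewrite divr_gt0.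
  by move=> n; rewrite exprMn mulrA ler_wpM2r// exprn_ge0.
move=> h hr; apply: He; rewrite (le_lt_trans hr)// (le_lt_trans _ r0e)//.
by rewrite ler_pdivrMr// ler_peMr ?ler1n// ltW.
Qed.

Lemma canal_shrink f z0 (r1 : R) : 0 < r1 -> canal f z0 ->
  exists (a : nat -> C) (r B : R), [/\ 0 < r, r <= r1,
  (forall n, cabs (a n) * r ^+ n <= B * 8^-1 ^+ n) &
  forall h, cabs h <= r ->
    ccvg (series (fun n => a n * h ^+ n)) (f (z0 + h))].
Proof.
move=> r10 [a [r [B [r0 aB fa]]]].
exists a, (Num.min r r1), B; split.
- by rewrite lt_min r0.
- by rewrite ge_min lexx orbT.
- move=> n; apply: le_trans (aB n); rewrite ler_wpM2l ?cabs_ge0//.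
  rewrite lerXn2r ?nnegrE ?ge_min ?lexx//; last exact: ltW.
  by rewrite le_min !ltW.
- by move=> h; rewrite le_min => /andP[hr _]; exact: fa.
Qed.

Lemma canal2 f g z0 : canal f z0 -> canal g z0 ->
  exists (a b : nat -> C) (r A B : R), [/\ 0 < r,
  (forall n, cabs (a n) * r ^+ n <= A * 8^-1 ^+ n) ,
  (forall n, cabs (b n) * r ^+ n <= B * 8^-1 ^+ n) ,
  (forall h, cabs h <= r ->
    ccvg (series (fun n => a n * h ^+ n)) (f (z0 + h))) &
  (forall h, cabs h <= r ->
    ccvg (series (fun n => b n * h ^+ n)) (g (z0 + h)))].
Proof.
move=> [a [r [A [r0 aA fa]]]] gz.
have [b [r' [B [r'0 r'r bB gb]]]] := canal_shrink r0 gz.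
exists a, b, r', A, B; split; [exact: r'0| |exact: bB| |exact: gb].
  move=> n; apply: le_trans (aA n); rewrite ler_wpM2l ?cabs_ge0//.
  by rewrite lerXn2r ?nnegrE// ltW.
by move=> h hr; apply: fa; exact: le_trans r'r.
Qed.

Lemma canalD f g z0 : canal f z0 -> canal g z0 ->
  canal (fun z => f z + g z) z0.
Proof.
move=> fz gz; have [a [b [r [A [B [r0 aA bB fa gb]]]]]] := canal2 fz gz.
exists (fun n => a n + b n), r, (A + B); split; first exact: r0.
  move=> n; rewrite mulrDl (le_trans _ (lerD (aA n) (bB n)))// -mulrDl.
  by apply: ler_wpM2r; [exact/exprn_ge0/ltW|exact: cabsD].
move=> h hr; apply: (ccvg_eq (ccvgD (fa h hr) (gb h hr))) => n.
by rewrite /series/= -big_split/=; apply: eq_bigr => i _; rewrite mulrDl.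
Qed.

Lemma canalM f g z0 : canal f z0 -> canal g z0 ->
  canal (fun z => f z * g z) z0.
Proof.
move=> fz gz; have [a [b [r [A [B [r0 aA bB fa gb]]]]]] := canal2 fz gz.
have A0 : 0 <= A.
  by have := aA 0%N; rewrite !expr0 !mulr1; apply: le_trans; exact: cabs_ge0.
have B0 : 0 <= B.
  by have := bB 0%N; rewrite !expr0 !mulr1; apply: le_trans; exact: cabs_ge0.
have le8 h (c : nat -> C) K : cabs h <= r ->
    (forall n, cabs (c n) * r ^+ n <= K * 8^-1 ^+ n) ->
    forall n, cabs (c n * h ^+ n) <= K * 8^-1 ^+ n.
  move=> hr cK n; apply: le_trans (cK n); rewrite cabsM cabsX.
  by rewrite ler_wpM2l ?cabs_ge0// lerXn2r ?nnegrE ?cabs_ge0// ltW.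
pose c n := \sum_(i < n.+1) a i * b (n - i)%N.
have Hc h : cabs h <= r ->
    ccvg (series (fun n => c n * h ^+ n)) (f (z0 + h) * g (z0 + h)).
  move=> hr.
  apply: (ccvg_eq (ccvg_cauchy (le8 _ _ _ hr aA) (le8 _ _ _ hr bB) (fa _ hr) (gb _ hr))).
  move=> N; apply: eq_bigr => n _; rewrite mulr_suml; apply: eq_bigr => i _.
  have ni : (i <= n)%N by rewrite -ltnS.
  by rewrite mulrACA -exprD subnKC.
have cK n : cabs (c n) * r ^+ n <= A * B * 4^-1 ^+ n.
  apply: (@le_trans _ _ (\sum_(i < n.+1) A * B * 8^-1 ^+ n)).
    apply: (@le_trans _ _ ((\sum_(i < n.+1) cabs (a i * b (n - i)%N)) * r ^+ n)).
      by apply: ler_wpM2r; [exact/exprn_ge0/ltW|exact: cabs_sum].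
    rewrite mulr_suml; apply: ler_sum => i _; rewrite cabsM.
    have ni : (i <= n)%N by rewrite -ltnS.
    rewrite -[in X in _ * r ^+ X](subnKC ni) exprD mulrACA.
    rewrite (le_trans (ler_pM _ _ (aA i) (bB _)))//.
    - by rewrite mulr_ge0 ?cabs_ge0// exprn_ge0// ltW.
    - by rewrite mulr_ge0 ?cabs_ge0// exprn_ge0// ltW.
    - by rewrite mulrACA -exprD subnKC.
  rewrite sumr_const card_ord -[_ *+ n.+1]mulr_natr.
  rewrite (_ : _ * n.+1%:R = A * B * (8^-1 ^+ n * n.+1%:R)); last by rewrite mulrA.
  apply: ler_wpM2l; first exact: mulr_ge0.
  have -> : (8^-1 : R) ^+ n = 4^-1 ^+ n * 2^-1 ^+ n.
    by rewrite -exprMn; congr (_ ^+ _); field.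
  rewrite -mulrA ler_piMr// ?exprn_ge0// ?invr_ge0//.
  rewrite exprVn ler_pdivrMl ?exprn_gt0// mulr1 -natrX ler_nat.
  exact: ltn_expl.
exists c, (r / 2), (A * B); split => [||h hr].
- by rewrite divr_gt0.
- move=> n; rewrite exprMn mulrA.
  have -> : (8^-1 : R) ^+ n = 4^-1 ^+ n * 2^-1 ^+ n.
    by rewrite -exprMn; congr (_ ^+ _); field.
  by rewrite mulrA ler_wpM2r// exprn_ge0// invr_ge0.
- by apply: Hc; rewrite (le_trans hr)//; lra.
Qed.

Lemma canal_cst (k z0 : C) : canal (fun=> k) z0.
Proof.
exists (fun n => if n == 0%N then k else 0), 1, (cabs k); split; first exact: ltr01.
  move=> [|n]; first by rewrite !expr0.
  by rewrite /= cabs0 mul0r mulr_ge0 ?cabs_ge0// expr8_ge0.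
move=> h _; apply/(ccvg_shift _ _ 1).
apply: (ccvg_eq (ccvg_cst k)) => n; rewrite addn1 /series/= big_nat_recl//=.
by rewrite expr0 mulr1 big1 ?addr0// => i _; rewrite mul0r.
Qed.

Lemma canal_id z0 : canal id z0.
Proof.
exists (fun n => if n == 0%N then z0 else (n == 1%N)%:R), 1, (8 * (cabs z0 + 1)).
split; first exact: ltr01.
  have c0 := cabs_ge0 z0.
  move=> [|[|n]]; rewrite ?expr0 ?expr1 ?expr1n ?mulr1/= ?cabs1 ?cabs0; [lra| lra|].
  by rewrite mulr_ge0 ?expr8_ge0// mulr_ge0// addr_ge0.
move=> h _; apply/(ccvg_shift _ _ 2).
apply: (ccvg_eq (ccvg_cst (z0 + h))) => n; rewrite addn2 /series/=.
rewrite big_nat_recl//= big_nat_recl//= expr0 expr1 mulr1 mul1r big1 ?addr0//.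
by move=> i _; rewrite mul0r.
Qed.

Lemma canalZ (k : C) f z0 : canal f z0 -> canal (fun z => k * f z) z0.
Proof. exact/canalM/canal_cst. Qed.

Lemma canalB f g z0 : canal f z0 -> canal g z0 -> canal (fun z => f z - g z) z0.
Proof.
move=> fz gz; have := canalD fz (canalZ (-1) gz).
by under [X in canal X _ -> _]eq_fun do rewrite mulN1r.
Qed.

Lemma canal_prod n (F : nat -> C -> C) z0 : (forall i, canal (F i) z0) ->
  canal (fun z => \prod_(i < n) F i z) z0.
Proof.
move=> FC; elim: n => [|n IHn].
  by under eq_fun do rewrite big_ord0; exact: canal_cst.
rewrite (_ : (fun z => _) = (fun z => (\prod_(i < n) F i z) * F n z)); last first.
  by apply/funext => z; rewrite big_ord_recr.
exact: (canalM IHn (FC n)).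
Qed.

Lemma sum_half_le1 (m N : nat) : \sum_(m <= i < N) (2^-1 : R) ^+ i.+1 <= 1.
Proof.
have [Nm|mN] := leqP N m; first by rewrite big_geq.
suff H M : (m <= M)%N -> \sum_(m <= i < M) (2^-1 : R) ^+ i.+1 <= 1 - 2^-1 ^+ M.
  by rewrite (le_trans (H _ (ltnW mN)))// lerBlDr lerDl exprn_ge0.
elim: M => [|M IHM]; first by rewrite leqn0 => /eqP->; rewrite big_geq// subrr.
rewrite leq_eqVlt ltnS => /orP[/eqP->|mM].
  by rewrite big_geq// subr_ge0 exprn_ile1// invf_le1// ler1n.
rewrite big_nat_recr//= (le_trans (lerD (IHM mM) (lexx _)))//.
by rewrite exprS; lra.
Qed.

(** If the coefficients of index less than n vanish, the equation f (z0 + h j) = 0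
    bounds the n-th one by a multiple of the modulus of h j, since the terms of
    higher index are of order n + 1; hence all coefficients vanish by induction. *)
Lemma canal_zero f z0 (h : nat -> C) : canal f z0 ->
  (forall j, h j != 0) -> (fun j => cabs (h j)) @ \oo --> (0 : R) ->
  (forall j, f (z0 + h j) = 0) ->
  exists2 r : R, 0 < r & forall k, cabs k <= r -> f (z0 + k) = 0.
Proof.
move=> [a [r [B [r0 aB fa]]]] h0 hcvg fh; exists r => // k kr.
have B0 : 0 <= B.
  by have := aB 0%N; rewrite !expr0 !mulr1; apply: le_trans; exact: cabs_ge0.
suff a0 n : a n = 0.
  apply: (ccvg_unique (fa k kr)); apply: (ccvg_eq (ccvg_cst 0)) => n.
  by rewrite /series/= big1// => i _; rewrite a0 mul0r.
elim/ltn_ind: n => n IH.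
have key j : cabs (h j) <= r -> cabs (a n) <= cabs (h j) * (2 * B / r ^+ n.+1).
  move=> hr; set q := cabs (h j).
  have q0 : 0 < q by rewrite cabs_gt0.
  have := fa _ hr; rewrite fh => /ccvgP H.
  rewrite -(ler_pM2r (exprn_gt0 n q0)) [leRHS]mulrAC -exprS.
  apply/ler_addgt0Pr => e e0; have [N0 HN0] := H _ e0.
  pose N := maxn N0 n.+1.
  have := HN0 N (leq_maxl _ _); rewrite subr0 /series/=.
  rewrite (@big_cat_nat _ _ _ n.+1)//= ?leq_maxr// big_nat_recr//=.
  rewrite big_nat big1 => [|i /andP[_ ni]]; last by rewrite IH// mul0r.
  rewrite add0r => HS.
  set T := \sum_(n.+1 <= i < N) _ in HS.
  have TB : cabs T <= q ^+ n.+1 * (2 * B / r ^+ n.+1).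
    have tb i : (n.+1 <= i)%N ->
        cabs (a i * h j ^+ i) <= (q / r) ^+ n.+1 * B * 2^-1 ^+ i.+1 * 2.
      move=> ni; rewrite cabsM cabsX -/q.
      rewrite (@le_trans _ _ ((q / r) ^+ i * (B * 8^-1 ^+ i)))//.
        rewrite (_ : (q / r) ^+ i * (B * 8^-1 ^+ i)
            = (B * 8^-1 ^+ i / r ^+ i) * q ^+ i); last first.
          by rewrite expr_div_n; ring.
        apply: ler_wpM2r; first by rewrite exprn_ge0// ltW.
        by rewrite ler_pdivlMr ?exprn_gt0.
      rewrite -!mulrA; apply: ler_pM.
      + by rewrite exprn_ge0// divr_ge0// ltW.
      + by rewrite mulr_ge0// expr8_ge0.
      + by apply: ler_wiXn2l => //; rewrite ?divr_ge0 ?(ltW q0) ?(ltW r0)// ler_pdivrMr ?mul1r.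
      rewrite ler_wpM2l// exprS mulrAC mulVf// mul1r.
      rewrite lerXn2r ?nnegrE ?invr_ge0//.
      by rewrite lef_pV2 ?posrE// ler_nat.
    rewrite (le_trans (cabs_sum _ _ _))//.
    rewrite (@le_trans _ _ (\sum_(n.+1 <= i < N) (q / r) ^+ n.+1 * B * 2 * 2^-1 ^+ i.+1))//.
      rewrite big_nat [leRHS]big_nat; apply: ler_sum => i /andP[ni _].
      by rewrite (le_trans (tb i ni))// -!mulrA [2 * _]mulrC.
    rewrite -mulr_sumr exprMn exprVn.
    rewrite (_ : q ^+ n.+1 * (2 * B / r ^+ n.+1) = (q ^+ n.+1 / r ^+ n.+1 * B * 2) * 1); last by ring.
    rewrite ler_wpM2l//; first by rewrite !mulr_ge0// ?invr_ge0 ?exprn_ge0 ?(ltW q0) ?(ltW r0).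
    exact: sum_half_le1.
  have -> : cabs (a n) * q ^+ n = cabs (a n * h j ^+ n + T - T).
    by rewrite addrK cabsM cabsX.
  rewrite (le_trans (cabsD _ _))// cabsN addrC lerD// ltW//.
apply/eqP; rewrite -cabs_eq0 eq_le cabs_ge0 andbT.
set K := 2 * B / r ^+ n.+1 in key.
have HK : (fun j => cabs (h j) * K) @ \oo --> 0 * K.
  by apply: cvgM => //; exact: cvg_cst.
rewrite mul0r in HK.
rewrite -(cvg_lim _ HK)//.
apply: limr_ge; first by apply/cvg_ex; exists 0.
move/cvgrPdist_le : hcvg => /(_ _ r0)[M _ HM].
exists M => // j Mj /=; apply: key.
by have := HM j Mj; rewrite /= sub0r normrN; apply: le_trans; rewrite ler_norm.
Qed.

(** Let T be the supremum of the parameters up to which f vanishes on the segment.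
    Zeros accumulate at T, so f vanishes near it by [canal_zero], and T can only
    be the end of the segment. *)
Lemma identity_segment f (p v : C) :
  (forall t : R, 0 <= t <= 1 -> canal f (p + t%:C%C * v)) ->
  (exists2 r : R, 0 < r & forall h, cabs h <= r -> f (p + h) = 0) ->
  f (p + v) = 0.
Proof.
move=> fan [r r0 fr].
have [v0|v0] := eqVneq v 0; first by rewrite v0 fr// cabs0 ltW.
have cv0 : 0 < cabs v by rewrite cabs_gt0.
pose A := [set t : R | 0 <= t <= 1 /\
  forall t', 0 <= t' <= t -> f (p + t'%:C%C * v) = 0].
have grow t0 (d : R) : 0 < d -> 0 <= t0 <= 1 ->
    (forall k, cabs k <= d -> f (p + t0%:C%C * v + k) = 0) ->
    forall t', t0 <= t' <= t0 + d / cabs v -> f (p + t'%:C%C * v) = 0.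
  move=> d0 t01 fd t' /andP[t0t' t't].
  have -> : p + t'%:C%C * v = p + t0%:C%C * v + (t' - t0)%:C%C * v.
    by rewrite rmorphB/=; ring.
  apply: fd; rewrite cabsM cabsR ger0_norm ?subr_ge0// -ler_pdivlMr//.
  by rewrite lerBlDl.
have A0 : A (Num.min 1 (r / cabs v)).
  split; first by rewrite le_min ler01 divr_ge0 ?(ltW r0) ?(ltW cv0)//= ge_min lexx.
  move=> t' /andP[t'0]; rewrite le_min => /andP[_ t'r].
  apply: (grow 0 r) => //; first by rewrite lexx ler01.
    by move=> k kr; rewrite rmorph0 mul0r addr0 fr.
  by rewrite t'0 add0r.
have hA : has_sup A by split; [eexists; exact: A0|exists 1 => t [/andP[]]].
set T := sup A.
have T0 : 0 < T.
  rewrite (lt_le_trans _ (ub_le_sup _ A0))//; last by case: hA.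
  by rewrite lt_min ltr01 divr_gt0.
have T1 : T <= 1 by apply: ge_sup; [eexists; exact: A0| move=> t [/andP[]]].
have zT t : 0 <= t < T -> f (p + t%:C%C * v) = 0.
  move=> /andP[t0 tT]; have [u [_ Au] tu] := @sup_adherent _ A (T - t) (etrans (subr_gt0 _ _) tT) hA.
  apply: Au; rewrite t0/= ltW//.
  by move: tu; rewrite opprB addrC subrK.
pose h (j : nat) : C := (- (T / j.+2%:R))%:C%C * v.
have hT j : T / j.+2%:R < T by rewrite ltr_pdivrMr// ltr_pMr// ltr1n.
have [d d0 fd] : exists2 d : R, 0 < d &
    forall k, cabs k <= d -> f (p + T%:C%C * v + k) = 0.
  apply: (@canal_zero _ _ h).
  - by apply: fan; rewrite T1 ltW.
  - move=> j; rewrite mulf_neq0// -cabs_eq0 cabsR normrN normr_eq0.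
    by rewrite mulf_neq0 ?invr_eq0 ?pnatr_eq0// gt_eqF.
  - rewrite (_ : (fun j => _) = (fun j => `|T| / j.+2%:R * cabs v)); last first.
      by apply/funext => j; rewrite cabsM cabsR normrN normrM normfV normr_nat.
    rewrite (_ : 0 = `|T| * 0 * cabs v); last by rewrite mulr0 mul0r.
    apply: cvgM; last exact: cvg_cst.
    apply: cvgM; first exact: cvg_cst.
    have := @cvg_harmonic R; rewrite -(cvg_shiftn 1)/=.
    by apply: cvg_trans; apply: near_eq_cvg; near=> n; rewrite /= addn1.
  - move=> j.
    have -> : p + T%:C%C * v + h j = p + (T - T / j.+2%:R)%:C%C * v.
      by rewrite /h rmorphB rmorphN/=; ring.
    apply: zT; rewrite subr_ge0 ltW//= ltrBlDr ltrDl.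
    by rewrite divr_gt0.
pose T' := Num.min 1 (T + d / cabs v).
have AT' : A T'.
  split; first by rewrite le_min ler01/= ge_min lexx andbT addr_ge0 ?(ltW T0)// divr_ge0 ?(ltW d0) ?(ltW cv0).
  move=> t' /andP[t'0]; rewrite le_min => /andP[_ t'd].
  have [t'T|Tt'] := ltP t' T; first by rewrite zT// t'0.
  by apply: (grow T d) => //; rewrite ?T1 ?Tt' ?(ltW T0).
have : T' <= T by apply: ub_le_sup AT'; case: hA.
rewrite /T' ge_min => /orP[T1'|]; last first.
  by rewrite gerDl leNgt divr_gt0.
have [_ /(_ 1)] := AT'; rewrite mul1r; apply.
rewrite ler01 /T' le_min lexx/= (le_trans T1')// lerDl ltW// divr_gt0//.
Unshelve. all: by end_near. Qed.

(** A segment joins s to a point p of the half plane where f is known to vanish.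
    It has to avoid 1: p is taken at the height of s when s is not real, and at
    height 1 otherwise, so that only s itself may be real. *)
Lemma identity_halfplane f (c C0 : R) :
  (forall s, c < complex.Re s -> s != 1 -> canal f s) ->
  (forall s, C0 < complex.Re s -> f s = 0) ->
  forall s, c < complex.Re s -> s != 1 -> f s = 0.
Proof.
move=> fan f0 s cs s1.
pose x0 := Num.max C0 (complex.Re s) + 1.
pose y0 := if complex.Im s == 0 then 1 else complex.Im s.
pose p := (x0 +i* y0)%C.
have -> : s = p + (s - p) by rewrite addrC subrK.
have x0C : C0 < x0 by rewrite /x0 ltr_pwDr// le_max lexx.
have x0s : complex.Re s <= x0 by rewrite /x0 ler_wpDr// le_max lexx orbT.
apply: identity_segment; last first.
  exists ((x0 - C0) / 2); first by rewrite divr_gt0// subr_gt0.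
  move=> h hr; apply: f0; rewrite ReD/=.
  have := le_trans (normr_Re_le h) hr; rewrite ler_norml => /andP[+ _].
  lra.
move=> t /andP[t0 t1]; apply: fan.
  rewrite ReD ReM/= ReD ReN/= mul0r subr0.
  rewrite (_ : x0 + _ = complex.Re s + (1 - t) * (x0 - complex.Re s)); last by ring.
  by apply: ltr_wpDr => //; rewrite mulr_ge0 ?subr_ge0.
have [Is|Is] := eqVneq (complex.Im s) 0.
  have [->|t1'] := eqVneq t 1; first by rewrite mul1r addrC subrK.
  apply/eqP => /(congr1 (@complex.Im R)); rewrite ImD ImM/= ImD ImN/= Is /y0 Is eqxx.
  rewrite mul0r addr0 add0r mulrN1 => /eqP.
  by rewrite subr_eq0 eq_sym (negPf t1').
apply/eqP => /(congr1 (@complex.Im R)); rewrite ImD ImM/= ImD ImN/= /y0 (negPf Is).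
rewrite subrr mulr0 mul0r !addr0 => /eqP.
by rewrite (negPf Is).
Qed.

End PowerSeries.

(** * Complex integrals and Laplace transforms *)

Section ExpBounds.
Context {R : realType}.

Lemma cabs_exp_series_le (w : R[i]) n :
  cabs (series (fun n => w ^+ n / n`!%:R) n) <= expR (cabs w).
Proof.
apply: le_trans (series_exp_coeff_le n (cabs_ge0 w)).
rewrite (le_trans (cabs_sum _ _ _))// ler_sum// => i _.
by rewrite cabsM cabsX cabsV cabs_nat.
Qed.

(** The majorant of [lap_analytic]: between two abscissae a and b, the exponential
    weight with the margin r is dominated by the weights at a and at b. *)
Lemma expR_two_sided (a b c r l : R) : a <= c - r -> c + r <= b ->
  expR (c * l) * expR (r * `|l|) <= expR (a * l) + expR (b * l).
Proof.
move=> ac cb; rewrite -expRD; have [l0|l0] := leP 0 l.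
  apply: ler_wpDl; first exact: expR_ge0.
  by rewrite ler_expR ger0_norm// -mulrDl ler_wpM2r.
apply: ler_wpDr; first exact: expR_ge0.
by rewrite ler_expR (ltr0_norm l0) mulrN -mulrBl ler_wnM2r// ltW.
Qed.

End ExpBounds.

Section ComplexIntegral.
Context d (T : measurableType d) (R : realType).
Variable mu : {measure set T -> \bar R}.
Implicit Types (D : set T) (f g : T -> R[i]).

Definition cint D f : R[i] :=
  ((\int[mu]_(x in D) complex.Re (f x)) +i* (\int[mu]_(x in D) complex.Im (f x)))%C.

Definition cmeas D f := measurable_fun D (fun x => complex.Re (f x)) /\
  measurable_fun D (fun x => complex.Im (f x)).

Definition cintegrable D f :=
  mu.-integrable D (EFin \o (fun x => complex.Re (f x))) /\
  mu.-integrable D (EFin \o (fun x => complex.Im (f x))).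

Lemma cmeasD D f g : cmeas D f -> cmeas D g -> cmeas D (fun x => f x + g x).
Proof.
move=> [f1 f2] [g1 g2]; split.
  by under eq_fun do rewrite ReD; exact: measurable_funD.
by under eq_fun do rewrite ImD; exact: measurable_funD.
Qed.

Lemma cmeasM D f g : cmeas D f -> cmeas D g -> cmeas D (fun x => f x * g x).
Proof.
move=> [f1 f2] [g1 g2]; split.
  by under eq_fun do rewrite ReM; apply: measurable_funB; exact: measurable_funM.
by under eq_fun do rewrite ImM; apply: measurable_funD; exact: measurable_funM.
Qed.

Lemma cmeas_cst D k : cmeas D (fun=> k).
Proof. by split; exact: measurable_cst. Qed.

Lemma cmeas_real D (h : T -> R) : measurable_fun D h -> cmeas D (fun x => (h x)%:C%C).
Proof. by move=> mh; split=> //=; exact: measurable_cst. Qed.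

Lemma cmeas_sum D (F : nat -> T -> R[i]) n : (forall i, cmeas D (F i)) ->
  cmeas D (fun x => series (fun i => F i x) n).
Proof.
move=> mF; elim: n => [|n IH].
  by under [X in cmeas _ X]eq_fun do rewrite /series/= big_nil; exact: cmeas_cst.
under [X in cmeas _ X]eq_fun do rewrite /series/= big_nat_recr//=.
exact: cmeasD.
Qed.

Lemma cmeasX D f n : cmeas D f -> cmeas D (fun x => f x ^+ n).
Proof.
move=> mf; elim: n => [|n IH].
  by under [X in cmeas _ X]eq_fun do rewrite expr0; exact: cmeas_cst.
by under [X in cmeas _ X]eq_fun do rewrite exprS; exact: cmeasM.
Qed.

Lemma cmeas_cexp D f : measurable D -> cmeas D f -> cmeas D (fun x => cexp (f x)).
Proof.
move=> mD [f1 f2]; split => /=.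
  apply: measurable_funM; first exact: measurableT_comp.
  by apply: measurableT_comp => //; apply: continuous_measurable_fun; exact: continuous_cos.
apply: measurable_funM; first exact: measurableT_comp.
by apply: measurableT_comp => //; apply: continuous_measurable_fun; exact: continuous_sin.
Qed.

Lemma cintegrable_le D f (g : T -> R) : measurable D -> cmeas D f ->
  mu.-integrable D (EFin \o g) -> (forall x, D x -> cabs (f x) <= g x) ->
  cintegrable D f.
Proof.
move=> mD [f1 f2] ig fg; split; apply: (le_integrable mD _ _ ig).
- exact/measurable_EFinP.
- move=> x Dx; rewrite lee_fin (le_trans (normr_Re_le _))//.
  by rewrite (le_trans (fg _ Dx))// ler_norm.
- exact/measurable_EFinP.
- move=> x Dx; rewrite lee_fin (le_trans (normr_Im_le _))//.
  by rewrite (le_trans (fg _ Dx))// ler_norm.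
Qed.

Lemma cintegrable_cmeas D f : cintegrable D f -> cmeas D f.
Proof. by move=> [/integrableP[/measurable_EFinP ? _] /integrableP[/measurable_EFinP ? _]]. Qed.

Lemma cabs_cint_le D f (g : T -> R) : measurable D -> cmeas D f ->
  mu.-integrable D (EFin \o g) -> (forall x, D x -> cabs (f x) <= g x) ->
  cabs (cint D f) <= 2 * \int[mu]_(x in D) g x.
Proof.
move=> mD mf ig fg; have [i1 i2] := cintegrable_le mD mf ig fg.
rewrite (le_trans (cabs_le_ReIm _))//= mulr_natl mulr2n lerD//.
  rewrite (le_trans (le_normr_Rintegral mD i1))// le_Rintegral//.
    by have := integrable_norm i1.
  by move=> x Dx; rewrite (le_trans (normr_Re_le _))// fg.
rewrite (le_trans (le_normr_Rintegral mD i2))// le_Rintegral//.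
  by have := integrable_norm i2.
by move=> x Dx; rewrite (le_trans (normr_Im_le _))// fg.
Qed.

Lemma eq_cint D f g : (forall x, D x -> f x = g x) -> cint D f = cint D g.
Proof.
by move=> fg; apply: complex_eq => /=; apply: eq_Rintegral => x /set_mem/fg ->.
Qed.

Lemma cintegrableD D f g : measurable D -> cintegrable D f -> cintegrable D g ->
  cintegrable D (fun x => f x + g x).
Proof.
move=> mD [f1 f2] [g1 g2]; split.
  rewrite (_ : _ \o _ = (EFin \o (fun x => complex.Re (f x))) \+
     (EFin \o (fun x => complex.Re (g x)))); last by apply/funext => x /=; rewrite ReD.
  exact: integrableD.
rewrite (_ : _ \o _ = (EFin \o (fun x => complex.Im (f x))) \+
   (EFin \o (fun x => complex.Im (g x)))); last by apply/funext => x /=; rewrite ImD.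
exact: integrableD.
Qed.

Lemma cintegrableZ D (k : R[i]) f : measurable D -> cintegrable D f ->
  cintegrable D (fun x => k * f x).
Proof.
move=> mD [f1 f2].
have Z (c : R) (h : T -> R) : mu.-integrable D (EFin \o h) ->
    mu.-integrable D (EFin \o (fun x => c * h x)).
  by move=> ih; have := integrableZl mD c ih.
split.
  rewrite (_ : _ \o _ = (EFin \o (fun x => complex.Re k * complex.Re (f x))) \+
     (EFin \o (fun x => - complex.Im k * complex.Im (f x)))).
    by apply: integrableD => //; exact: Z.
  by apply/funext => x /=; rewrite ReM mulNr.
rewrite (_ : _ \o _ = (EFin \o (fun x => complex.Re k * complex.Im (f x))) \+
   (EFin \o (fun x => complex.Im k * complex.Re (f x)))).
  by apply: integrableD => //; exact: Z.
by apply/funext => x /=; rewrite ImM.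
Qed.

Lemma cintD D f g : measurable D -> cintegrable D f -> cintegrable D g ->
  cint D (fun x => f x + g x) = cint D f + cint D g.
Proof.
move=> mD [f1 f2] [g1 g2]; apply: complex_eq; rewrite ?ReD ?ImD /=.
  by rewrite -RintegralD//; apply: eq_Rintegral => x _; rewrite ReD.
by rewrite -RintegralD//; apply: eq_Rintegral => x _; rewrite ImD.
Qed.

Lemma cintZ D (k : R[i]) f : measurable D -> cintegrable D f ->
  cint D (fun x => k * f x) = k * cint D f.
Proof.
move=> mD [f1 f2].
have Z (c : R) (h : T -> R) : mu.-integrable D (EFin \o h) ->
    mu.-integrable D (EFin \o (fun x => c * h x)).
  by move=> ih; have := integrableZl mD c ih.
apply: complex_eq; rewrite ?ReM ?ImM /=.
  rewrite -!RintegralZl// -RintegralB//; try exact: Z.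
  by apply: eq_Rintegral => x _; rewrite ReM.
rewrite -!RintegralZl// -RintegralD//; try exact: Z.
by apply: eq_Rintegral => x _; rewrite ImM.
Qed.

Lemma cint_series D (F : nat -> T -> R[i]) n : measurable D ->
  (forall i, cintegrable D (F i)) ->
  cintegrable D (fun x => series (fun i => F i x) n) /\
  cint D (fun x => series (fun i => F i x) n) = series (fun i => cint D (F i)) n.
Proof.
move=> mD iF; elim: n => [|n [IH1 IH2]].
  have -> : (fun x => series (fun i => F i x) 0) = (fun=> 0).
    by apply/funext => x; rewrite /series/= big_nil.
  split; first by split; exact: integrable0.
  rewrite [RHS]/series/= big_nil; apply: complex_eq => /=;
    by rewrite /Rintegral integral0.
have -> : (fun x => series (fun i => F i x) n.+1) =
    (fun x => series (fun i => F i x) n + F n x).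
  by apply/funext => x; rewrite /series/= big_nat_recr.
split; first exact: cintegrableD.
by rewrite cintD// IH2 [RHS]/series/= big_nat_recr.
Qed.

Lemma Rintegral_cvg D (F : nat -> T -> R) (f g : T -> R) : measurable D ->
  (forall n, measurable_fun D (F n)) ->
  mu.-integrable D (EFin \o g) ->
  (forall n x, D x -> `|F n x| <= g x) ->
  (forall x, D x -> (fun n => F n x) @ \oo --> f x) ->
  mu.-integrable D (EFin \o f) /\
  (fun n => \int[mu]_(x in D) F n x) @ \oo --> \int[mu]_(x in D) f x.
Proof.
move=> mD mF ig Fg Ff.
have mf : measurable_fun D f.
  by apply: (measurable_fun_cvg mF) => x Dx; exact: Ff.
have H1 : {ae mu, forall x, D x -> (EFin \o F n) x @[n --> \oo] --> (EFin \o f) x}.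
  by apply: aeW => x Dx; apply: cvg_EFin; [exact: nearW|exact: Ff].
have H2 : {ae mu, forall x n, D x -> (`|(EFin \o F n) x| <= (EFin \o g) x)%E}.
  by apply: aeW => x n Dx; rewrite /= lee_fin Fg.
have [i_f _ H] := @dominated_convergence _ _ _ mu D mD (fun n => EFin \o F n)
  (EFin \o f) (EFin \o g) (fun n => (measurable_EFinP _ _).2 (mF n))
  ((measurable_EFinP _ _).2 mf) H1 ig H2.
split=> //; apply: fine_cvg; rewrite fineK//.
exact: integrable_fin_num.
Qed.

Lemma cint_cvg D (F : nat -> T -> R[i]) f (g : T -> R) : measurable D ->
  (forall n, cmeas D (F n)) ->
  mu.-integrable D (EFin \o g) ->
  (forall n x, D x -> cabs (F n x) <= g x) ->
  (forall x, D x -> ccvg (fun n => F n x) (f x)) ->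
  ccvg (fun n => cint D (F n)) (cint D f).
Proof.
move=> mD mF ig Fg Ff; apply/ccvg_ReIm; split => /=.
  apply: (Rintegral_cvg mD (fun n => (mF n).1) ig _ _).2.
    by move=> n x Dx; rewrite (le_trans (normr_Re_le _))// Fg.
  by move=> x Dx; have /ccvg_ReIm[] := Ff x Dx.
apply: (Rintegral_cvg mD (fun n => (mF n).2) ig _ _).2.
  by move=> n x Dx; rewrite (le_trans (normr_Im_le _))// Fg.
by move=> x Dx; have /ccvg_ReIm[] := Ff x Dx.
Qed.

(** With l = ln the exponential is x^s, as in a Mellin transform; with l = id this
    is a two-sided Laplace transform. *)
Definition lap D (h l : T -> R) (s : R[i]) : R[i] :=
  cint D (fun x => (h x)%:C%C * cexp (s * (l x)%:C%C)).

Lemma cabs_lap_integrand (s : R[i]) (h l : R) :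
  cabs (h%:C%C * cexp (s * l%:C%C)) = `|h| * expR (complex.Re s * l).
Proof. by rewrite cabsM cabsR cabs_cexp ReM/= mulr0 subr0. Qed.

Lemma Re_lap_real D (h l : T -> R) (x : R) :
  complex.Re (lap D h l x%:C%C) = \int[mu]_(t in D) (h t * expR (x * l t)).
Proof.
rewrite [LHS]/(Rintegral _ _ _); apply: eq_Rintegral => t _.
by rewrite -[x%:C%C * _]realCM cexpR -realCM.
Qed.

Lemma cmeas_lap D (h l : T -> R) s : measurable D -> measurable_fun D h ->
  measurable_fun D l -> cmeas D (fun x => (h x)%:C%C * cexp (s * (l x)%:C%C)).
Proof.
move=> mD mh ml; apply: cmeasM; first exact: cmeas_real.
by apply: cmeas_cexp => //; apply: cmeasM; [exact: cmeas_cst|exact: cmeas_real].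
Qed.

Lemma lap_integrable D (h l : T -> R) s : measurable D -> measurable_fun D h ->
  measurable_fun D l ->
  mu.-integrable D (EFin \o (fun x => h x * expR (complex.Re s * l x))) ->
  cintegrable D (fun x => (h x)%:C%C * cexp (s * (l x)%:C%C)).
Proof.
move=> mD mh ml i_h; apply: (cintegrable_le mD (cmeas_lap _ mD mh ml)
  (integrable_norm i_h)) => x _.
by rewrite cabs_lap_integrand /= normrM (ger0_norm (expR_ge0 _)).
Qed.

(** Expanding cexp (k l) in powers of k gives a series whose partial sums are
    dominated by the integrand at the ends a and b of the strip, so that it can
    be integrated term by term. The radius is an eighth of the distance to the
    ends: the decay 8^-n of the definition of [canal] then follows from
    |l|^n / n! <= (8 r)^-n exp (8 r |l|). *)
Theorem lap_analytic D (h l : T -> R) (a b : R) s : measurable D ->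
  measurable_fun D h -> measurable_fun D l ->
  mu.-integrable D (EFin \o (fun x => h x * expR (a * l x))) ->
  mu.-integrable D (EFin \o (fun x => h x * expR (b * l x))) ->
  a < complex.Re s < b -> canal (lap D h l) s.
Proof.
move=> mD mh ml ia ib /andP[as_ sb].
pose r := Num.min (complex.Re s - a) (b - complex.Re s) / 8.
have r0 : 0 < r by rewrite divr_gt0// lt_min !subr_gt0 as_.
have r8a : a <= complex.Re s - 8 * r.
  rewrite /r mulrC divfK// lerBrDl -lerBrDr ge_min.
  by rewrite (_ : complex.Re s - a <= _)// lexx.
have r8b : complex.Re s + 8 * r <= b.
  by rewrite /r mulrC divfK// -lerBrDl ge_min lexx orbT.
pose g x := `|h x| * (expR (a * l x) + expR (b * l x)).
have ig : mu.-integrable D (EFin \o g).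
  rewrite (_ : _ \o _ = (EFin \o (fun x => `|h x * expR (a * l x)|)) \+
      (EFin \o (fun x => `|h x * expR (b * l x)|))).
    by apply: integrableD => //; exact: integrable_norm.
  apply/funext => x /=; rewrite /g mulrDr !normrM.
  by rewrite !(ger0_norm (expR_ge0 _)).
pose c n x := (h x)%:C%C * cexp (s * (l x)%:C%C) * ((l x)%:C%C ^+ n / n`!%:R).
have mc n : cmeas D (c n).
  apply: cmeasM; first exact: cmeas_lap.
  by apply: cmeasM; [apply/cmeasX/cmeas_real|exact: cmeas_cst].
have r8 : 0 < 8 * r by rewrite mulr_gt0.
have cg n x : D x -> cabs (c n x) <= (8 * r) ^- n * g x.
  move=> Dx; rewrite ler_pdivlMl ?exprn_gt0// /c cabsM cabs_lap_integrand.
  rewrite cabsM cabsX cabsR cabsV cabs_nat.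
  rewrite [leLHS](_ : _ = `|h x| * (expR (complex.Re s * l x) *
     ((8 * r * `|l x|) ^+ n / n`!%:R))); last by rewrite [(_ * `|l x|) ^+ n]exprMn; ring.
  rewrite /g ler_wpM2l// (le_trans _ (expR_two_sided _ r8a r8b))//.
  by rewrite ler_wpM2l ?expR_ge0// exp_coeff_le_expR// mulr_ge0// ltW.
have ign n : mu.-integrable D (EFin \o (fun x => (8 * r) ^- n * g x)).
  by have := integrableZl mD ((8 * r) ^- n) ig.
have ic n : cintegrable D (c n) by exact: cintegrable_le (ign n) (cg n).
exists (fun n => cint D (c n)), r, (2 * \int[mu]_(x in D) g x); split => //.
  move=> n; have := cabs_cint_le mD (mc n) (ign n) (cg n).
  rewrite RintegralZl// => H.
  rewrite (@le_trans _ _ ((2 * ((8 * r) ^- n * \int[mu]_(x in D) g x)) * r ^+ n))//.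
    by rewrite ler_wpM2r// exprn_ge0// ltW.
  rewrite le_eqVlt; apply/orP; left; apply/eqP.
  rewrite exprMn invfM exprVn.
  by field; rewrite ?expf_neq0// gt_eqF.
move=> k kr.
have Hs N : series (fun n => cint D (c n) * k ^+ n) N =
    cint D (fun x => series (fun n => k ^+ n * c n x) N).
  have [_ ->] := @cint_series D (fun n x => k ^+ n * c n x) N mD
    (fun n => cintegrableZ (k ^+ n) mD (ic n)).
  by apply: eq_bigr => n _; rewrite cintZ// mulrC.
apply: (@ccvg_eq _ (fun N => cint D (fun x => series (fun n => k ^+ n * c n x) N))).
  2: by move=> N; rewrite Hs.
have E N x : series (fun n => k ^+ n * c n x) N = (h x)%:C%C * cexp (s * (l x)%:C%C) *
    series (fun n => (k * (l x)%:C%C) ^+ n / n`!%:R) N.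
  rewrite /series/= mulr_sumr; apply: eq_bigr => n _.
  by rewrite /c exprMn; ring.
apply: (cint_cvg mD _ ig).
- by move=> n; apply: cmeas_sum => i; apply: cmeasM => //; exact: cmeas_cst.
- move=> n x Dx; rewrite E cabsM cabs_lap_integrand -mulrA /g ler_wpM2l//.
  apply: le_trans (expR_two_sided _ r8a r8b).
  rewrite ler_wpM2l ?expR_ge0//.
  rewrite (le_trans (cabs_exp_series_le _ _))// ler_expR cabsM cabsR.
  by rewrite ler_wpM2r// (le_trans kr)// ler_peMl ?ler1n// ltW.
- move=> x Dx; apply: (@ccvg_eq _ (fun N => (h x)%:C%C * cexp (s * (l x)%:C%C) *
    series (fun n => (k * (l x)%:C%C) ^+ n / n`!%:R) N)); last first.
    by move=> n; rewrite E.
  rewrite mulrDl cexpD mulrA.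
  exact: (ccvgM (ccvg_cst _) (cexp_series _)).
Qed.

(** The terms being nonnegative, the sum dominates all the partial sums. *)
Lemma lap_series D (h : nat -> T -> R) (H l : T -> R) s : measurable D ->
  (forall n, measurable_fun D (h n)) -> measurable_fun D l ->
  (forall n x, D x -> 0 <= h n x) ->
  (forall x, D x -> (fun N => \sum_(0 <= n < N) h n x) @ \oo --> H x) ->
  mu.-integrable D (EFin \o (fun x => H x * expR (complex.Re s * l x))) ->
  ccvg (series (fun n => lap D (h n) l s)) (lap D H l s).
Proof.
move=> mD mh ml h0 hH iH.
have leH N x : D x -> \sum_(0 <= n < N) h n x <= H x.
  move=> Dx; rewrite -(cvg_lim _ (hH x Dx))//; apply: nondecreasing_cvgn_le.
    apply/nondecreasing_seqP => k; rewrite big_nat_recr//= lerDl.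
    exact: h0.
  by apply/cvg_ex; exists (H x); exact: hH.
have lehH n x : D x -> h n x <= H x.
  move=> Dx; apply: le_trans (leH n.+1 _ Dx); rewrite big_nat_recr//= lerDr.
  by apply: sumr_ge0 => i _; exact: h0.
have ih n : cintegrable D (fun x => (h n x)%:C%C * cexp (s * (l x)%:C%C)).
  apply: (cintegrable_le mD (cmeas_lap _ mD (mh n) ml) iH) => x Dx.
  rewrite cabs_lap_integrand ler_wpM2r ?expR_ge0// ger0_norm ?h0//.
  exact: lehH.
have := @cint_cvg D (fun N x => series (fun n => (h n x)%:C%C * cexp (s * (l x)%:C%C)) N)
  (fun x => (H x)%:C%C * cexp (s * (l x)%:C%C))
  (fun x => H x * expR (complex.Re s * l x)) mD.
move=> /(_ _ iH) HH.
have E N x : series (fun n => (h n x)%:C%C * cexp (s * (l x)%:C%C)) N =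
    (\sum_(0 <= n < N) h n x)%:C%C * cexp (s * (l x)%:C%C).
  by rewrite /series/= rmorph_sum/= mulr_suml.
apply: (@ccvg_eq _ (fun N => cint D (fun x => series (fun n => (h n x)%:C%C * cexp (s * (l x)%:C%C)) N))).
  apply: HH.
  - by move=> n; apply: cmeas_sum => i; exact: cmeas_lap.
  - move=> N x Dx; rewrite E cabs_lap_integrand ler_wpM2r ?expR_ge0//.
    rewrite ger0_norm ?leH//; apply: sumr_ge0 => i _; exact: h0.
  - move=> x Dx; apply: (@ccvg_eq _ (fun N => (\sum_(0 <= n < N) h n x)%:C%C * cexp (s * (l x)%:C%C))).
      2: by move=> n; rewrite E.
    apply: ccvgM (ccvg_cst _); apply/ccvg_ReIm; split => /=; first exact: hH.
    exact: cvg_cst.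
by move=> N; have [_ ->] := cint_series N mD ih.
Qed.

End ComplexIntegral.

(** * The fundamental theorem of calculus on open sets *)

Section ImproperFTC.
Context {R : realType}.
Local Notation mu := (@lebesgue_measure R).
Variables (D : set R) (f F : R -> R) (a_ b_ : nat -> R) (la lb : R).
Hypothesis mD : measurable D.
Hypothesis ab : forall n, a_ n < b_ n.
Hypothesis abD : forall n x, a_ n <= x <= b_ n -> D x.
Hypothesis Dab : forall x, D x -> \forall n \near \oo, a_ n <= x <= b_ n.
Hypothesis dF : forall x, D x -> is_derive x 1 F (f x).
Hypothesis cf : forall x, D x -> {for x, continuous f}.
Hypothesis Fa : F (a_ n) @[n --> \oo] --> la.
Hypothesis Fb : F (b_ n) @[n --> \oo] --> lb.

Let I n := `[a_ n, b_ n]%classic.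

Let ID n : I n `<=` D.
Proof. by move=> x; rewrite /I/= in_itv/=; exact: abD. Qed.

Let FTC_n n : (\int[mu]_(x in I n) (f x)%:E = (F (b_ n) - F (a_ n))%:E)%E.
Proof.
have cF x : D x -> {for x, continuous F}.
  move=> Dx; have [+ _] := dF Dx.
  by move=> /derivable1_diffP/differentiable_continuous.
rewrite EFinB; apply: continuous_FTC2 => //.
- apply: continuous_in_subspaceT => x /set_mem/= xI.
  by apply: cf; apply: (ID xI).
- split.
  + move=> x; rewrite in_itv/= => /andP[/ltW ax /ltW xb].
    by have [] := dF (abD (introT andP (conj ax xb))).
  + by apply: cvg_at_right_filter; apply: cF; apply: (@abD n); rewrite lexx ltW.
  + by apply: cvg_at_left_filter; apply: cF; apply: (@abD n); rewrite lexx ltW.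
- move=> x; rewrite in_itv/= => /andP[/ltW ax /ltW xb].
  rewrite derive1E; have := dF (abD (introT andP (conj ax xb))).
  by move=> dFx; rewrite derive_val.
Qed.

Let cvgI x : D x -> (f \_ (I n)) x @[n --> \oo] --> f x.
Proof.
move=> Dx; apply: cvg_near_cst; near=> n.
rewrite patchE mem_set//= /I/= in_itv/=.
by near: n; exact: Dab.
Unshelve. all: by end_near. Qed.

Let measurable_patch_itv n : measurable_fun D f -> measurable_fun D (f \_ (I n)).
Proof.
move=> mf; apply: (measurable_restrict _ (measurable_itv _) mD).1.
by apply: measurable_funS mf => //; exact: subIsetl.
Qed.

(** The segments [a_n, b_n] exhaust D, and the integral over each of them is given
    by the theorem on a compact interval; dominated convergence. *)
Lemma improper_FTC : mu.-integrable D (EFin \o f) ->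
  \int[mu]_(x in D) f x = lb - la.
Proof.
move=> intf.
have mf : measurable_fun D f.
  by apply/measurable_EFinP; exact: (measurable_int mu).
have mfI n := measurable_patch_itv n mf.
have fI n x : D x -> `|(f \_ (I n)) x| <= `|f x|.
  by move=> _; rewrite patchE; case: ifP => // _; rewrite normr0.
have [_ H] := @Rintegral_cvg _ (measurableTypeR R) _ mu D _ f _ mD mfI
  (integrable_norm intf) fI cvgI.
have E : (fun n => \int[mu]_(x in D) (f \_ (I n)) x) = (fun n => F (b_ n) - F (a_ n)).
  apply/funext => n; rewrite -Rintegral_mkcondr.
  by rewrite (setIidr (@ID n)) /Rintegral FTC_n.
rewrite E in H.
by rewrite -(cvg_lim _ H)//; apply: cvg_lim => //; exact: cvgB.
Qed.

(** By monotone convergence, a nonnegative derivative is integrable as soon as the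
    primitive has limits at both ends. *)
Lemma improper_FTC_integrable :
  measurable_fun D f -> (forall x, D x -> 0 <= f x) ->
  (forall n m, (n <= m)%N -> a_ m <= a_ n) ->
  (forall n m, (n <= m)%N -> b_ n <= b_ m) ->
  mu.-integrable D (EFin \o f).
Proof.
move=> mf f0 nda ndb; apply/integrableP; split; first exact/measurable_EFinP.
have E x : D x -> (`|(f x)%:E| = limn (fun n => ((f \_ (I n)) x)%:E))%E.
  move=> Dx; apply/esym/cvg_lim => //; rewrite gee0_abs ?lee_fin ?f0//.
  by apply: cvg_EFin; [exact: nearW|exact: cvgI].
have -> : (\int[mu]_(x in D) `|(EFin \o f) x| = \int[mu]_(x in D) limn (fun n => ((f \_ (I n)) x)%:E))%E.
  by apply: eq_integral => x /set_mem Dx; exact: E.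
have H := @cvg_monotone_convergence _ _ _ mu D mD (fun n x => ((f \_ (I n)) x)%:E).
have {}H : (\int[mu]_(x in D) ((f \_ (I n)) x)%:E)%E @[n --> \oo] -->
    (\int[mu]_(x in D) limn (fun n => ((f \_ (I n)) x)%:E))%E.
  apply: H.
  - by move=> n; apply/measurable_EFinP; exact: measurable_patch_itv.
  - by move=> n x Dx; rewrite lee_fin patchE; case: ifP => // _; exact: f0.
  - move=> x Dx n m nm; rewrite lee_fin !patchE; case: ifPn => [/set_mem|_].
      rewrite /I/= in_itv/= => /andP[anx xbn]; rewrite mem_set//= /I/= in_itv/=.
      by rewrite (le_trans _ anx) ?nda// (le_trans xbn)// ndb.
    by case: ifP => // _; exact: f0.
have EI : (fun n => \int[mu]_(x in D) ((f \_ (I n)) x)%:E)%E =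
    (fun n => (F (b_ n) - F (a_ n))%:E).
  apply/funext => n; rewrite -FTC_n.
  rewrite -[in RHS](setIidr (@ID n)) integral_mkcondr.
  by apply: eq_integral => x _; rewrite restrict_EFin.
rewrite EI in H.
suff -> : (\int[mu]_(x in D) limn (fun n => ((f \_ (I n)) x)%:E))%E = (lb - la)%:E.
  by rewrite ltry.
rewrite -(cvg_lim _ H)//; apply: cvg_lim => //.
by apply: cvg_EFin; [exact: nearW|exact: cvgB].
Qed.

End ImproperFTC.

Section ComplexDerivative.
Context {R : realType}.
Local Notation mu := (@lebesgue_measure R).

Definition is_cderive (F : R -> R[i]) (x : R) (d : R[i]) :=
  is_derive x 1 (fun x => complex.Re (F x)) (complex.Re d) /\
  is_derive x 1 (fun x => complex.Im (F x)) (complex.Im d).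

Lemma is_cderive_cexp (s : R[i]) (l : R -> R) (x l' : R) :
  is_derive x 1 l l' ->
  is_cderive (fun x => cexp (s * (l x)%:C%C)) x (s * l'%:C%C * cexp (s * (l x)%:C%C)).
Proof.
move=> dl; case: s => a b.
have -> : (fun x => cexp ((a +i* b)%C * (l x)%:C%C)) =
   (fun x => (expR (a * l x) * cos (b * l x) +i* (expR (a * l x) * sin (b * l x)))%C).
  by apply/funext => y; rewrite /cexp/= !mulr0 subr0 add0r.
split => /=.
  by apply: is_derive_eq; rewrite /cexp/= !mulr0 !subr0 !add0r /GRing.scale/=; ring.
by apply: is_derive_eq; rewrite /cexp/= !mulr0 !subr0 !add0r /GRing.scale/=; ring.
Qed.

Lemma is_cderiveZ (k : R[i]) F x d : is_cderive F x d ->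
  is_cderive (fun x => k * F x) x (k * d).
Proof.
move=> [d1 d2]; split.
  have -> : (fun x => complex.Re (k * F x)) =
     (fun x => complex.Re k * complex.Re (F x) - complex.Im k * complex.Im (F x)).
    by apply/funext => y; rewrite ReM.
  by apply: is_derive_eq; rewrite ReM /GRing.scale/= ?mulr0 ?mul0r ?addr0.
have -> : (fun x => complex.Im (k * F x)) =
   (fun x => complex.Re k * complex.Im (F x) + complex.Im k * complex.Re (F x)).
  by apply/funext => y; rewrite ImM.
by apply: is_derive_eq; rewrite ImM /GRing.scale/= ?mulr0 ?mul0r ?addr0.
Qed.

Lemma is_cderiveMr (g : R -> R) F (x g' : R) d : is_derive x 1 g g' -> is_cderive F x d ->
  is_cderive (fun x => (g x)%:C%C * F x) x (g'%:C%C * F x + (g x)%:C%C * d).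
Proof.
move=> dg [d1 d2]; split.
  have -> : (fun x => complex.Re ((g x)%:C%C * F x)) =
     (fun x => g x * complex.Re (F x)).
    by apply/funext => y; rewrite ReM/= mul0r subr0.
  by apply: is_derive_eq; rewrite ReD !ReM/= !mul0r !subr0 /GRing.scale/=; ring.
have -> : (fun x => complex.Im ((g x)%:C%C * F x)) =
   (fun x => g x * complex.Im (F x)).
  by apply/funext => y; rewrite ImM/= mul0r addr0.
by apply: is_derive_eq; rewrite ImD !ImM/= !mul0r !addr0 /GRing.scale/=; ring.
Qed.

Lemma is_cderive_continuous F x d : is_cderive F x d ->
  {for x, continuous (fun x => complex.Re (F x))} /\
  {for x, continuous (fun x => complex.Im (F x))}.
Proof.
by move=> [[+ _] [+ _]]; split;
  exact/differentiable_continuous/derivable1_diffP.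
Qed.

Lemma cint_improper_FTC (D : set R) (f F : R -> R[i]) (a_ b_ : nat -> R) (la lb : R[i]) :
  measurable D ->
  (forall n, a_ n < b_ n) ->
  (forall n x, a_ n <= x <= b_ n -> D x) ->
  (forall x, D x -> \forall n \near \oo, a_ n <= x <= b_ n) ->
  (forall x, D x -> is_cderive F x (f x)) ->
  (forall x, D x -> exists d, is_cderive f x d) ->
  ccvg (fun n => F (a_ n)) la -> ccvg (fun n => F (b_ n)) lb ->
  cintegrable mu D f -> cint mu D f = lb - la.
Proof.
move=> mD ab abD Dab dF df /ccvg_ReIm[a1 a2] /ccvg_ReIm[b1 b2] [i1 i2].
have c1 x (Dx : D x) : {for x, continuous (fun x => complex.Re (f x))}.
  by have [d /is_cderive_continuous[]] := df _ Dx.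
have c2 x (Dx : D x) : {for x, continuous (fun x => complex.Im (f x))}.
  by have [d /is_cderive_continuous[]] := df _ Dx.
apply: complex_eq; rewrite /= ?ReD ?ImD ?ReN ?ImN.
  exact: (improper_FTC mD ab abD Dab (fun x Dx => (dF x Dx).1) c1 a1 b1 i1).
exact: (improper_FTC mD ab abD Dab (fun x Dx => (dF x Dx).2) c2 a2 b2 i2).
Qed.

End ComplexDerivative.

(** * Invariance of the Lebesgue measure *)

Section LebesgueInvariance.
Context {R : realType}.
Local Notation mu := (@lebesgue_measure R).

Lemma measurable_shift (a : R) : measurable_fun setT (fun x : R => x + a).
Proof. exact: measurable_funD. Qed.

Lemma lebesgue_shift (a : R) (A : set R) : measurable A ->
  pushforward mu (fun x => x + a : measurableTypeR R) A = mu A.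
Proof.
move=> mA; apply/esym/lebesgue_measure_unique => //=; first exact: measurable_shift.
move=> _ _ [[u v]] _ <-; rewrite /pushforward.
have -> : (fun x : R => x + a) @^-1` `]u, v] = `]u - a, v - a]%classic.
  by apply/seteqP; split => x /=; rewrite !in_itv/= ltrBlDr lerBrDr.
rewrite !lebesgue_measure_itv/= !lte_fin ltrD2r.
by case: ifP => // _; rewrite -!EFinB; congr EFin; ring.
Qed.

Lemma Rintegral_shift (a : R) (D : set R) (f : R -> R) : measurable D ->
  measurable_fun setT f ->
  mu.-integrable [set x | D (x + a)] (EFin \o (fun x => f (x + a))) ->
  \int[mu]_(x in [set x | D (x + a)]) f (x + a) = \int[mu]_(x in D) f x.
Proof.
move=> mD mf i_f; rewrite /Rintegral; congr fine.
have ms : measurable_fun setT (fun x : R => x + a : measurableTypeR R).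
  exact: measurable_shift.
transitivity (\int[pushforward mu (fun x : R => (x + a)%R : measurableTypeR R)]_(x in D) (f x)%:E)%E.
  by rewrite integral_pushforward//; exact/measurable_EFinP.
by apply: eq_measure_integral => A mA _; exact: lebesgue_shift.
Qed.

Lemma Rintegral_opp (D : set R) (f : R -> R) : measurable D ->
  measurable_fun setT f ->
  mu.-integrable [set x | D (- x)] (EFin \o (fun x => f (- x))) ->
  \int[mu]_(x in [set x | D (- x)]) f (- x) = \int[mu]_(x in D) f x.
Proof.
move=> mD mf i_f; rewrite /Rintegral; congr fine.
transitivity (\int[pushforward mu (-%R : _ -> measurableTypeR R)]_(x in D) (f x)%:E)%E.
  by rewrite integral_pushforward//; exact/measurable_EFinP.
by apply: eq_measure_integral => A mA _; exact: lebesgue_measureN.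
Qed.

End LebesgueInvariance.

(** * Mellin transforms on a bounded interval *)

Section PowerMellin.
Context {R : realType}.
Local Notation mu := (@lebesgue_measure R).
Implicit Types (s : R[i]) (b : R).

Lemma Re_mulR s (x : R) : complex.Re (s * x%:C%C) = complex.Re s * x.
Proof. by rewrite ReM/= mulr0 subr0. Qed.

Lemma Im_mulR s (x : R) : complex.Im (s * x%:C%C) = complex.Im s * x.
Proof. by rewrite ImM/= mulr0 add0r. Qed.

Lemma measurable_expR_ln (c : R) : measurable_fun setT (fun x : R => expR (c * ln x)).
Proof.
apply: measurableT_comp => //; apply: measurable_funM => //; exact: measurable_ln.
Qed.

Lemma measurable_expRN_ln : measurable_fun setT (fun x : R => expR (- ln x)).
Proof. by have := measurable_expR_ln (-1); under eq_fun do rewrite mulN1r. Qed.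

Lemma is_derive_expRM (c x l' : R) (l : R -> R) : is_derive x 1 l l' ->
  is_derive x 1 (fun x => expR (c * l x)) (c * l' * expR (c * l x)).
Proof.
by move=> dl; apply: is_derive_eq; rewrite /GRing.scale/=; ring.
Qed.

Lemma is_derive_expR_ln (c x : R) : 0 < x ->
  is_derive x 1 (fun x => expR (c * ln x)) (c * expR ((c - 1) * ln x)).
Proof.
move=> x0; have := is_derive_expRM c (is_derive1_ln x0).
congr is_derive; rewrite mulrBl mul1r expRD expRN lnK ?posrE//.
by rewrite -mulrA; congr (_ * _); rewrite mulrC.
Qed.

Lemma cvg_div3 (b : R) : (fun n : nat => b / n.+3%:R) @ \oo --> (0 : R).
Proof.
rewrite (_ : 0 = b * 0); last by rewrite mulr0.
apply: cvgM; first exact: cvg_cst.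
have := @cvg_harmonic R; rewrite -(cvg_shiftn 2)/=.
by apply: cvg_trans; apply: near_eq_cvg; near=> n; rewrite /= addn2.
Unshelve. all: by end_near. Qed.

Lemma cvg_subdiv3 (b : R) : (fun n : nat => b - b / n.+3%:R) @ \oo --> b.
Proof.
have H : (fun n : nat => b - b / n.+3%:R) @ \oo --> b - 0.
  by apply: cvgB; [exact: cvg_cst|exact: cvg_div3].
by rewrite subr0 in H.
Qed.

Lemma powlim (c b : R) : 0 < c -> 0 < b ->
  (fun n : nat => expR (c * ln (b / n.+3%:R))) @ \oo --> (0 : R).
Proof.
move=> c0 b0; have -> : (fun n : nat => expR (c * ln (b / n.+3%:R))) =
  (fun n => (b / n.+3%:R) `^ c).
  by apply/funext => n; rewrite /powR gt_eqF ?divr_gt0.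
have H := cvg_div3 b.
apply/cvgrPdist_lt => e e0.
have d0 : 0 < e `^ c^-1 by rewrite powR_gt0.
move/cvgrPdist_lt : H => /(_ _ d0)[N _ HN]; exists N => // n Nn /=.
have := HN n Nn; rewrite /= !sub0r !normrN => H1.
rewrite ger0_norm ?powR_ge0//.
have bn : 0 <= b / n.+3%:R by rewrite divr_ge0// ltW.
rewrite ger0_norm// in H1.
have -> : e = (e `^ c^-1) `^ c by rewrite -powRrM mulVf ?gt_eqF// powRr1// ltW.
by rewrite gt0_ltr_powR// nnegrE ?powR_ge0.
Qed.

(** The shift by 3 in the denominator makes the segments that exhaust the interval
    nondegenerate from the first one on. *)
Lemma itv0_lt (b : R) (n : nat) : 0 < b -> b / n.+3%:R < b - b / n.+3%:R.
Proof.
move=> b0; rewrite ltrBrDr -mulrDr gtr_pMr// -mulr2n -[_ *+ 2]mulr_natl.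
by rewrite ltr_pdivrMr// mul1r ltr_nat.
Qed.

Lemma itv0_exhaust b (n : nat) (x : R) : 0 < b ->
  b / n.+3%:R <= x <= b - b / n.+3%:R -> 0 < x < b.
Proof.
move=> b0 /andP[h1 h2]; have h3 : 0 < b / n.+3%:R by rewrite divr_gt0.
by rewrite (lt_le_trans h3)//= (le_lt_trans h2)// gtrDl oppr_lt0.
Qed.

Lemma itv0_near b (x : R) : 0 < b -> 0 < x < b ->
  \forall n \near \oo, b / n.+3%:R <= x <= b - b / n.+3%:R.
Proof.
move=> b0 /andP[x0 xb]; have H := cvg_div3 b.
have d0 : 0 < Num.min x (b - x) by rewrite lt_min x0 subr_gt0.
move/cvgrPdist_lt : H => /(_ _ d0)[N _ HN]; exists N => // n Nn /=.
have := HN n Nn; rewrite /= sub0r normrN ger0_norm ?divr_ge0 ?(ltW b0)//.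
by rewrite lt_min => /andP[h1 h2]; rewrite (ltW h1) lerBrDr addrC -lerBrDr ltW.
Qed.

Lemma mem_itv0 b (x : R) : (`]0, b[%classic : set R) x = (0 < x < b).
Proof. by rewrite /= in_itv. Qed.

Lemma integrable_power (c b : R) : 0 < c -> 0 < b ->
  mu.-integrable `]0, b[ (EFin \o (fun x => expR ((c - 1) * ln x))).
Proof.
move=> c0 b0.
have b2 n : 0 < b / n.+3%:R by rewrite divr_gt0.
apply: (@improper_FTC_integrable _ _ _ (fun x => c^-1 * expR (c * ln x))
  (fun n => b / n.+3%:R) (fun n => b - b / n.+3%:R) (c^-1 * 0) (c^-1 * expR (c * ln b))).
- exact: measurable_itv.
- by move=> n; exact: itv0_lt.
- by move=> n x /(itv0_exhaust b0); rewrite -mem_itv0.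
- by move=> x; rewrite mem_itv0 => /(itv0_near b0).
- move=> x; rewrite mem_itv0 => /andP[x0 _].
  have := is_derive_expR_ln c x0 => H.
  have := is_deriveZ c^-1 H; congr is_derive.
  by rewrite /GRing.scale/= mulrA mulVf ?mul1r// gt_eqF.
- move=> x; rewrite mem_itv0 => /andP[x0 _].
  have [+ _] := is_derive_expR_ln (c - 1) x0.
  by move=> /derivable1_diffP/differentiable_continuous.
- by apply: cvgM; [exact: cvg_cst|exact: powlim].
- apply: cvgM; first exact: cvg_cst.
  have cb : {for b, continuous (fun x => expR (c * ln x))}.
    have [+ _] := is_derive_expR_ln c b0.
    by move=> /derivable1_diffP/differentiable_continuous.
  by apply: (continuous_cvg _ cb); exact: cvg_subdiv3.
- by apply: measurable_funTS; exact: measurable_expR_ln.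
- by move=> x _; exact: expR_ge0.
- move=> n m nm; rewrite ler_pM2l// lef_pV2 ?posrE// ler_nat.
  by rewrite !ltnS.
- move=> n m nm; rewrite lerD2l lerN2 ler_pM2l// lef_pV2 ?posrE// ler_nat.
  by rewrite !ltnS.
Qed.

(** The integral of g(x) x^(s-1) over (0, b); the density 1/x is written
    exp (- ln x). *)
Definition mellin b (g : R -> R) s : R[i] :=
  lap mu `]0, b[ (fun x => g x * expR (- ln x)) (@ln R) s.

Lemma mellin_bounded_integrable (g : R -> R) b (K : R) (c : R) :
  0 < b -> 0 < c -> measurable_fun (`]0, b[%classic : set R) g ->
  (forall x, 0 < x < b -> `|g x| <= K) ->
  mu.-integrable `]0, b[ (EFin \o (fun x => g x * expR (- ln x) * expR (c * ln x))).
Proof.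
move=> b0 c0 mg gK.
have i0 : mu.-integrable `]0, b[ (EFin \o (fun x => K * expR ((c - 1) * ln x))).
  by have := @integrableZl _ (measurableTypeR R) _ mu _ (measurable_itv _) K _ (integrable_power c0 b0).
apply: (@le_integrable _ (measurableTypeR R) _ mu _ (measurable_itv _) _ _ _ _ i0).
  apply/measurable_EFinP; apply: measurable_funM.
    apply: measurable_funM => //; apply: measurable_funTS.
    exact: measurable_expRN_ln.
  by apply: measurable_funTS; exact: measurable_expR_ln.
move=> x; rewrite mem_itv0 => xb /=; rewrite lee_fin.
rewrite -mulrA -expRD (_ : - ln x + c * ln x = (c - 1) * ln x); last by ring.
rewrite !normrM (ger0_norm (expR_ge0 _)) ler_wpM2r ?expR_ge0//.
by rewrite (le_trans (gK _ xb))// ler_norm.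
Qed.

Lemma mellin_analytic (g : R -> R) b (K : R) s :
  0 < b -> measurable_fun (`]0, b[%classic : set R) g ->
  (forall x, 0 < x < b -> `|g x| <= K) ->
  0 < complex.Re s -> canal (mellin b g) s.
Proof.
move=> b0 mg gK s0.
have mh : measurable_fun (`]0, b[%classic : set (measurableTypeR R))
    (fun x => g x * expR (- ln x)).
  apply: measurable_funM => //; apply: measurable_funTS.
  exact: measurable_expRN_ln.
apply: (@lap_analytic _ _ _ _ _ _ _ (complex.Re s / 2) (complex.Re s + 1)) => //.
- by apply: measurable_funTS; exact: measurable_ln.
- by apply: (@mellin_bounded_integrable g b K) => //; rewrite divr_gt0.
- by apply: (@mellin_bounded_integrable g b K) => //; rewrite addr_gt0.
- by rewrite ltrDl ltr01 andbT; lra.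
Qed.

Lemma mellin1 b s : 0 < b -> 0 < complex.Re s ->
  mellin b (fun=> 1) s = s^-1 * cexp (s * (ln b)%:C%C).
Proof.
move=> b0 s0.
have sn0 : s != 0 by apply: contraTneq s0 => ->; rewrite /= ltxx.
have b2 n : 0 < b / n.+3%:R by rewrite divr_gt0.
rewrite -[RHS]subr0.
have dF x (l : R) : 0 < x -> is_cderive (fun x => s^-1 * cexp (s * (ln x)%:C%C)) x
    ((1 * expR (- ln x))%:C%C * cexp (s * (ln x)%:C%C)).
  move=> x0; have H := is_cderive_cexp s (is_derive1_ln x0).
  have := is_cderiveZ s^-1 H; congr (is_cderive _ _ _).
  by rewrite mulrA mulrA mulVf// mul1r expRN lnK// mul1r.
have cvl : ccvg (fun n : nat => s^-1 * cexp (s * (ln (b / n.+3%:R))%:C%C)) 0.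
  apply: (@ccvg0_squeeze _ _ (fun n => cabs s^-1 * expR (complex.Re s * ln (b / n.+3%:R)))).
    by move=> n; rewrite cabsM cabs_cexp Re_mulR.
  rewrite (_ : 0 = cabs s^-1 * 0); last by rewrite mulr0.
  by apply: cvgM; [exact: cvg_cst|exact: powlim].
apply: (@cint_improper_FTC _ _ _ (fun x => s^-1 * cexp (s * (ln x)%:C%C))
  (fun n => b / n.+3%:R) (fun n => b - b / n.+3%:R) _ _ _ _ _ _ _ _ cvl).
- exact: measurable_itv.
- by move=> n; exact: itv0_lt.
- by move=> n x /(itv0_exhaust b0); rewrite -mem_itv0.
- by move=> x; rewrite mem_itv0 => /(itv0_near b0).
- by move=> x; rewrite mem_itv0 => /andP[x0 _]; exact: dF.
- move=> x; rewrite mem_itv0 => /andP[x0 _]; eexists.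
  apply: is_cderiveMr; last exact: (is_cderive_cexp s (is_derive1_ln x0)).
  have := is_derive_expRM (-1) (is_derive1_ln x0).
  have -> : (fun x : R => expR (-1 * ln x)) = (fun x => 1 * expR (- ln x)).
    by apply/funext => y; rewrite mul1r mulN1r.
  exact.
- apply: ccvgM; first exact: ccvg_cst.
  have [c1 c2] := is_cderive_continuous (is_cderive_cexp s (is_derive1_ln b0)).
  apply/ccvg_ReIm; split.
    by apply: (continuous_cvg _ c1); exact: cvg_subdiv3.
  by apply: (continuous_cvg _ c2); exact: cvg_subdiv3.
- apply: lap_integrable => //.
  + apply: measurable_funM => //; apply: measurable_funTS.
    exact: measurable_expRN_ln.
  + by apply: measurable_funTS; exact: measurable_ln.
  + apply: (@mellin_bounded_integrable _ b 1) => //.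
    by move=> x _; rewrite normr1.
Qed.

End PowerMellin.

(** * The Mellin transform of the fractional part *)

(** The expansion at z0 is that of the exponential at 0, by the addition formula. *)
Lemma canal_cexp (R : realType) (k z0 : R[i]) : canal (fun z => cexp (z * k)) z0.
Proof.
have [B HB] := cexp_series_bound k.
exists (fun n => cexp (z0 * k) * (k ^+ n / n`!%:R)), 1, (cabs (cexp (z0 * k)) * B).
split; first exact: ltr01.
  move=> n; rewrite expr1n mulr1 cabsM -mulrA ler_wpM2l ?cabs_ge0//.
move=> h _; rewrite mulrDl cexpD.
have H := ccvgM (ccvg_cst (cexp (z0 * k))) (cexp_series (h * k)).
apply: (ccvg_eq H) => n.
rewrite /series/= mulr_sumr; apply: eq_bigr => i _.
by rewrite exprMn; ring.
Qed.

Section ZetaMellin.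
Context {R : realType}.
Local Notation mu := (@lebesgue_measure R).
Implicit Types (s : R[i]).

(** This is how the Mellin transform of floor (th / x) becomes a Dirichlet
    series. *)
Lemma floor_count (t : R) : 0 <= t ->
  (fun N => \sum_(0 <= m < N) (m.+1%:R <= t :> R)%:R : R) @ \oo --> ((Num.floor t)%:~R : R).
Proof.
move=> t0; have [k Ek] : exists k : nat, Num.floor t = k.
  exists `|Num.floor t|%N; by rewrite gez0_abs// floor_ge0.
apply: cvg_near_cst; exists k => // N /= kN.
have E m : (m.+1%:R <= t) = (m < k)%N.
  by have := floor_ge_int t m.+1; rewrite Ek lez_nat => <-.
under eq_bigr do rewrite E.
rewrite (@big_cat_nat _ _ _ k)//= [X in _ + X]big_nat_cond [X in _ + X]big1; last first.
  by move=> i; rewrite andbT => /andP[ki _]; rewrite ltnNge ki.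
rewrite addr0 big_nat_cond (eq_bigr (fun=> 1)); last first.
  by move=> i; rewrite andbT => /andP[_ ->].
by rewrite -big_nat_cond sumr_const_nat subn0 Ek.
Qed.

Lemma frac_part_itv (t : R) : 0 <= frac_part t < 1.
Proof.
rewrite /frac_part subr_ge0 floor_le_tmp ltrBlDl/=.
by have := lt_succ_floor t; rewrite intrD1.
Qed.

Section Fixed.
Variables (th b : R).
Hypothesis th0 : 0 < th.
Hypothesis thb : th <= b.
Let b0 : 0 < b. Proof. exact: lt_le_trans thb. Qed.
Let D : set R := `]0, b[%classic.

Let c m := th / m.+1%:R.
Let c0 m : 0 < c m. Proof. by rewrite divr_gt0. Qed.
Let cb m : c m <= b.
Proof. by rewrite (le_trans _ thb)// ler_pdivrMr// ler_peMr ?ler1n// ltW. Qed.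

Let h m (x : R) : R := \1_(`]-oo, c m]%classic : set R) x.

Let mh m : measurable_fun D (h m).
Proof. by apply: measurable_funTS; exact: measurable_indic. Qed.

Let hE m x : 0 < x -> h m x = (m.+1%:R <= th / x :> R)%:R.
Proof.
move=> x0; rewrite /h indicE; congr ((nat_of_bool _)%:R).
apply/idP/idP.
  by move=> /set_mem/=; rewrite in_itv/= /c ler_pdivlMr// ler_pdivlMr// mulrC.
by rewrite ler_pdivlMr// => H; apply/mem_set => /=; rewrite in_itv/= /c ler_pdivlMr// mulrC.
Qed.

Let floor_cvg x : D x ->
  (fun N => \sum_(0 <= m < N) h m x) @ \oo --> ((Num.floor (th / x))%:~R : R).
Proof.
rewrite /D mem_itv0 => /andP[x0 _].
under eq_fun do (under eq_bigr do rewrite hE//).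
by apply: floor_count; rewrite divr_ge0// ltW.
Qed.

Lemma measurable_floor_div :
  measurable_fun D (fun x => (Num.floor (th / x))%:~R : R).
Proof.
apply: (@measurable_fun_cvg _ _ _ _ (fun N x => \sum_(0 <= m < N) h m x)) => //.
by move=> N; apply: measurable_sum => m.
Qed.

Lemma measurable_frac_div : measurable_fun D (fun x => frac_part (th / x)).
Proof.
apply: (@eq_measurable_fun _ _ _ _ D (fun x => th * expR (- ln x) - (Num.floor (th / x))%:~R)).
  move=> x /set_mem; rewrite /D mem_itv0 => /andP[x0 _].
  by rewrite expRN lnK.
apply: measurable_funB; last exact: measurable_floor_div.
apply: measurable_funTS; apply: measurable_funM => //.
exact: measurable_expRN_ln.
Qed.

Lemma frac_mellin_analytic s : 0 < complex.Re s ->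
  canal (mellin b (fun x => frac_part (th / x))) s.
Proof.
move=> s0; apply: (@mellin_analytic _ _ b 1) => //; first exact: measurable_frac_div.
by move=> x _; have /andP[h0 h1] := frac_part_itv (th / x); rewrite ger0_norm// ltW.
Qed.

Let mexpD : measurable_fun D (fun x : R => expR (- ln x)).
Proof. by apply: measurable_funTS; exact: measurable_expRN_ln. Qed.

(** The indicator cuts the interval of integration down to that of [mellin1]. *)
Lemma mellin_indic m s : 0 < complex.Re s ->
  mellin b (h m) s = s^-1 * cexp (s * (ln (c m))%:C%C).
Proof.
move=> s0; rewrite -(mellin1 (c0 m) s0).
pose g x := (1 * expR (- ln x))%:C%C * cexp (s * (ln x)%:C%C).
have ig : cintegrable mu (`]0, c m[ : set (measurableTypeR R)) g.
  apply: lap_integrable => //.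
  - by apply: measurable_funTS; apply: measurable_funM => //; exact: measurable_expRN_ln.
  - by apply: measurable_funTS; exact: measurable_ln.
  - by apply: (@mellin_bounded_integrable _ _ _ 1) => // x _; rewrite normr1.
have key (f : R -> R) : mu.-integrable (`]0, c m[ : set (measurableTypeR R)) (EFin \o f) ->
    \int[mu]_(x in `]0, b[) (h m x * f x) = \int[mu]_(x in `]0, c m[) f x.
  move=> i_f.
  transitivity (\int[mu]_(x in `]0, b[) (f \_ `]-oo, c m]) x).
    apply: eq_Rintegral => x _; rewrite patchE /h indicE.
    by case: ifP => _; rewrite ?mul1r ?mul0r.
  rewrite -Rintegral_mkcondr.
  have := cb m; rewrite le_eqVlt => /predU1P[E|cmb].
    congr (Rintegral _ _ _); apply/seteqP; split => x /=; rewrite !in_itv/= E.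
      by move=> [].
    by move=> /andP[-> xb]; split => //; rewrite ltW.
  rewrite Rintegral_itv_bndo_bndc//.
  congr (Rintegral _ _ _); apply/seteqP; split => x /=; rewrite !in_itv/=.
    by move=> [/andP[-> _] ->].
  by move=> /andP[-> xc]; rewrite xc (le_lt_trans xc cmb).
have [ig1 ig2] := ig.
rewrite /mellin /lap /cint; congr (_ +i* _)%C.
  rewrite -(key _ ig1); apply: eq_Rintegral => x _.
  by rewrite /g mul1r [(h m x * _)%:C%C]realCM -mulrA Re_realM.
rewrite -(key _ ig2); apply: eq_Rintegral => x _.
by rewrite /g mul1r [(h m x * _)%:C%C]realCM -mulrA Im_realM.
Qed.

Let dirichlet_c m s : cexp (s * (ln (c m))%:C%C) =
  cexp (s * (ln th)%:C%C) * dirichlet_term s m.+1.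
Proof.
rewrite /dirichlet_term -cexpD /c ln_div ?posrE//; congr cexp.
by rewrite rmorphB/=; ring.
Qed.

Let integrable_floor (sg : R) : 1 < sg ->
  mu.-integrable D (EFin \o (fun x =>
    (Num.floor (th / x))%:~R * expR (- ln x) * expR (sg * ln x))).
Proof.
move=> s1.
have i0 : mu.-integrable D (EFin \o (fun x => th * expR (((sg - 1) - 1) * ln x))).
  have s10 : 0 < sg - 1 by rewrite subr_gt0.
  by have := @integrableZl _ (measurableTypeR R) _ mu _ (measurable_itv _) th _ (integrable_power s10 b0).
apply: (@le_integrable _ (measurableTypeR R) _ mu _ (measurable_itv _) _ _ _ _ i0).
  apply/measurable_EFinP; apply: measurable_funM.
    apply: measurable_funM; first exact: measurable_floor_div.
    exact: mexpD.
  by apply: measurable_funTS; exact: measurable_expR_ln.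
move=> x; rewrite mem_itv0 => /andP[x0 xb] /=; rewrite lee_fin.
have f0 : 0 <= th / x by rewrite divr_ge0// ltW.
rewrite !normrM !(ger0_norm (expR_ge0 _)) (gtr0_norm th0).
rewrite ger0_norm; last by rewrite ler0z floor_ge0.
rewrite (_ : expR ((sg - 1 - 1) * ln x) = expR (- ln x) * (expR (- ln x) * expR (sg * ln x))); last first.
  by rewrite -!expRD; congr expR; ring.
rewrite -[leLHS]mulrA [leRHS]mulrA ler_wpM2r ?mulr_ge0 ?expR_ge0//.
by rewrite expRN lnK// floor_le_tmp.
Qed.

(** For Re s > 1 the two terms of th / x - floor (th / x) have Mellin transforms.
    The second one is the sum over m of the integrals of x^(s-1) over the
    intervals (0, th / m), that is, th^s zeta(s) / s. *)
Lemma frac_mellin_gt1 (zeta : R[i] -> R[i]) s : is_riemann_zeta zeta ->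
  1 < complex.Re s ->
  s * (s - 1) * mellin b (fun x => frac_part (th / x)) s =
  s * th%:C%C * cexp ((s - 1) * (ln b)%:C%C) - (s - 1) * cexp (s * (ln th)%:C%C) * zeta s.
Proof.
move=> [hz _] s1.
have s0 : 0 < complex.Re s by rewrite (lt_trans ltr01).
have sn0 : s != 0 by apply: contraTneq s0 => ->; rewrite /= ltxx.
have sn1 : s - 1 != 0.
  by rewrite subr_eq0; apply: contraTneq s1 => ->; rewrite /= ltxx.
have Hfl : mellin b (fun x => (Num.floor (th / x))%:~R) s =
    s^-1 * cexp (s * (ln th)%:C%C) * zeta s.
  pose F (x : R) : R := (Num.floor (th / x))%:~R * expR (- ln x).
  have := @lap_series _ (measurableTypeR R) _ mu D (fun m x => h m x * expR (- ln x)) F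
    (@ln R) s (measurable_itv _).
  move=> H; have {}H : ccvg (series (fun m => mellin b (h m) s))
      (mellin b (fun x => (Num.floor (th / x))%:~R) s).
    apply: H.
    - by move=> n; apply: measurable_funM; [exact: mh|exact: mexpD].
    - by apply: measurable_funTS; exact: measurable_ln.
    - by move=> n x _; rewrite mulr_ge0 ?expR_ge0// /h indicE.
    - move=> x Dx.
      have -> : (fun N => \sum_(0 <= n < N) h n x * expR (- ln x)) =
          (fun N => (\sum_(0 <= n < N) h n x) * expR (- ln x)).
        by apply/funext => N; rewrite mulr_suml.
      by apply: cvgM; [exact: floor_cvg|exact: cvg_cst].
    - exact: integrable_floor.
  apply: (ccvg_unique H).
  apply: (ccvg_eq (ccvgM (ccvg_cst (s^-1 * cexp (s * (ln th)%:C%C))) (hz s s1))) => N.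
  rewrite /series/= mulr_sumr; apply: eq_bigr => m _.
  by rewrite mellin_indic// dirichlet_c mulrA.
have Hdiv : mellin b (fun x => th * expR (- ln x)) s =
    th%:C%C * ((s - 1)^-1 * cexp ((s - 1) * (ln b)%:C%C)).
  rewrite -mellin1//; last by rewrite ReD ReN/= subr_gt0.
  rewrite /mellin /lap -cintZ//; last first.
    apply: lap_integrable => //.
    - by apply: measurable_funTS; apply: measurable_funM => //; exact: measurable_expRN_ln.
    - by apply: measurable_funTS; exact: measurable_ln.
    - apply: (@mellin_bounded_integrable _ _ _ 1) => //; last by move=> x _; rewrite normr1.
      by rewrite ReD ReN/= subr_gt0.
  apply: eq_cint => x; rewrite mem_itv0 => /andP[x0 _].
  rewrite mul1r mulrBl mul1r cexpD.
  have -> : cexp (- (ln x)%:C%C) = (expR (- ln x))%:C%C by rewrite -rmorphN/= cexpR.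
  by rewrite !rmorphM/=; ring.
have Hsub : mellin b (fun x => frac_part (th / x)) s =
    mellin b (fun x => th * expR (- ln x)) s - mellin b (fun x => (Num.floor (th / x))%:~R) s.
  rewrite -[X in _ - X]mul1r -mulNr /mellin /lap -cintZ//; last first.
    apply: lap_integrable => //.
    - apply: measurable_funM; first exact: measurable_floor_div.
      exact: mexpD.
    - by apply: measurable_funTS; exact: measurable_ln.
    - exact: integrable_floor.
  rewrite -cintD//.
  - apply: eq_cint => x; rewrite mem_itv0 => /andP[x0 _].
    rewrite /frac_part expRN lnK// -/(th / x).
    by rewrite !rmorphM/= rmorphB/=; ring.
  - apply: lap_integrable => //.
    + by apply: measurable_funTS; apply: measurable_funM; [apply: measurable_funM => //|]; exact: measurable_expRN_ln.
    + by apply: measurable_funTS; exact: measurable_ln.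
    + have s10 : 0 < complex.Re s - 1 by rewrite subr_gt0.
      have := @integrableZl _ (measurableTypeR R) _ mu _ (measurable_itv _) th _ (integrable_power s10 b0).
      congr (integrable _ _ _); apply/funext => x /=; congr EFin.
      by rewrite -!mulrA -!expRD; congr (_ * expR _); ring.
  - apply: cintegrableZ => //; apply: lap_integrable => //.
    + apply: measurable_funM; first exact: measurable_floor_div.
      exact: mexpD.
    + by apply: measurable_funTS; exact: measurable_ln.
    + exact: integrable_floor.
rewrite Hsub Hdiv Hfl.
by field; rewrite sn0 sn1.
Qed.

(** Both sides are analytic for Re s > 0 and s <> 1, the left one because the
    fractional part is bounded. *)
Theorem frac_mellin (zeta : R[i] -> R[i]) s : is_riemann_zeta zeta ->
  0 < complex.Re s -> s != 1 ->
  s * (s - 1) * mellin b (fun x => frac_part (th / x)) s =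
  s * th%:C%C * cexp ((s - 1) * (ln b)%:C%C) - (s - 1) * cexp (s * (ln th)%:C%C) * zeta s.
Proof.
move=> hz s0 s1.
pose f s := s * (s - 1) * mellin b (fun x => frac_part (th / x)) s -
  (s * th%:C%C * (cexp (s * (ln b)%:C%C) * cexp (- (ln b)%:C%C)) -
   (s - 1) * cexp (s * (ln th)%:C%C) * zeta s).
have expE z : cexp ((z - 1) * (ln b)%:C%C) = cexp (z * (ln b)%:C%C) * cexp (- (ln b)%:C%C).
  by rewrite mulrBl mul1r cexpD.
suff : f s = 0 by move=> /eqP; rewrite subr_eq0 expE => /eqP.
apply: (@identity_halfplane _ f 0 1) => //.
  move=> z z0 z1.
  have cm1 : canal (fun z => z - 1) z.
    by apply: canalB; [exact: canal_id|exact: canal_cst].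
  apply: canalB.
    apply: canalM; last exact: frac_mellin_analytic.
    by apply: canalM; [exact: canal_id|exact: cm1].
  apply: canalB.
    apply: canalM.
      by apply: canalM; [exact: canal_id|exact: canal_cst].
    by apply: canalM; [exact: canal_cexp|exact: canal_cst].
  apply: canalM; last by apply: analytic_canal; apply: hz.2.
  by apply: canalM; [exact: cm1|exact: canal_cexp].
move=> z z1; rewrite /f (frac_mellin_gt1 hz z1) expE.
by rewrite subrr.
Qed.

End Fixed.

(** At a zero x, [frac_mellin] with th = b = 1 gives (x - 1) M = 1, where M is the
    integral of {1/t} t^(x-1) over (0, 1), hence 0 <= M <= 1/x. This is
    impossible for x < 1 because of the sign, and for x > 1 because
    (x - 1) / x < 1. *)
Lemma zeta_real_neq0 (zeta : R[i] -> R[i]) (x : R) : is_riemann_zeta zeta ->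
  0 < x -> x != 1 -> zeta x%:C%C != 0.
Proof.
move=> hz x0 x1; apply/eqP => z0.
have xc1 : x%:C%C != 1 :> R[i] by rewrite (inj_eq (@complexI R)).
have := frac_mellin ltr01 (lexx 1) hz (s := x%:C%C) x0 xc1.
rewrite z0 mulr0 subr0 ln1 !mulr0 cexp0 !mulr1.
set M := mellin _ _ _.
have M0 : 0 <= complex.Re M <= x^-1.
  rewrite /M /mellin Re_lap_real.
  have i1 : mu.-integrable `]0, 1[ (EFin \o (fun t : R => frac_part (1 / t) * expR (- ln t) * expR (x * ln t))).
    apply: (@mellin_bounded_integrable _ _ _ 1) => //; first exact: measurable_frac_div.
    by move=> t _; have /andP[h0 h1] := frac_part_itv (1 / t); rewrite ger0_norm// ltW.
  have i2 : mu.-integrable `]0, 1[ (EFin \o (fun t : R => (fun=> 1) t * expR (- ln t) * expR (x * ln t))).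
    by apply: (@mellin_bounded_integrable _ _ _ 1) => // t _; rewrite normr1.
  apply/andP; split.
    apply: Rintegral_ge0 => t _; rewrite mulr_ge0 ?expR_ge0// mulr_ge0 ?expR_ge0//.
    by have /andP[] := frac_part_itv (1 / t).
  have := mellin1 ltr01 (s := x%:C%C) x0; rewrite ln1 mulr0 cexp0 mulr1.
  move=> /(congr1 (@complex.Re R)); rewrite /mellin Re_lap_real -fmorphV/= => <-.
  apply: (@le_Rintegral _ (measurableTypeR R)) => //.
  move=> t _; rewrite ler_wpM2r ?expR_ge0// ler_wpM2r ?expR_ge0//.
  by have /andP[_ /ltW] := frac_part_itv (1 / t).
move=> H.
have {}H : (x%:C%C - 1) * M = 1.
  have xn0 : x%:C%C != 0 :> R[i] by rewrite (inj_eq (@complexI R)) gt_eqF.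
  by apply: (mulfI xn0); rewrite mulr1 mulrA.
have {}H : (x - 1) * complex.Re M = 1.
  have E : (x - 1)%:C%C = x%:C%C - 1 :> R[i] by rewrite rmorphB rmorph1.
  by rewrite -Re_realM E H.
have [h0 h1] := andP M0.
have [xgt|xlt] := leP x 1.
  suff : (x - 1) * complex.Re M <= 0 by rewrite H ler10.
  by rewrite mulr_le0_ge0// subr_le0.
have : (x - 1) * complex.Re M <= (x - 1) * x^-1.
  by rewrite ler_wpM2l// subr_ge0 ltW.
rewrite H mulrBl mulfV ?gt_eqF// mul1r lerBrDl gerDr leNgt invr_gt0.
by rewrite x0.
Qed.

End ZetaMellin.

(** * Fubini's theorem for a bounded kernel *)

Section BoundedKernel.
Context {R : realType}.
Local Notation mu := (@lebesgue_measure R).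
Local Notation RR := (measurableTypeR R).

(** As k is bounded, u(x) k(x, y) v(y) is integrable on the product; u and v are
    extended by 0 to apply the theorem to the whole plane. *)
Lemma Fubini_bounded (A B : set R) (u v : R -> R) (k : R * R -> R) (K : R) :
  measurable (A : set RR) -> measurable (B : set RR) ->
  mu.-integrable A (EFin \o u) -> mu.-integrable B (EFin \o v) ->
  measurable_fun setT (k : RR * RR -> R) ->
  (forall z, `|k z| <= K) ->
  \int[mu]_(x in A) (u x * \int[mu]_(y in B) (k (x, y) * v y)) =
  \int[mu]_(y in B) (v y * \int[mu]_(x in A) (k (x, y) * u x)).
Proof.
move=> mA mB iu iv mk kK.
pose u' := u \_ A; pose v' := v \_ B.
have iu' : mu.-integrable setT (EFin \o u').
  by have := (integrable_mkcond _ mA).1 iu; rewrite /u' -restrict_EFin.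
have iv' : mu.-integrable setT (EFin \o v').
  by have := (integrable_mkcond _ mB).1 iv; rewrite /v' -restrict_EFin.
pose G (z : RR * RR) := (u' z.1 * k z * v' z.2)%:E.
have mu' : measurable_fun setT (u' : RR -> R) by apply/measurable_EFinP; exact: (measurable_int mu).
have mv' : measurable_fun setT (v' : RR -> R) by apply/measurable_EFinP; exact: (measurable_int mu).
have mk1 x : measurable_fun setT (fun y : RR => k (x, y)).
  by apply: (measurableT_comp mk); exact: measurable_fun_pair.
have mk2 y : measurable_fun setT (fun x : RR => k (x, y)).
  by apply: (measurableT_comp mk); exact: measurable_fun_pair.
have K0 : 0 <= K by exact: le_trans (normr_ge0 _) (kK (0, 0)).
have mG : measurable_fun setT G.
  apply/measurable_EFinP; apply: measurable_funM.
    apply: measurable_funM => //; exact: (measurableT_comp mu' measurable_fst).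
  exact: (measurableT_comp mv' measurable_snd).
have iG : (mu \x mu)%E.-integrable setT G.
  apply/(integrable12ltyP mu mu mG).
  apply: (@le_lt_trans _ _ (\int[mu]_x ((K * \int[mu]_y `|v' y|) * `|u' x|)%:E)%E).
    apply: ge0_le_integral => //=.
    - by move=> x _; exact: integral_ge0.
    - apply: (@measurable_fun_fubini_tonelli_F _ _ _ _ _ mu (fun z => `|G z|%E)) => //.
      exact: measurableT_comp.
    - apply/measurable_EFinP; apply: measurable_funM => //.
      by apply: measurableT_comp => //.
    - move=> x _.
      apply: (@le_trans _ _ (\int[mu]_y ((K * `|u' x|) * `|v' y|)%:E)%E).
        apply: ge0_le_integral => //=.
        + apply/measurable_EFinP; apply: measurableT_comp => //.
          by do 2 apply: measurable_funM => //.
        + by apply/measurable_EFinP; apply: measurable_funM => //; apply: measurableT_comp.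
        + move=> y _; rewrite lee_fin !normrM [K * _]mulrC ler_wpM2r// ler_wpM2l//.
      have iv2 := integrable_norm iv'.
      rewrite (_ : (fun y => _) = (fun y => (K * `|u' x|)%:E * (`|v' y|)%:E)%E); last first.
        by apply/funext => y; rewrite EFinM.
      rewrite integralZl// -[X in (_ * X <= _)%E]fineK; last exact: (integrable_fin_num _ iv2).
      by rewrite -EFinM lee_fin mulrAC.
  have iu2 := integrable_norm iu'.
  have := @integrableZl _ RR _ mu _ measurableT (K * \int[mu]_y `|v' y|) _ iu2.
  move=> /integrableP[_]; apply: le_lt_trans; apply: ge0_le_integral => //=.
  - move=> x _; rewrite lee_fin mulr_ge0// mulr_ge0// Rintegral_ge0//.
  - apply/measurable_EFinP; apply: measurable_funM => //.
    by apply: measurableT_comp => //.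
  - apply/measurable_EFinP; apply: measurableT_comp => //; apply: measurable_funM => //.
    by apply: measurableT_comp => //.
  - by move=> x _; rewrite lee_fin ler_norm.
have E1 x : (\int[mu]_y G (x, y))%E = (u' x * \int[mu]_(y in B) (k (x, y) * v y))%:E.
  have i1 : mu.-integrable setT (EFin \o (fun y => k (x, y) * v' y)).
    have := @integrableZl _ RR _ mu _ measurableT K _ (integrable_norm iv').
    apply: le_integrable => //.
      by apply/measurable_EFinP; apply: measurable_funM => //; exact: mk1.
    move=> y _ /=; rewrite lee_fin !normrM normr_id (ger0_norm K0) ler_wpM2r//.
  rewrite (_ : (fun y => G (x, y)) = (fun y => (u' x)%:E * (k (x, y) * v' y)%:E)%E); last first.
    by apply/funext => y; rewrite /G/= -EFinM mulrA.
  rewrite integralZl//.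
  rewrite -[X in (_ * X = _)%E]fineK; last exact: (integrable_fin_num _ i1).
  rewrite -EFinM; congr (_ * _)%:E; rewrite -[LHS]/(Rintegral _ _ _).
  rewrite [RHS]Rintegral_mkcond; apply: eq_Rintegral => y _.
  by rewrite /v' !patchE; case: ifP => //; rewrite mulr0.
have E2 y : (\int[mu]_x G (x, y))%E = (v' y * \int[mu]_(x in A) (k (x, y) * u x))%:E.
  have i1 : mu.-integrable setT (EFin \o (fun x => k (x, y) * u' x)).
    have := @integrableZl _ RR _ mu _ measurableT K _ (integrable_norm iu').
    apply: le_integrable => //.
      by apply/measurable_EFinP; apply: measurable_funM => //; exact: mk2.
    move=> x _ /=; rewrite lee_fin !normrM normr_id (ger0_norm K0) ler_wpM2r//.
  rewrite (_ : (fun x => G (x, y)) = (fun x => (v' y)%:E * (k (x, y) * u' x)%:E)%E); last first.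
    by apply/funext => x; rewrite /G/= -EFinM; congr EFin; ring.
  rewrite integralZl//.
  rewrite -[X in (_ * X = _)%E]fineK; last exact: (integrable_fin_num _ i1).
  rewrite -EFinM; congr (_ * _)%:E; rewrite -[LHS]/(Rintegral _ _ _).
  rewrite [RHS]Rintegral_mkcond; apply: eq_Rintegral => x _.
  by rewrite /u' !patchE; case: ifP => //; rewrite mulr0.
rewrite Rintegral_mkcond [RHS]Rintegral_mkcond /Rintegral; congr fine.
have HF : (\int[mu]_x \int[mu]_y G (x, y) = \int[mu]_y \int[mu]_x G (x, y))%E.
  exact: (Fubini iG).
transitivity (\int[mu]_x \int[mu]_y G (x, y))%E.
  apply: eq_integral => x _; rewrite E1; congr EFin.
  by rewrite /u' !patchE; case: ifP => //; rewrite mul0r.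
rewrite HF; apply: eq_integral => y _; rewrite E2; congr EFin.
by rewrite /v' !patchE; case: ifP => //; rewrite mul0r.
Qed.

End BoundedKernel.

(** * Weak limits of sequences that are bounded in L2 *)

Section WeakLimit.
Context {R : realType}.
Local Notation mu := (@lebesgue_measure R).
Local Notation RR := (measurableTypeR R).
Local Notation I := (`]0, 1[%classic : set R).

(** Integrated, it takes the place of the Cauchy-Schwarz inequality: the weight eta
    is free, and is chosen according to the sizes of the two factors. *)
Lemma AMGM (eta a b : R) : 0 < eta -> `|a * b| <= (eta * a ^+ 2 + b ^+ 2 / eta) / 2.
Proof.
move=> e0; rewrite ler_pdivlMr// -subr_ge0.
have -> : eta * a ^+ 2 + b ^+ 2 / eta - `|a * b| * 2 = eta * (`|a| - `|b| / eta) ^+ 2.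
  rewrite normrM -(real_normK (num_real a)) -(real_normK (num_real b)).
  by field; rewrite gt_eqF.
by rewrite mulr_ge0 ?sqr_ge0// ltW.
Qed.

Lemma bounded_integrable (A : set R) (f : R -> R) (K : R) : measurable (A : set RR) ->
  (mu A < +oo)%E -> measurable_fun (A : set RR) f -> (forall x, A x -> `|f x| <= K) ->
  mu.-integrable A (EFin \o f).
Proof.
move=> mA Aoo mf fK; apply: (@le_integrable _ RR _ mu A mA _ (EFin \o cst K)).
- exact/measurable_EFinP.
- by move=> x Ax /=; rewrite lee_fin (le_trans (fK _ Ax))// ler_norm.
- apply/integrableP; split; first exact/measurable_EFinP.
  by rewrite /= integral_cst// lte_mul_pinfty.
Qed.

Lemma mu01 : (mu I < +oo)%E.
Proof. by rewrite lebesgue_measure_itv/= lte_fin ltr01 ltry. Qed.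

Lemma integrableD_R (A : set R) (f g : R -> R) : measurable (A : set RR) ->
  mu.-integrable A (EFin \o f) -> mu.-integrable A (EFin \o g) ->
  mu.-integrable A (EFin \o (fun x => f x + g x)).
Proof. by move=> mA i1 i2; have := @integrableD _ RR _ mu A mA _ _ i1 i2. Qed.

Lemma integrableZ_R (A : set R) (k : R) (f : R -> R) : measurable (A : set RR) ->
  mu.-integrable A (EFin \o f) ->
  mu.-integrable A (EFin \o (fun x => k * f x)).
Proof. by move=> mA i1; have := @integrableZl _ RR _ mu A mA k _ i1. Qed.

Lemma le_integrable_R (A : set R) (f g : R -> R) : measurable (A : set RR) ->
  measurable_fun (A : set RR) f -> (forall x, A x -> `|f x| <= g x) ->
  mu.-integrable A (EFin \o g) -> mu.-integrable A (EFin \o f).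
Proof.
move=> mA mf fg; apply: (@le_integrable _ RR _ mu A mA).
  exact/measurable_EFinP.
by move=> x Ax /=; rewrite lee_fin (le_trans (fg _ Ax))// ler_norm.
Qed.

(** The bound on the integral belongs to the predicate, to be uniform along a
    sequence. *)
Definition square_integrable (F : R -> R) (M : R) :=
  [/\ measurable_fun (I : set RR) F, mu.-integrable I (EFin \o (fun x => F x ^+ 2)) &
      \int[mu]_(x in I) F x ^+ 2 <= M].

Lemma sqint_M_ge0 F M : square_integrable F M -> 0 <= M.
Proof.
by move=> [_ _]; apply: le_trans; apply: Rintegral_ge0 => x _; exact: sqr_ge0.
Qed.

Lemma sqint_mul (A : set R) F M (g : R -> R) (eta : R) : square_integrable F M ->
  measurable (A : set RR) -> A `<=` I -> 0 < eta ->
  measurable_fun (A : set RR) g -> mu.-integrable A (EFin \o (fun x => g x ^+ 2)) ->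
  mu.-integrable A (EFin \o (fun x => F x * g x)) /\
  `|\int[mu]_(x in A) (F x * g x)| <= (eta * M + (\int[mu]_(x in A) g x ^+ 2) / eta) / 2.
Proof.
move=> [mF iF FM] mA AI e0 mg ig.
have iFA : mu.-integrable A (EFin \o (fun x => F x ^+ 2)).
  exact: (@integrableS _ RR _ mu I A _ (measurable_itv _)).
have FA : \int[mu]_(x in A) F x ^+ 2 <= M.
  apply: le_trans FM; rewrite /Rintegral fine_le//.
  - exact: (integrable_fin_num _ iFA).
  - by apply: (integrable_fin_num _ iF).
  - apply: ge0_subset_integral => //.
    + by case/integrableP : iF.
    + by move=> x _; rewrite lee_fin sqr_ge0.
have mFA : measurable_fun (A : set RR) F by exact: measurable_funS mF.
pose G x := (eta * F x ^+ 2 + g x ^+ 2 / eta) / 2.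
have i1 : mu.-integrable A (EFin \o (fun x => (eta / 2) * F x ^+ 2)) by exact: integrableZ_R.
have i2 : mu.-integrable A (EFin \o (fun x => ((eta * 2)^-1) * g x ^+ 2)) by exact: integrableZ_R.
have GE x : G x = (eta / 2) * F x ^+ 2 + ((eta * 2)^-1) * g x ^+ 2.
  by rewrite /G; field; rewrite gt_eqF.
have iG : mu.-integrable A (EFin \o G).
  have := integrableD_R mA i1 i2.
  by congr (integrable _ _ _); apply/funext => x /=; rewrite GE.
have iFg : mu.-integrable A (EFin \o (fun x => F x * g x)).
  apply: (le_integrable_R mA _ _ iG); first exact: measurable_funM.
  by move=> x _; exact: AMGM.
split => //.
rewrite (le_trans (le_normr_Rintegral mA iFg))//.
rewrite (@le_trans _ _ (\int[mu]_(x in A) G x))//.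
  apply: (@le_Rintegral _ RR) => //; first exact: (@integrable_norm _ RR).
  by move=> x _; exact: AMGM.
rewrite (@eq_Rintegral _ RR _ mu A _ G (fun x _ => GE x)).
rewrite (@RintegralD _ RR)// !(@RintegralZl _ RR)//.
rewrite (_ : (eta * M + (\int[mu]_(x in A) g x ^+ 2) / eta) / 2 =
  eta / 2 * M + (eta * 2)^-1 * \int[mu]_(x in A) g x ^+ 2); last first.
  by field; rewrite gt_eqF.
by rewrite lerD2r ler_wpM2l// divr_ge0// ltW.
Qed.

Lemma sqint_integrable F M : square_integrable F M -> mu.-integrable I (EFin \o F).
Proof.
move=> sF.
have [] := @sqint_mul I F M (fun=> 1) 1 sF (measurable_itv _) (fun x h => h) ltr01.
- exact: measurable_cst.
- apply: (@bounded_integrable _ _ 1) => //; first exact: mu01.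
  by move=> x _; rewrite expr1n normr1.
- by move=> + _; congr (integrable _ _ _); apply/funext => x /=; rewrite mulr1.
Qed.

Lemma lint_itv (a b : R) : a <= b -> \int[mu]_(x in `]a, b[) (1 : R) = b - a.
Proof.
move=> ab; transitivity (fine (mu (`]a, b[%classic : set R))).
  by rewrite /Rintegral integral_cst// mul1e.
rewrite lebesgue_measure_itv/= lte_fin.
by move: ab; rewrite le_eqVlt => /predU1P[->|->//]; rewrite ltxx subrr.
Qed.

Lemma sqint_cstN1 : square_integrable (fun=> -1) 1.
Proof.
split; first exact: measurable_cst.
  apply: (@bounded_integrable _ _ 1) => //; first exact: mu01.
  by move=> x _; rewrite sqrrN expr1n normr1.
under eq_Rintegral do rewrite sqrrN expr1n.
by rewrite lint_itv ?subr0.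
Qed.

(** The choice eta = sqrt t in [sqint_mul] gives the order sqrt t of the
    Cauchy-Schwarz inequality. *)
Lemma prim_bound F M t : square_integrable F M -> 0 < t <= 1 ->
  `|\int[mu]_(x in `]0, t[) F x| <= expR (2^-1 * ln t) * ((M + 1) / 2).
Proof.
move=> sF /andP[t0 t1].
set e := expR _; have e0 : 0 < e by exact: expR_gt0.
have ee : t = e * e by rewrite /e -expRD -mulrDl -div1r -splitr mul1r lnK.
have sub : `]0, t[%classic `<=` I.
  by move=> x /=; rewrite !in_itv/= => /andP[-> xt]; exact: lt_le_trans t1.
have [] := @sqint_mul `]0, t[%classic F M (fun=> 1) e sF (measurable_itv _) sub e0.
- exact: measurable_cst.
- apply: (@bounded_integrable _ _ 1) => //.
    by rewrite lebesgue_measure_itv/= lte_fin t0 ltry.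
  by move=> x _; rewrite expr1n normr1.
move=> _; under eq_Rintegral do rewrite mulr1.
move=> /le_trans; apply.
under eq_Rintegral do rewrite expr1n.
rewrite lint_itv ?(ltW t0)// subr0 (_ : t / e = e); last first.
  by rewrite [X in X / _]ee mulfK ?gt_eqF.
by rewrite le_eqVlt; apply/orP; left; apply/eqP; field.
Qed.

Lemma half_split (r K z e : R) : 0 < e -> r * (K + 4) <= e / 3 -> z <= 4 * r -> (r * K + z) / 2 <= e / 3.
Proof. by move=> e0; rewrite mulrDr => ? ?; lra. Qed.

(** The shape of the test functions that approximate the indicator of (0, t). *)
Definition plateau (t d : R) (phi : R -> R) :=
  [/\ measurable_fun setT (phi : RR -> R), (forall x, 0 <= phi x <= 1),
   (forall x, 2 * d <= x < t - 2 * d -> phi x = 1) &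
   (forall x, ~~ (0 < x < t) -> phi x = 0)].

Variables (F_ : nat -> R -> R) (M : R).
Hypothesis sF : forall j, square_integrable (F_ j) M.
Hypothesis Htest : forall t d, 0 < d -> 4 * d < t -> t <= 1 ->
  exists phi : R -> R, plateau t d phi /\
  (fun j => \int[mu]_(x in I) (F_ j x * phi x)) @ \oo --> - \int[mu]_(x in I) phi x.

(** The indicator of (0, t) exceeds the test function by a function k with values
    in [0, 1] and integral at most 4 d. Its square has an integral of order d, so
    that its pairing with F_j is small, uniformly in j. *)
Lemma prim_lim t : 0 < t <= 1 ->
  (fun j => \int[mu]_(x in `]0, t[) F_ j x) @ \oo --> - t.
Proof.
move=> /andP[t0 t1].
have M0 : 0 <= M by exact: sqint_M_ge0 (sF 0).
apply/cvgrPdist_le => e e0.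
(* r is the weight eta of the inequality between means; with d <= r^2, the
   bound (r M + 4 d / r) / 2 is of order r *)
pose r := Num.min (e / 3 / (M + 4)) (Num.min (t / 5) 1).
have r0 : 0 < r.
  by rewrite !lt_min !divr_gt0//= ?ltr_wpDl//= (lt_le_trans t0).
pose d := Num.min (r ^+ 2) (e / 12).
have d0 : 0 < d by rewrite lt_min exprn_gt0//= divr_gt0.
have r1 : r <= 1 by rewrite /r !ge_min lexx !orbT.
have rt : r <= t / 5 by rewrite /r !ge_min lexx !orbT.
have re : r <= e / 3 / (M + 4) by rewrite /r !ge_min lexx.
have dr2 : d <= r ^+ 2 by rewrite /d ge_min lexx.
have dr : d <= r by rewrite (le_trans dr2)// expr2 ler_piMr// ltW.
have d12 : d <= e / 12 by rewrite /d ge_min lexx orbT.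
have d4t : 4 * d < t by lra.
have [phi [[mphi phi01 phi1 phi0] Hphi]] := Htest d0 d4t t1.
pose A : set R := `]0, t[%classic.
have AI : A `<=` I.
  by move=> x; rewrite /A/= !in_itv/= => /andP[-> xt]; exact: lt_le_trans t1.
pose k x := \1_A x - phi x.
have kA x : 0 <= k x <= 1.
  have /andP[p0 p1] := phi01 x; rewrite /k indicE.
  have [xA|xA] := boolP (x \in A); first by rewrite subr_ge0 p1/= lerBlDr lerDl.
  rewrite phi0 ?subrr ?lexx ?ler01//.
  by apply: contra xA => xA; apply/mem_set; rewrite /A/= in_itv.
have mk : measurable_fun (I : set RR) k.
  apply: measurable_funTS; apply: measurable_funB => //.
  by apply: measurable_indic; exact: measurable_itv.
have ik : mu.-integrable I (EFin \o k).
  apply: (@bounded_integrable _ _ 1) => //; first exact: mu01.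
  by move=> x _; have /andP[k0 k1] := kA x; rewrite ger0_norm.
have iphi : mu.-integrable I (EFin \o phi).
  apply: (@bounded_integrable _ _ 1) => //; first exact: mu01.
    exact: measurable_funTS.
  by move=> x _; have /andP[k0 k1] := phi01 x; rewrite ger0_norm.
have intA (f : R -> R) : \int[mu]_(x in I) (f x * \1_A x) = \int[mu]_(x in A) f x.
  rewrite -[in RHS](setIidr AI) Rintegral_mkcondr; apply: eq_Rintegral => x _.
  by rewrite indicE patchE; case: ifP => _; rewrite ?mulr1 ?mulr0.
have iind (S : set R) : measurable (S : set RR) -> mu.-integrable I (EFin \o \1_S).
  move=> mS; apply: (@bounded_integrable _ _ 1) => //; first exact: mu01.
  by move=> x _; rewrite indicE; case: (_ \in _); rewrite ?normr1 ?normr0.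
have kint : \int[mu]_(x in I) k x = t - \int[mu]_(x in I) phi x.
  rewrite (@RintegralB _ RR)//.
    congr (_ - _); have := intA (fun=> 1).
    by under eq_Rintegral do rewrite mul1r; move=> ->; rewrite lint_itv ?subr0// ltW.
  by apply: iind; exact: measurable_itv.
have ik_le : 0 <= \int[mu]_(x in I) k x <= 4 * d.
  apply/andP; split; first by apply: Rintegral_ge0 => x _; case/andP: (kA x).
  pose B : set R := `]2 * d, t - 2 * d[%classic.
  have BI : B `<=` I.
    by move=> x; rewrite /B/= !in_itv/= => /andP[x1 x2]; apply/andP; split; lra.
  rewrite kint; have : t - 4 * d <= \int[mu]_(x in I) phi x.
    have -> : t - 4 * d = \int[mu]_(x in I) (\1_B x).
      have -> : \int[mu]_(x in I) (\1_B x) = \int[mu]_(x in B) (1 : R).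
        rewrite -[in RHS](setIidr BI) Rintegral_mkcondr; apply: eq_Rintegral => x _.
        by rewrite indicE patchE; case: ifP.
      by rewrite lint_itv; lra.
    apply: (@le_Rintegral _ RR) => //.
      by apply: iind; exact: measurable_itv.
    move=> x _; rewrite indicE; have [/set_mem xB|_] := boolP (x \in B).
      by rewrite phi1//; move: xB; rewrite /B/= in_itv/= => /andP[/ltW-> ->].
    by case/andP: (phi01 x).
  lra.
have ik2 : mu.-integrable I (EFin \o (fun x => k x ^+ 2)).
  apply: (le_integrable_R _ _ _ ik) => //; first exact: measurable_funX.
  move=> x _; have /andP[k0 k1] := kA x.
  by rewrite ger0_norm ?sqr_ge0// expr2 ler_piMl.
have k2le : \int[mu]_(x in I) k x ^+ 2 <= 4 * r ^+ 2.
  rewrite (@le_trans _ _ (\int[mu]_(x in I) k x))//.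
    apply: (@le_Rintegral _ RR) => // x _; have /andP[k0 k1] := kA x.
    by rewrite expr2 ler_piMl.
  by case/andP: ik_le => _ /le_trans; apply; rewrite ler_wpM2l.
have Hk j : `|\int[mu]_(x in I) (F_ j x * k x)| <= e / 3.
  have [_] := @sqint_mul I (F_ j) M k r (sF j) (measurable_itv _) (fun x h => h) r0 mk ik2.
  move=> /le_trans; apply.
  have : (\int[mu]_(x in I) k x ^+ 2) / r <= 4 * r.
    by rewrite ler_pdivrMr// -mulrA -expr2.
  have : r * (M + 4) <= e / 3 by rewrite -ler_pdivlMr// ltr_wpDl.
  exact: (half_split e0).
have dec j : \int[mu]_(x in `]0, t[) F_ j x =
    \int[mu]_(x in I) (F_ j x * k x) + \int[mu]_(x in I) (F_ j x * phi x).
  rewrite -intA -(@RintegralD _ RR)//.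
  - by apply: eq_Rintegral => x _; rewrite /k mulrBr subrK.
  - by have [] := @sqint_mul I (F_ j) M k r (sF j) (measurable_itv _) (fun x h => h) r0 mk ik2.
  - have [] // := @sqint_mul I (F_ j) M phi r (sF j) (measurable_itv _) (fun x h => h) r0.
      exact: measurable_funTS.
    apply: (@bounded_integrable _ _ 1) => //; first exact: mu01.
      by apply: measurable_funX; exact: measurable_funTS.
    move=> x _; have /andP[k0 k1] := phi01 x.
    by rewrite ger0_norm ?sqr_ge0// exprn_ile1.
have e30 : 0 < e / 3 by rewrite divr_gt0.
move/cvgrPdist_le : Hphi => /(_ _ e30)[N _ HN]; exists N => // j Nj /=.
have := HN j Nj; rewrite /= dec; have := Hk j.
move: (\int[mu]_(x in I) (F_ j x * k x)) (\int[mu]_(x in I) (F_ j x * phi x)) => X Y.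
move=> /ler_normlP[X1 X2] /ler_normlP[Y1 Y2]; apply/ler_normlP.
have /andP[K1 K2] := ik_le; rewrite kint in K1 K2.
by split; lra.
Qed.

(** For sg > 1/2 such a weight may fail to be integrable near 0, but its product
    with a function of order sqrt t is integrable. *)
Definition weight_bound (sg C : R) (v : R -> R) :=
  measurable_fun (I : set RR) v /\
  forall t, 0 < t < 1 -> `|v t| <= C * expR ((sg - 2) * ln t).

(** The integral of v over (x, 1). The indicator is kept inside the integral to be
    treated as the kernel of a double integral. *)
Definition tail (v : R -> R) (x : R) := \int[mu]_(t in I) ((x < t)%R%:R * v t).

Lemma memI x : I x = (0 < x < 1).
Proof. by rewrite /= in_itv. Qed.

Lemma weight_integrable (sg C c : R) v : weight_bound sg C v -> 1 < sg + c ->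
  mu.-integrable I (EFin \o (fun t => v t * expR (c * ln t))).
Proof.
move=> [mv vC] c1.
have c0 : 0 < sg + c - 1 by rewrite subr_gt0.
have i0 := integrableZ_R C (measurable_itv _) (integrable_power c0 ltr01).
apply: (le_integrable_R (measurable_itv _) _ _ i0).
  apply: measurable_funM => //; apply: measurable_funTS; exact: measurable_expR_ln.
move=> t; rewrite memI => t01; rewrite normrM (ger0_norm (expR_ge0 _)).
rewrite (_ : (sg + c - 1 - 1) * ln t = (sg - 2) * ln t + c * ln t); last by ring.
by rewrite expRD mulrA ler_wpM2r ?expR_ge0// vC.
Qed.

(** Integration by parts, as an exchange of integrals over x < t. As v alone need
    not be integrable, a factor (x/t)^al is introduced in the kernel, where it
    is bounded by 1 for x < t, and compensated by x^-al in one integrand and t^al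
    in the other; al < 1/2 keeps F x^-al integrable and sg + al > 1 makes v t^al
    integrable. *)
Lemma tail_fubini (sg C : R) v F K : 2^-1 < sg <= 1 -> weight_bound sg C v ->
  square_integrable F K ->
  \int[mu]_(x in I) (F x * tail v x) =
  \int[mu]_(t in I) (v t * \int[mu]_(x in `]0, t[) F x).
Proof.
move=> /andP[s2 s1] wv sqF; have [mF iF FK] := sqF.
pose al := (3 / 2 - sg) / 2.
have al0 : 0 <= al by rewrite /al; lra.
have al2 : al < 2^-1 by rewrite /al; lra.
have als : 1 < sg + al by rewrite /al; lra.
pose k (z : R * R) := ((0 < z.1) && (z.1 < z.2))%:R * expR (al * (ln z.1 - ln z.2)).
have mk : measurable_fun setT (k : RR * RR -> R).
  apply: measurable_funM.
    rewrite (_ : (fun _ => _) = (fun z : RR * RR => if (0 < z.1) && (z.1 < z.2) then 1 else 0)); last first.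
      by apply/funext => z; case: (_ && _).
    apply: measurable_fun_ifT => //; apply: measurable_and.
      apply: measurable_fun_ltr => //; exact: measurable_fst.
    by apply: measurable_fun_ltr; [exact: measurable_fst|exact: measurable_snd].
  apply: measurableT_comp => //; apply: measurable_funM => //.
  apply: measurable_funB.
    exact: (measurableT_comp (@measurable_ln R) measurable_fst).
  exact: (measurableT_comp (@measurable_ln R) measurable_snd).
have k1 z : `|k z| <= 1.
  rewrite /k; case: (boolP ((0 < z.1) && (z.1 < z.2))) => [/andP[z0 z12]|_]; last by rewrite mul0r normr0.
  rewrite mul1r ger0_norm ?expR_ge0// expR_le1// mulr_ge0_le0// subr_le0.
  by rewrite ler_ln ?posrE// ?(ltW z12)// (lt_trans z0).
have iu : mu.-integrable I (EFin \o (fun x => F x * expR (- al * ln x))).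
  have [] // := @sqint_mul I F K (fun x => expR (- al * ln x)) 1 sqF (measurable_itv _)
    (fun x h => h) ltr01.
    by apply: measurable_funTS; exact: measurable_expR_ln.
  have c0 : 0 < 1 - 2 * al by lra.
  have := integrable_power c0 ltr01; congr (integrable _ _ _).
  by apply/funext => x /=; rewrite expr2 -expRD; congr (EFin (expR _)); ring.
have iv := weight_integrable wv als.
have := Fubini_bounded (measurable_itv _) (measurable_itv _) iu iv mk k1.
have kE x t : 0 < x -> k (x, t) = (x < t)%R%:R * (expR (al * ln x) * expR (- al * ln t)).
  by move=> x0; rewrite /k/= x0/= -expRD; congr (_ * expR _); ring.
have L : \int[mu]_(x in I) (F x * tail v x) = \int[mu]_(x in I) (F x * expR (- al * ln x) *
    \int[mu]_(y in I) (k (x, y) * (v y * expR (al * ln y)))).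
  apply: eq_Rintegral => x /set_mem; rewrite memI => /andP[x0 x1].
  rewrite -mulrA; congr (_ * _); rewrite /tail -(@RintegralZl _ RR)//.
    apply: eq_Rintegral => t _; rewrite kE//.
    have e1 : expR (- al * ln x) * expR (al * ln x) = 1.
      by rewrite -expRD mulNr addNr expR0.
    have e2 : expR (- al * ln t) * expR (al * ln t) = 1.
      by rewrite -expRD mulNr addNr expR0.
    by rewrite -[LHS]mul1r -e1 -[LHS]mul1r -e2; ring.
  apply: (le_integrable_R (measurable_itv _) _ _ (@integrable_norm _ RR _ _ _ _ iv)).
    apply: measurable_funM; last by apply/measurable_EFinP; exact: (measurable_int mu).
    apply: measurable_funTS; apply: (measurableT_comp mk); exact: measurable_fun_pair.
  by move=> t _; rewrite normrM ler_piMl.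
rewrite L => ->; apply: eq_Rintegral => t /set_mem; rewrite memI => /andP[t0 t1].
rewrite -mulrA; congr (_ * _); rewrite -(@RintegralZl _ RR)//.
  have AI : `]0, t[%classic `<=` I.
    by move=> x /=; rewrite !in_itv/= => /andP[-> xt]; exact: lt_trans t1.
  rewrite -[in RHS](setIidr AI) Rintegral_mkcondr; apply: eq_Rintegral => x /set_mem.
  rewrite memI => /andP[x0 x1]; rewrite kE// patchE mem_setE in_itv/= x0/=.
  have e1 : expR (- al * ln x) * expR (al * ln x) = 1.
    by rewrite -expRD mulNr addNr expR0.
  have e2 : expR (- al * ln t) * expR (al * ln t) = 1.
    by rewrite -expRD mulNr addNr expR0.
  case: ifPn => _; last by rewrite !mul0r mulr0.
  rewrite (_ : true%:R = 1)// mul1r -[RHS]mul1r -e1 -[RHS]mul1r -e2; ring.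
apply: (le_integrable_R (measurable_itv _) _ _ (@integrable_norm _ RR _ _ _ _ iu)).
  apply: measurable_funM; last by apply/measurable_EFinP; exact: (measurable_int mu).
  apply: measurable_funTS; apply: (measurableT_comp mk); exact: measurable_fun_pair.
by move=> x _; rewrite normrM ler_piMl.
Qed.

Lemma measurable_prim F K : square_integrable F K ->
  measurable_fun (I : set RR) (fun t => \int[mu]_(x in `]0, t[) F x).
Proof.
move=> sqF.
have iF : mu.-integrable `[0, 1] (EFin \o (F \_ I)).
  have : mu.-integrable setT (EFin \o (F \_ I)).
    have := (@integrable_mkcond _ RR _ mu I (EFin \o F) (measurable_itv _)).1 (sqint_integrable sqF).
    by rewrite -restrict_EFin.
  by apply: (@integrableS _ RR) => //; exact: measurable_itv.
have := @parameterized_integral_continuous R 0 1 (F \_ I) ler01 iF.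
move=> /subspace_continuous_measurable_fun => /(_ (measurable_itv _)) m1.
apply: (@eq_measurable_fun _ _ _ _ (I : set RR) (fun t => parameterized_integral mu 0 t (F \_ I))).
  move=> t /set_mem; rewrite memI => /andP[t0 t1].
  have AI : `]0, t[%classic `<=` I.
    by move=> x /=; rewrite !in_itv/= => /andP[-> xt]; exact: lt_trans t1.
  have S1 : `[0, t[%classic `<=` `[0, 1]%classic.
    by move=> x /=; rewrite !in_itv/= => /andP[-> xt]; rewrite ltW// (lt_trans xt).
  have S2 : `]0, t[%classic `<=` `[0, 1]%classic.
    by move=> x /=; rewrite !in_itv/= => /andP[/ltW-> xt]; rewrite ltW// (lt_trans xt).
  rewrite /parameterized_integral -Rintegral_itv_bndo_bndc; last first.
    by apply: (@integrableS _ RR) iF => //; exact: measurable_itv.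
  rewrite -Rintegral_itv_obnd_cbnd; last first.
    by apply: (@integrableS _ RR) iF => //; exact: measurable_itv.
  by apply: eq_Rintegral => x /set_mem xt; rewrite patchE mem_set//; exact: AI.
by apply: measurable_funS m1 => //; exact: subset_itv_oo_cc.
Qed.

(** After [tail_fubini] only the primitives of F_j enter. They converge pointwise
    by [prim_lim] and are dominated by a multiple of sqrt t, by [prim_bound]. *)
Lemma tail_lim (sg C : R) v : 2^-1 < sg <= 1 -> weight_bound sg C v ->
  (fun j => \int[mu]_(x in I) (F_ j x * tail v x)) @ \oo -->
  \int[mu]_(x in I) (- 1 * tail v x).
Proof.
move=> sg12 wv; have /andP[s2 s1] := sg12.
rewrite (tail_fubini sg12 wv sqint_cstN1).
under eq_fun do rewrite (tail_fubini sg12 wv (sF _)).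
have c1 : 1 < sg + 2^-1 by lra.
have M0 : 0 <= M by exact: sqint_M_ge0 (sF 0).
have iv := @integrable_norm _ RR _ _ _ _ (weight_integrable wv c1).
have ig := integrableZ_R ((M + 1) / 2) (measurable_itv _) iv.
have mv : measurable_fun (I : set RR) v by exact: wv.1.
have mG j : measurable_fun (I : set RR) (fun t => v t * \int[mu]_(x in `]0, t[) F_ j x).
  by apply: measurable_funM => //; exact: (measurable_prim (sF j)).
have Hb j t : I t -> `|v t * \int[mu]_(x in `]0, t[) F_ j x| <=
    (M + 1) / 2 * `|v t * expR (2^-1 * ln t)|.
  rewrite memI => /andP[t0 t1].
  have t01 : 0 < t <= 1 by rewrite t0 ltW.
  rewrite normrM (le_trans (ler_wpM2l (normr_ge0 _) (prim_bound (sF j) t01)))//.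
  have -> : `|v t * expR (2^-1 * ln t)| = `|v t| * expR (2^-1 * ln t) :> R.
    by rewrite normrM (ger0_norm (expR_ge0 _)).
  by rewrite [X in _ <= X]mulrC -[X in _ <= X]mulrA lexx.
have Hl t : I t -> (fun j => v t * \int[mu]_(x in `]0, t[) F_ j x) @ \oo -->
    v t * \int[mu]_(x in `]0, t[) (-1).
  rewrite memI => /andP[t0 t1]; apply: cvgM; first exact: cvg_cst.
  have -> : \int[mu]_(x in `]0, t[) (-1 : R) = - t.
    transitivity (\int[mu]_(x in `]0, t[) (-1 * 1 : R)).
      by apply: eq_Rintegral => x _; rewrite mulr1.
    rewrite (@RintegralZl _ RR)//; last first.
      apply: (@bounded_integrable _ _ 1) => //.
        by rewrite lebesgue_measure_itv/= lte_fin t0 ltry.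
      by move=> x _; rewrite normr1.
    by rewrite lint_itv ?(ltW t0)// subr0 mulN1r.
  by apply: prim_lim; rewrite t0 ltW.
exact: (@Rintegral_cvg _ RR _ mu I _ _ _ (measurable_itv _) mG ig Hb Hl).2.
Qed.

(** In other words, 1 - x^(s-1) is the integral of (s - 1) t^(s-2) over (x, 1). *)
Lemma tail_power (s : R[i]) (x : R) : 0 < x < 1 ->
  cexp ((s - 1) * (ln x)%:C%C) = 1 -
   ((tail (fun t => complex.Re ((s - 1) * cexp ((s - 2) * (ln t)%:C%C))) x) +i*
   (tail (fun t => complex.Im ((s - 1) * cexp ((s - 2) * (ln t)%:C%C))) x))%C.
Proof.
move=> /andP[x0 x1].
pose f t := (s - 1) * cexp ((s - 2) * (ln t : R)%:C%C).
have tE (v : R -> R) : tail v x = \int[mu]_(t in `]x, 1[) v t.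
  have AI : `]x, 1[%classic `<=` I.
    by move=> t; rewrite memI/= in_itv/= => /andP[xt ->]; rewrite (lt_trans x0).
  rewrite /tail -[in RHS](setIidr AI) Rintegral_mkcondr; apply: eq_Rintegral => t /set_mem.
  rewrite memI => /andP[t0 t1]; rewrite patchE mem_setE in_itv/= t1 andbT.
  by case: ifPn => _; rewrite ?mul1r ?mul0r.
rewrite !tE.
suff H : cint mu `]x, 1[ f = 1 - cexp ((s - 1) * (ln x)%:C%C).
  by transitivity (1 - cint mu `]x, 1[ f); [rewrite H; ring|].
pose c := 1 - x; have c0 : 0 < c by rewrite subr_gt0.
have cn n : 0 < c / n.+3%:R by rewrite divr_gt0.
have cn3 n : c / n.+3%:R <= c / 3.
  by rewrite ler_pM2l// lef_pV2 ?posrE ?ltr0n// ler_nat.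
have dF t : 0 < t -> is_cderive (fun t => cexp ((s - 1) * (ln t)%:C%C)) t (f t).
  move=> t0; have := is_cderive_cexp (s - 1) (is_derive1_ln t0).
  congr is_cderive; rewrite /f -mulrA; congr (_ * _).
  rewrite -[t in t^-1](lnK) ?posrE// -expRN -cexpR -cexpD; congr cexp.
  by rewrite rmorphN/=; ring.
have lim (u : nat -> R) (l : R) : 0 < l -> u @ \oo --> l ->
    ccvg (fun n => cexp ((s - 1) * (ln (u n))%:C%C)) (cexp ((s - 1) * (ln l)%:C%C)).
  move=> l0 ul; have [c1 c2] := is_cderive_continuous (dF _ l0).
  by apply/ccvg_ReIm; split; [exact: (continuous_cvg _ c1)|exact: (continuous_cvg _ c2)].
have L1 : ccvg (fun n => cexp ((s - 1) * (ln (x + c / n.+3%:R))%:C%C))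
    (cexp ((s - 1) * (ln x)%:C%C)).
  apply: lim => //.
  have H : (fun n : nat => x + c / n.+3%:R) @ \oo --> x + 0.
    by apply: cvgD; [exact: cvg_cst|exact: cvg_div3].
  by rewrite addr0 in H.
have L2 : ccvg (fun n => cexp ((s - 1) * (ln (1 - c / n.+3%:R))%:C%C))
    (cexp ((s - 1) * (ln (1 : R))%:C%C)).
  apply: lim; first exact: ltr01.
  have H : (fun n : nat => 1 - c / n.+3%:R) @ \oo --> (1 - 0 : R).
    by apply: cvgB; [exact: cvg_cst|exact: cvg_div3].
  by rewrite subr0 in H.
rewrite ln1 mulr0 cexp0 in L2.
have Dn t : x < t < 1 -> \forall n \near \oo, x + c / n.+3%:R <= t <= 1 - c / n.+3%:R.
  move=> /andP[xt t1].
  have m0 : 0 < Num.min (t - x) (1 - t) by rewrite lt_min !subr_gt0 xt.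
  have /cvgrPdist_lt/(_ _ m0)[N _ HN] := cvg_div3 c.
  exists N => // n Nn; have /= := HN n Nn; rewrite sub0r normrN ger0_norm ?(ltW (cn n))//.
  by rewrite lt_min; move: (c / _) => z /andP[h1 h2]; apply/andP; split; lra.
apply: (@cint_improper_FTC _ _ f (fun t => cexp ((s - 1) * (ln t)%:C%C))
  (fun n => x + c / n.+3%:R) (fun n => 1 - c / n.+3%:R) _ _ _ _ _ _ _ _ L1 L2).
- exact: measurable_itv.
- by move=> n; have := cn3 n; move: (c / _) => z zc; clear -zc c0; rewrite /c in zc c0; lra.
- move=> n t /andP[t1 t2]; rewrite /= in_itv/=; have := cn n; move: t1 t2.
  by move: (c / _) => z *; apply/andP; split; lra.
- by move=> t /=; rewrite in_itv/= => /Dn.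
- by move=> t /=; rewrite in_itv/= => /andP[xt _]; apply: dF; exact: lt_trans xt.
- move=> t /=; rewrite in_itv/= => /andP[xt _]; eexists; apply: is_cderiveZ.
  by apply: is_cderive_cexp; apply: is_derive1_ln; exact: lt_trans xt.
- apply: (@cintegrable_le _ RR _ mu _ _
    (fun=> cabs (s - 1) * expR (`|complex.Re (s - 2)| * - ln x))).
  + exact: measurable_itv.
  + apply: cmeasM; first exact: cmeas_cst.
    apply: cmeas_cexp; [exact: measurable_itv|].
    apply: cmeasM; first exact: cmeas_cst.
    apply: cmeas_real; apply: measurable_funTS; exact: measurable_ln.
  + apply: (@bounded_integrable _ _ (cabs (s - 1) * expR (`|complex.Re (s - 2)| * - ln x))).
    * exact: measurable_itv.
    * by rewrite lebesgue_measure_itv/= lte_fin x1 ltry.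
    * exact: measurable_cst.
    * by move=> t _; rewrite ger0_norm// mulr_ge0 ?cabs_ge0 ?expR_ge0.
  + move=> t /=; rewrite in_itv/= => /andP[xt t1]; have t0 := lt_trans x0 xt.
    rewrite cabsM cabs_cexp Re_mulR ler_wpM2l ?cabs_ge0// ler_expR.
    rewrite (le_trans (ler_norm _))// normrM ler_wpM2l// ler0_norm ?ln_le0 ?(ltW t1)//.
    by rewrite lerN2 ler_ln ?posrE// ltW.
Qed.

(** Capping the exponent at 1 is harmless on (0, 1), and keeps it in the range of
    [tail_fubini] also for Re s > 1. *)
Lemma weight_power (s : R[i]) : 2^-1 < complex.Re s ->
  exists sg C, [/\ 2^-1 < sg <= 1,
   weight_bound sg C (fun t => complex.Re ((s - 1) * cexp ((s - 2) * (ln t)%:C%C))) &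
   weight_bound sg C (fun t => complex.Im ((s - 1) * cexp ((s - 2) * (ln t)%:C%C)))].
Proof.
move=> s2.
have H t : 0 < t < 1 -> cabs ((s - 1) * cexp ((s - 2) * (ln t)%:C%C)) <=
    cabs (s - 1) * expR ((Num.min (complex.Re s) 1 - 2) * ln t).
  move=> /andP[t0 t1]; rewrite cabsM cabs_cexp Re_mulR ler_wpM2l ?cabs_ge0// ler_expR.
  apply: ler_wnM2r; first by rewrite ln_le0// ltW.
  by rewrite ReD ReN Re_nat lerD2r ge_min lexx.
have [m1 m2] : cmeas (I : set RR) (fun t : RR => (s - 1) * cexp ((s - 2) * (ln t)%:C%C)).
  apply: cmeasM; first exact: cmeas_cst.
  apply: cmeas_cexp; first exact: measurable_itv.
  apply: cmeasM; first exact: cmeas_cst.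
  apply: cmeas_real; apply: measurable_funTS; exact: measurable_ln.
exists (Num.min (complex.Re s) 1), (cabs (s - 1)); split.
- by rewrite lt_min s2 invf_lt1//= ltr1n ge_min lexx orbT.
- by split => // t t01; apply: le_trans (H t t01); exact: normr_Re_le.
- by split => // t t01; apply: le_trans (H t t01); exact: normr_Im_le.
Qed.

Lemma split_tail F K (g v : R -> R) (c : R) : square_integrable F K ->
  measurable_fun (I : set RR) g -> mu.-integrable I (EFin \o (fun x => g x ^+ 2)) ->
  (forall x, 0 < x < 1 -> g x = c - tail v x) ->
  \int[mu]_(x in I) (F x * g x) = c * \int[mu]_(x in I) F x - \int[mu]_(x in I) (F x * tail v x).
Proof.
move=> sqF mg ig gE.
have [iFg _] := sqint_mul sqF (measurable_itv _) (fun x h => h) ltr01 mg ig.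
have iF := sqint_integrable sqF.
have icF := integrableZ_R c (measurable_itv _) iF.
rewrite -(@RintegralZl _ RR)//.
rewrite (_ : \int[mu]_(x in I) (F x * tail v x) =
    \int[mu]_(x in I) (c * F x - F x * g x)).
  by rewrite (@RintegralB _ RR)// opprB addrC subrK.
apply: eq_Rintegral => x /set_mem; rewrite memI => x01.
by rewrite gE// mulrBr opprB addrCA (mulrC c) subrr addr0.
Qed.

(** The pairings with 1 and with the tail of v converge by [prim_lim] and
    [tail_lim]; the limits are those of the pairings with the constant -1. *)
Lemma weak_lim (sg C c : R) (g v : R -> R) : 2^-1 < sg <= 1 -> weight_bound sg C v ->
  measurable_fun (I : set RR) g -> mu.-integrable I (EFin \o (fun x => g x ^+ 2)) ->
  (forall x, 0 < x < 1 -> g x = c - tail v x) ->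
  (fun j => \int[mu]_(x in I) (F_ j x * g x)) @ \oo --> - \int[mu]_(x in I) g x.
Proof.
move=> sg12 wv mg ig gE.
have i1 : mu.-integrable I (EFin \o (fun=> 1 : R)).
  by apply: (@bounded_integrable _ _ 1) => //; [exact: mu01|move=> x _; rewrite normr1].
have [iFg _] := sqint_mul sqint_cstN1 (measurable_itv _) (fun x h => h) ltr01 mg ig.
have gI : mu.-integrable I (EFin \o g).
  have := integrableZ_R (-1) (measurable_itv _) iFg.
  by congr (integrable _ _ _); apply/funext => x /=; rewrite !mulN1r opprK.
have -> : - (\int[mu]_(x in I) g x) = c * (- 1) - \int[mu]_(x in I) (- 1 * tail v x).
  rewrite -[LHS]mulN1r -(@RintegralZl _ RR)// (split_tail sqint_cstN1 mg ig gE); congr (_ * _ - _).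
  have -> : \int[mu]_(x in I) (-1 : R) = \int[mu]_(x in I) (-1 * 1 : R) :> R.
    by apply: eq_Rintegral => x _; rewrite mulr1.
  by rewrite (@RintegralZl _ RR)// lint_itv// subr0 mulr1.
under eq_fun do rewrite (split_tail (sF _) mg ig gE).
apply: cvgB; last exact: (tail_lim sg12 wv).
apply: cvgM; first exact: cvg_cst.
by apply: prim_lim; rewrite ltr01 lexx.
Qed.

(** The limit is the pairing of x^(s-1) with the constant -1, and x^(s-1) is square
    integrable because Re s > 1/2. *)
Lemma mellin_weak (s : R[i]) : 2^-1 < complex.Re s ->
  ccvg (fun j => mellin 1 (F_ j) s) (- s^-1).
Proof.
move=> s2; have s0 : 0 < complex.Re s by rewrite (lt_trans _ s2)// invr_gt0.
have [sg [C [sg12 w1 w2]]] := weight_power s2.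
pose g x := cexp ((s - 1) * (ln x : R)%:C%C).
have gE (h x : R) : 0 < x -> (h * expR (- ln x))%:C%C * cexp (s * (ln x)%:C%C) = h%:C%C * g x.
  move=> x0; rewrite realCM -mulrA -cexpR -cexpD; congr (_ * cexp _).
  by rewrite rmorphN/=; ring.
have [m1 m2] : cmeas (I : set RR) (g : RR -> R[i]).
  apply: cmeas_cexp; first exact: measurable_itv.
  apply: cmeasM; first exact: cmeas_cst.
  apply: cmeas_real; apply: measurable_funTS; exact: measurable_ln.
have g2 x : cabs (g x) ^+ 2 = expR ((2 * complex.Re s - 1 - 1) * ln x).
  rewrite cabs_cexp Re_mulR expr2 -expRD ReD ReN (_ : complex.Re (1 : R[i]) = 1)//.
  by congr expR; ring.
have c0 : 0 < 2 * complex.Re s - 1 by lra.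
have sq (z : R[i]) (r : R) : `|r| <= cabs z -> `|r ^+ 2| <= cabs z ^+ 2.
  by move=> h; rewrite normrX ler_pXn2r// ?nnegrE ?cabs_ge0.
have i1 : mu.-integrable I (EFin \o (fun x => complex.Re (g x) ^+ 2)).
  apply: (le_integrable_R (measurable_itv _) _ _ (integrable_power c0 ltr01)).
    exact: measurable_funX.
  by move=> x _; rewrite -g2; apply: sq; exact: normr_Re_le.
have i2 : mu.-integrable I (EFin \o (fun x => complex.Im (g x) ^+ 2)).
  apply: (le_integrable_R (measurable_itv _) _ _ (integrable_power c0 ltr01)).
    exact: measurable_funX.
  by move=> x _; rewrite -g2; apply: sq; exact: normr_Im_le.
have e1 x : 0 < x < 1 -> complex.Re (g x) = 1 -
    tail (fun t => complex.Re ((s - 1) * cexp ((s - 2) * (ln t)%:C%C))) x.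
  by move=> x01; rewrite /g tail_power// ReD ReN.
have e2 x : 0 < x < 1 -> complex.Im (g x) = 0 -
    tail (fun t => complex.Im ((s - 1) * cexp ((s - 2) * (ln t)%:C%C))) x.
  by move=> x01; rewrite /g tail_power// ImD ImN.
have mE (F : R -> R) : mellin 1 F s = ((\int[mu]_(x in I) (F x * complex.Re (g x))) +i*
    (\int[mu]_(x in I) (F x * complex.Im (g x))))%C.
  apply: complex_eq; apply: eq_Rintegral => x /set_mem; rewrite memI => /andP[x0 _].
    by rewrite gE// Re_realM.
  by rewrite gE// Im_realM.
have -> : - s^-1 = ((- (\int[mu]_(x in I) complex.Re (g x))) +i*
    (- (\int[mu]_(x in I) complex.Im (g x))))%C.
  have := mellin1 ltr01 s0; rewrite ln1 mulr0 cexp0 mulr1 => <-.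
  rewrite mE; apply: complex_eq; rewrite ?ReN ?ImN /=; congr (- _);
    by apply: eq_Rintegral => x _; rewrite mul1r.
apply/ccvg_ReIm; split.
  by under eq_fun do rewrite mE; exact: (weak_lim sg12 w1 m1 i1 e1).
by under eq_fun do rewrite mE; exact: (weak_lim sg12 w2 m2 i2 e2).
Qed.

End WeakLimit.

(** * Multiplicative regularization *)

Section Mollifier.
Context {R : realType}.
Local Notation mu := (@lebesgue_measure R).
Local Notation RR := (measurableTypeR R).
Local Notation I01 := (`]0, 1[%classic : set R).

Lemma cst_lim (a b : R) : (fun _ : nat => a) @ \oo --> b -> b = a.
Proof.
move=> h; have h2 : (fun _ : nat => a) @ \oo --> a by exact: cvg_cst.
by apply: (cvg_unique _ h h2); exact: Rhausdorff.
Qed.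

Lemma derive1n_affine (f : R -> R) (a d : R) m : smooth_on setT f ->
  derive1n m (fun x => f ((x - a) / d)) = (fun x => d^-1 ^+ m * derive1n m f ((x - a) / d)).
Proof.
move=> sf; elim: m => [|m IH]; first by apply/funext => x; rewrite expr0 mul1r.
rewrite /derive1n iterS -/(derive1n m _) IH; apply/funext => x.
have D : is_derive ((x - a) / d) 1 (derive1n m f) (derive1n m.+1 f ((x - a) / d)).
  have := sf m ((x - a) / d) I => /derivableP.
  by rewrite -derive1E.
rewrite derive1E.
have E : is_derive x 1 (fun x => (x - a) / d) d^-1.
  by apply: is_derive_eq; rewrite /GRing.scale/=; ring.
have := @is_deriveZ _ _ _ _ (d^-1 ^+ m) x 1 _ (@is_derive1_comp _ _ (fun x => (x - a) / d) _ _ _ D E).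
move=> /(@derive_val _ _ _ _ _ _ _) ->.
by rewrite exprSr /GRing.scale/=; ring.
Qed.

Lemma smooth_affine (f : R -> R) (a d : R) : smooth_on setT f ->
  smooth_on setT (fun x => f ((x - a) / d)).
Proof.
move=> sf m x _; rewrite derive1n_affine//.
have D : derivable (derive1n m f) ((x - a) / d) 1 by exact: sf.
have E : is_derive x 1 (fun x => (x - a) / d) d^-1.
  by apply: is_derive_eq; rewrite /GRing.scale/=; ring.
have [+ _] := @is_deriveZ _ _ _ _ (d^-1 ^+ m) x 1 _ (@is_derive1_comp _ _ (fun x => (x - a) / d) _ _ _ (derivableP D) E).
exact.
Qed.

Lemma smoothB (f g : R -> R) : smooth_on setT f -> smooth_on setT g ->
  smooth_on setT (fun x => f x - g x).
Proof.
move=> sf sg.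
have H m : derive1n m (fun x => f x - g x) = (fun x => derive1n m f x - derive1n m g x).
  elim: m => [//|m IH]; rewrite /derive1n iterS -/(derive1n m _) IH; apply/funext => x.
  rewrite derive1E.
  have := is_deriveB (derivableP (sf m x I)) (derivableP (sg m x I)).
  move=> /(@derive_val _ _ _ _ _ _ _) ->.
  by rewrite -!derive1E.
by move=> m x _; rewrite H; apply: derivableB; [exact: sf|exact: sg].
Qed.

Variable psi : R -> R.
Hypothesis hpsi : is_mollifier psi.

Lemma psi_ge0 x : 0 <= psi x. Proof. by have [_ _ + _] := hpsi; apply. Qed.

Lemma psi_continuous : continuous psi.
Proof.
have [+ _ _ _] := hpsi => /(_ 0%N) h x.
by apply/differentiable_continuous/derivable1_diffP; exact: h.
Qed.

Lemma psi_out x : ~~ (-1 <= x <= 0) -> psi x = 0.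
Proof.
have [_ h _ _] := hpsi => xn; apply/eqP; apply: contraNT xn => p0.
by have := h x (@subset_closure _ [set x | psi x != 0] x p0); rewrite /= in_itv.
Qed.

Lemma measurable_psi : measurable_fun setT (psi : RR -> R).
Proof. exact: continuous_measurable_fun psi_continuous. Qed.

Lemma psi_integrable : mu.-integrable setT (EFin \o psi).
Proof.
apply/integrableP; split; first by apply/measurable_EFinP; exact: measurable_psi.
have [_ _ _ h] := hpsi; under eq_integral do rewrite /= ger0_norm ?psi_ge0//.
by rewrite h ltry.
Qed.

(** A smooth step, from 0 for x <= -1 to 1 for x >= 0. Being a primitive of the
    mollifier, it provides test functions without a further construction of smooth
    functions. *)
Definition ramp (x : R) : R := \int[mu]_(t in `]-oo, x]) psi t.

Lemma psi_integrableS (A : set R) : measurable (A : set RR) -> mu.-integrable A (EFin \o psi).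
Proof. by move=> mA; apply: (@integrableS _ RR _ mu setT A _ measurableT mA _ psi_integrable). Qed.

Lemma is_derive_ramp (x : R) : is_derive x 1 ramp (psi x).
Proof.
have x1 : x < x + 1 by rewrite ltrDl.
have [] := @continuous_FTC1 R psi (BInfty _ true) x (x + 1) x1.
- exact: (psi_integrableS (measurable_itv _)).
- by rewrite ltNyr.
- exact: psi_continuous.
by move=> d1 d2; apply: DeriveDef; [exact: d1|rewrite -derive1E; exact: d2].
Qed.

Lemma ramp_smooth : smooth_on setT ramp.
Proof.
move=> [|m] x _; first by have [] := is_derive_ramp x.
rewrite /derive1n iterSr (_ : (ramp^`())%classic = psi); first by have [+ _ _ _] := hpsi; apply.
apply/funext => y; rewrite derive1E; exact: (@derive_val _ _ _ _ _ _ _ (is_derive_ramp y)).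
Qed.

Lemma ramp_le x y : x <= y -> ramp x <= ramp y.
Proof.
move=> xy; rewrite /ramp /Rintegral fine_le//.
- exact: (integrable_fin_num _ (psi_integrableS (measurable_itv _))).
- exact: (integrable_fin_num _ (psi_integrableS (measurable_itv _))).
- apply: (@ge0_subset_integral _ RR) => //.
  + by case/integrableP: (psi_integrableS (measurable_itv `]-oo, y])).
  + by move=> t _; rewrite lee_fin psi_ge0.
  + by move=> t /=; rewrite !in_itv/= => /le_trans; apply.
Qed.

Lemma ramp0 x : x <= -1 -> ramp x = 0.
Proof.
move=> x1; have : ramp x <= ramp (-1) by exact: ramp_le.
suff -> : ramp (-1) = 0.
  by move=> h; apply/eqP; rewrite eq_le h/=; apply: Rintegral_ge0 => t _; exact: psi_ge0.
rewrite /ramp -Rintegral_itv_bndo_bndc; last exact: (psi_integrableS (measurable_itv _)).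
transitivity (\int[mu]_(t in `]-oo, (-1)%R[) (0 : R)).
  apply: eq_Rintegral => t /set_mem/=; rewrite in_itv/= => t1; apply: psi_out.
  by rewrite leNgt t1.
by rewrite /Rintegral integral0.
Qed.

Lemma ramp1 x : 0 <= x -> ramp x = 1.
Proof.
move=> x0; rewrite /ramp; have [_ _ _ h] := hpsi.
rewrite -[1](_ : fine 1%E = 1)// -h /Rintegral; congr fine.
rewrite [LHS]integral_mkcond; apply: eq_integral => t _.
rewrite patchE; case: ifPn => // /negP tx; rewrite psi_out//.
apply/negP => /andP[_ t0]; apply: tx; apply/mem_set; rewrite /= in_itv/=.
exact: le_trans x0.
Qed.

Lemma ramp01 x : 0 <= ramp x <= 1.
Proof.
apply/andP; split; first by apply: Rintegral_ge0 => t _; exact: psi_ge0.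
rewrite -(@ramp1 (Num.max 0 x)) ?le_max ?lexx//.
by apply: ramp_le; rewrite le_max lexx orbT.
Qed.

Lemma ramp_measurable : measurable_fun setT (ramp : RR -> R).
Proof.
apply: continuous_measurable_fun => x.
by apply/differentiable_continuous/derivable1_diffP; have [] := is_derive_ramp x.
Qed.

(** The first step rises between d and 2 d, the second one between t - 2 d and
    t - d. *)
Definition ramp_bump (t d x : R) := ramp ((x - 2 * d) / d) - ramp ((x - (t - d)) / d).

Lemma ramp_bump_plateau t d : 0 < d -> 4 * d < t -> plateau t d (ramp_bump t d).
Proof.
move=> d0 dt; split.
- have mc (a : R) : measurable_fun setT (fun x : RR => ramp ((x - a) / d)).
    apply: (measurableT_comp ramp_measurable).
    by apply: measurable_funM => //; apply: measurable_funB.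
  by apply: measurable_funB; exact: mc.
- move=> x; rewrite /ramp_bump; have /andP[h0 h1] := ramp01 ((x - 2 * d) / d).
  have /andP[h2 h3] := ramp01 ((x - (t - d)) / d).
  rewrite subr_ge0 ramp_le; last by rewrite ler_pM2r ?invr_gt0//; lra.
  by rewrite lerBlDr (le_trans h1)// lerDl.
- move=> x /andP[x1 x2]; rewrite /ramp_bump ramp1; last by rewrite divr_ge0 ?(ltW d0)// subr_ge0.
  by rewrite ramp0 ?subr0// ler_pdivrMr//; lra.
- move=> x; rewrite negb_and -!leNgt /ramp_bump => /orP[x0|x0].
    by rewrite !ramp0 ?subrr// ler_pdivrMr//; lra.
  by rewrite !ramp1 ?subrr// divr_ge0 ?(ltW d0)//; lra.
Qed.

Lemma ramp_bump_supp t d x : 0 < d -> 4 * d < t -> ~~ (d <= x <= t - d) -> ramp_bump t d x = 0.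
Proof.
move=> d0 dt; rewrite negb_and -!ltNge /ramp_bump => /orP[x0|x0].
  by rewrite !ramp0 ?subrr// ler_pdivrMr//; lra.
by rewrite !ramp1 ?subrr// divr_ge0 ?(ltW d0)//; lra.
Qed.

Lemma ramp_bump_test t d : 0 < d -> 4 * d < t -> t <= 1 -> test_function (ramp_bump t d).
Proof.
move=> d0 dt t1.
have S : tsupport (ramp_bump t d) `<=` `[d, t - d].
  rewrite /tsupport; have /closure_id -> : closed `[d, t - d]%classic by exact: interval_closed.
  apply: closure_subset => x /= bx; rewrite in_itv/=.
  by apply: contraNT bx => h; rewrite ramp_bump_supp.
split.
- by apply: smoothB; apply: smooth_affine; exact: ramp_smooth.
- apply: (subclosed_compact _ (@segment_compact _ d (t - d)) S).
  exact: closed_closure.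
- move=> x /S; rewrite /= !in_itv/= => /andP[h1 h2]; apply/andP; split; lra.
Qed.

(** The density of the regularization with respect to dy. *)
Definition kernel (eps y : R) := scaled_mollifier psi eps y / y.

Section Kernel.
Variable eps : R.
Hypothesis eps0 : 0 < eps.

Lemma kernel_ge0 y : 0 < y -> 0 <= kernel eps y.
Proof.
by move=> y0; rewrite /kernel/scaled_mollifier !mulr_ge0 ?psi_ge0 ?invr_ge0// ltW.
Qed.

Lemma kernel_out y : 0 < y -> ~~ (expR (- eps) <= y <= 1) -> kernel eps y = 0.
Proof.
move=> y0; rewrite /kernel/scaled_mollifier => h; rewrite psi_out ?mulr0 ?mul0r//.
apply: contra h => /andP[h1 h2]; apply/andP; split.
  rewrite -[y]lnK ?posrE// ler_expR; move: h1; rewrite ler_pdivlMr//; lra.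
by rewrite -ler_ln ?posrE// ln1; move: h2; rewrite ler_pdivrMr// mul0r.
Qed.

Lemma kernel_measurable : measurable_fun (`]0, +oo[%classic : set RR) (kernel eps).
Proof.
apply: (@eq_measurable_fun _ _ _ _ _ (fun y => eps^-1 * psi (ln y / eps) * expR (- ln y))).
  by move=> y /set_mem/=; rewrite in_itv/= andbT => y0; rewrite expRN lnK.
apply: measurable_funTS.
apply: measurable_funM; last first.
  exact: measurable_expRN_ln.
apply: measurable_funM => //; apply: (measurableT_comp measurable_psi).
by apply: measurable_funM => //; exact: measurable_ln.
Qed.

(** The primitive of the kernel is ramp (ln y / eps). *)
Lemma kernel_int : mu.-integrable `]0, +oo[ (EFin \o kernel eps) /\
  \int[mu]_(y in `]0, +oo[) kernel eps y = 1.
Proof.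
pose a_ (n : nat) : R := n.+2%:R^-1; pose b_ (n : nat) : R := n.+2%:R.
have ab n : a_ n < b_ n.
  by rewrite /a_/b_ (@lt_trans _ _ 1)// ?invf_lt1 ?ltr1n ?ltr0n.
have a0 n : 0 < a_ n by rewrite invr_gt0 ltr0n.
have abD n x : a_ n <= x <= b_ n -> `]0, +oo[%classic x.
  by move=> /andP[+ _]; rewrite /= in_itv/= andbT; apply: lt_le_trans.
have Dab x : `]0, +oo[%classic x -> \forall n \near \oo, a_ n <= x <= b_ n.
  rewrite /= in_itv/= andbT => x0.
  exists (Num.truncn (x + x^-1)).+1 => // n /= nn.
  have h : x + x^-1 < n%:R.
    rewrite (lt_le_trans (truncnS_gt _))// ler_nat//.
  have n2 : n%:R <= n.+2%:R :> R by rewrite ler_nat -addn2 leq_addr.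
  have xi : 0 < x^-1 by rewrite invr_gt0.
  rewrite /a_/b_; apply/andP; split.
    rewrite -[leRHS]invrK lef_pV2 ?posrE ?invr_gt0//; lra.
  lra.
have dF (x : R) : `]0, +oo[%classic x -> is_derive x 1 (fun x => ramp (ln x / eps)) (kernel eps x).
  rewrite /= in_itv/= andbT => x0.
  have E : is_derive x 1 (fun x => ln x / eps) (x^-1 / eps).
    have := is_derive1_ln x0 => dl.
    by apply: is_derive_eq; rewrite /GRing.scale/=; ring.
  have := @is_derive1_comp _ _ (fun x => ln x / eps) _ _ _ (is_derive_ramp _) E.
  by congr is_derive; rewrite /kernel/scaled_mollifier; ring.
have cf (x : R) : `]0, +oo[%classic x -> {for x, continuous (kernel eps)}.
  rewrite /= in_itv/= andbT => x0.
  apply: (@cvgM _ _ _ _ (scaled_mollifier psi eps) (fun y => y^-1)).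
    apply: cvgM; first exact: cvg_cst.
    apply: (@continuous_comp _ _ _ (fun y : R => ln y / eps) psi x); last exact: psi_continuous.
    by apply: cvgM; [exact: continuous_ln|exact: cvg_cst].
  by apply: cvgV; [rewrite gt_eqF|exact: cvg_id].
have Fa : ramp (ln (a_ n) / eps) @[n --> \oo] --> (0 : R).
  apply: cvg_near_cst.
  exists (Num.truncn (expR eps)).+1 => // n /= nn; apply: ramp0.
  rewrite ler_pdivrMr// mulN1r /a_ lnV ?posrE ?ltr0n// lerN2.
  rewrite -[eps]expRK ler_ln ?posrE ?expR_gt0// (le_trans (ltW (truncnS_gt _)))// ler_nat.
  by rewrite (leq_trans nn)// -addn2 leq_addr.
have Fb : ramp (ln (b_ n) / eps) @[n --> \oo] --> (1 : R).
  apply: cvg_near_cst; exists 0%N => // n _; apply: ramp1.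
  by rewrite divr_ge0 ?(ltW eps0)// ln_ge0// ler1n.
have iq : mu.-integrable `]0, +oo[ (EFin \o kernel eps).
  apply: (improper_FTC_integrable (measurable_itv _) ab abD Dab dF cf Fa Fb).
  - exact: kernel_measurable.
  - by move=> x /=; rewrite in_itv/= andbT; exact: kernel_ge0.
  - by move=> n m nm; rewrite /a_ lef_pV2 ?posrE ?ltr0n// ler_nat !ltnS.
  - by move=> n m nm; rewrite /b_ ler_nat !ltnS.
split => //.
by rewrite (improper_FTC (measurable_itv _) ab abD Dab dF cf Fa Fb iq) subr0.
Qed.

Lemma mollifyE (f : R -> R) x : mollify psi eps f x =
  \int[mu]_(y in `]0, +oo[) ((f \_ `]0, 1[) (x / y) * kernel eps y).
Proof. by apply: eq_Rintegral => y _; rewrite /kernel mulrA. Qed.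

(** For these x the quotients x / y, with y in the support [exp (- eps), 1] of the
    kernel, stay in (0, 1). *)
Lemma mollify_chi x : 0 < x -> x < expR (- eps) -> mollify psi eps chi x = 1.
Proof.
move=> x0 xe; rewrite mollifyE.
transitivity (\int[mu]_(y in `]0, +oo[) kernel eps y); last exact: kernel_int.2.
apply: eq_Rintegral => y /set_mem/=; rewrite in_itv/= andbT => y0.
have [/andP[y1 _]|yn] := boolP (expR (- eps) <= y <= 1); last by rewrite kernel_out ?mulr0.
rewrite patchE mem_set; last first.
  rewrite /= in_itv/= divr_gt0//= ltr_pdivrMr// mul1r; exact: lt_le_trans y1.
rewrite /chi indicE mem_set ?mul1r//=.
by rewrite in_itv/= divr_gt0//= ltr_pdivrMr// mul1r; exact: lt_le_trans y1.
Qed.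

End Kernel.

(** The kernels are probability densities carried by [exp (- eps), 1], where y^s is
    close to 1. *)
Lemma kernel_moment (s : R[i]) :
  ccvg (fun j : nat => lap mu `]0, +oo[ (kernel (j.+1%:R^-1)) (@ln R) s) 1.
Proof.
have [c1 c2] := is_cderive_continuous (is_cderive_cexp s (is_derive_id (0 : R) 1)).
apply/ccvgP => e e0; have e3 : 0 < e / 5 by rewrite divr_gt0.
move/cvgrPdist_lt : c1 => /(_ _ e3)/nbhs_ballP[d1 d10 h1].
move/cvgrPdist_lt : c2 => /(_ _ e3)/nbhs_ballP[d2 d20 h2].
pose d := Num.min d1 d2; have d0 : 0 < d by rewrite lt_min (d10 : 0 < d1) (d20 : 0 < d2).
have s00 : s * (0 : R)%:C%C = 0 by rewrite mulr0.
have h1' t : `|0 - t| < d1 -> `|complex.Re (1 : R[i]) - complex.Re (cexp (s * t%:C%C))| < e / 5.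
  by move=> td; have := h1 t td; rewrite s00 cexp0.
have h2' t : `|0 - t| < d2 -> `|complex.Im (1 : R[i]) - complex.Im (cexp (s * t%:C%C))| < e / 5.
  by move=> td; have := h2 t td; rewrite s00 cexp0.
exists (Num.truncn d^-1).+1 => j nj.
have ej0 : 0 < j.+1%:R^-1 :> R by rewrite invr_gt0.
have ejd : j.+1%:R^-1 < d.
  rewrite -[ltRHS]invrK ltf_pV2 ?posrE ?ltr0n ?invr_gt0//.
  by rewrite (lt_le_trans (truncnS_gt _))// ler_nat (leq_trans nj).
set q := kernel _; have [iq q1] := kernel_int ej0.
have q0 y : `]0, +oo[%classic y -> 0 <= q y.
  by rewrite /= in_itv/= andbT => y0; apply: kernel_ge0.
have mq : measurable_fun (`]0, +oo[%classic : set RR) q by exact: kernel_measurable.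
have mD : measurable (`]0, +oo[%classic : set RR) by exact: measurable_itv.
have near1 y : `]0, +oo[%classic y -> q y * cabs (cexp (s * (ln y)%:C%C) - 1) <= q y * (2 * (e / 5)).
  rewrite /= in_itv/= andbT => y0.
  have [/andP[y1 y2]|yn] := boolP (expR (- j.+1%:R^-1) <= y <= 1); last first.
    by rewrite /q kernel_out// !mul0r.
  rewrite ler_wpM2l ?kernel_ge0//.
  have ly : `|0 - ln y| < d.
    rewrite sub0r normrN ler0_norm ?ln_le0// (le_lt_trans _ ejd)// lerNl.
    by rewrite -[leLHS]expRK ler_ln ?posrE ?expR_gt0.
  rewrite (le_trans (cabs_le_ReIm _))// mulr_natl mulr2n.
  have [l1 l2] : `|0 - ln y| < d1 /\ `|0 - ln y| < d2.
    by move: ly; rewrite /d lt_min => /andP[].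
  rewrite ReD ImD ReN ImN -normrN opprB -[X in _ + X <= _]normrN [- (_ - complex.Im _)]opprB.
  by apply: lerD; apply: ltW; [exact: h1'|exact: h2'].
have iqe : mu.-integrable `]0, +oo[ (EFin \o (fun y => q y * (2 * (e / 5)))).
  by have := @integrableZr _ RR _ mu _ mD (2 * (e / 5)) _ iq.
have ccexp : cmeas (`]0, +oo[%classic : set RR) (fun y : RR => cexp (s * (ln y)%:C%C)).
  apply: cmeas_cexp => //; apply: cmeasM; first exact: cmeas_cst.
  by apply: cmeas_real; apply: measurable_funTS; exact: measurable_ln.
pose g (y : R) := (q y)%:C%C * (cexp (s * (ln y)%:C%C) - 1).
have mg : cmeas (`]0, +oo[%classic : set RR) (g : RR -> R[i]).
  apply: cmeasM; first exact: cmeas_real.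
  by apply: cmeasD => //; exact: cmeas_cst.
have gle y : `]0, +oo[%classic y -> cabs (g y) <= q y * (2 * (e / 5)).
  by move=> Dy; rewrite cabsM cabsR ger0_norm ?q0//; exact: near1.
have ig := @cintegrable_le _ RR _ mu _ _ _ mD mg iqe gle.
have iqc : cintegrable mu (`]0, +oo[%classic : set RR) (fun y : RR => (q y)%:C%C).
  apply: (@cintegrable_le _ RR _ mu _ _ q mD _ iq); first exact: cmeas_real.
  by move=> y Dy; rewrite cabsR ger0_norm ?q0.
have lE : lap mu `]0, +oo[ q (@ln R) s = cint mu `]0, +oo[ g + 1.
  transitivity (cint mu (`]0, +oo[%classic : set RR) g + cint mu (`]0, +oo[%classic : set RR) (fun y : RR => (q y)%:C%C)).
    rewrite -(@cintD _ RR)//; apply: eq_cint => y _; rewrite /g; ring.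
  congr (_ + _); apply: complex_eq; first by rewrite /= q1.
  by rewrite /= /Rintegral integral0.
rewrite lE addrK.
have := @cabs_cint_le _ RR _ mu _ _ _ mD mg iqe gle.
rewrite (@RintegralZr _ RR)// q1 mul1r => /le_lt_trans; apply; lra.
Qed.

Lemma Re_mk (a b : R) : complex.Re (a +i* b)%C = a. Proof. by []. Qed.
Lemma Im_mk (a b : R) : complex.Im (a +i* b)%C = b. Proof. by []. Qed.
Lemma Re_cint (D : set R) (f : R -> R[i]) :
  complex.Re (cint mu (D : set RR) f) = \int[mu]_(x in D) complex.Re (f x).
Proof. by []. Qed.
Lemma Im_cint (D : set R) (f : R -> R[i]) :
  complex.Im (cint mu (D : set RR) f) = \int[mu]_(x in D) complex.Im (f x).
Proof. by []. Qed.

Lemma kernel_lap_integrable (s : R[i]) (eps : R) : 0 < complex.Re s -> 0 < eps ->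
  cintegrable mu (`]0, +oo[%classic : set RR)
    (fun y : RR => (kernel eps y)%:C%C * cexp (s * (ln y)%:C%C)).
Proof.
move=> s0 e0; have [iq _] := kernel_int e0.
have mD : measurable (`]0, +oo[%classic : set RR) by exact: measurable_itv.
apply: (@cintegrable_le _ RR _ mu _ _ (kernel eps) mD) => //.
  apply: cmeasM; first by apply: cmeas_real; exact: kernel_measurable.
  apply: cmeas_cexp => //; apply: cmeasM; first exact: cmeas_cst.
  by apply: cmeas_real; apply: measurable_funTS; exact: measurable_ln.
move=> y; rewrite /= in_itv/= andbT => y0; rewrite cabs_lap_integrand.
have [/andP[_ y1]|yn] := boolP (expR (- eps) <= y <= 1); last first.
  by rewrite kernel_out// normr0 mul0r.
rewrite ger0_norm ?kernel_ge0// ler_piMr ?kernel_ge0//.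
by rewrite -expR0 ler_expR mulr_ge0_le0 ?ln_le0// ltW.
Qed.

(** * Zeros to the right of the critical line *)

Section Net.
Variables (phi : nat -> R -> R) (n : R -> nat).

Definition source (eps x : R) : R :=
  \sum_(1 <= k < (n eps).+1) (moebius k)%:~R * phi k eps * vphi k%:R^-1 x.

Definition amplitude (eps : R) : R :=
  \sum_(1 <= k < (n eps).+1) (moebius k)%:~R * phi k eps * k%:R^-1.

Lemma netE eps x : moebius_net psi phi n eps x =
  \int[mu]_(y in `]0, +oo[) ((source eps \_ `]0, 1[) (x / y) * kernel eps y).
Proof. exact: mollifyE. Qed.

Lemma measurable_source eps : measurable_fun setT (source eps \_ I01 : RR -> R).
Proof.
apply/(measurable_restrictT _ (measurable_itv _)).
apply: measurable_sum => k; apply: measurable_funM => //.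
have [->|k0] := posnP k.
  apply: (@eq_measurable_fun _ _ _ _ (I01 : set RR) (fun=> 0 : R)); last exact: measurable_cst.
  by move=> x _; rewrite /vphi invr0 mul0r /frac_part floor0 subrr.
by apply: measurable_frac_div; rewrite ?invr_gt0 ?ltr0n// invf_le1 ?ler1n// ltr0n.
Qed.

Lemma source_bound eps : exists K, forall x, `|(source eps \_ I01) x| <= K.
Proof.
exists (\sum_(1 <= k < (n eps).+1) `|(moebius k)%:~R * phi k eps|) => x.
rewrite patchE; case: ifP => _; last by rewrite normr0 sumr_ge0.
rewrite (le_trans (ler_norm_sum _ _ _))// ler_sum// => k _.
rewrite normrM ler_piMr// /vphi; have /andP[h0 /ltW h1] := frac_part_itv (k%:R^-1 / x).
by rewrite ger0_norm.
Qed.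

(** The dilate by y <= 1 is carried by (0, y), where each term is covered by
    [frac_mellin] with th = y / k and b = y. At a zero of zeta the only surviving
    term is s th b^(s-1) = s y^s / k. *)
Lemma source_mellin (zeta : R[i] -> R[i]) (s : R[i]) (eps y : R) : is_riemann_zeta zeta ->
  0 < complex.Re s -> s != 1 -> zeta s = 0 -> 0 < y <= 1 ->
  (s - 1) * mellin 1 (fun x => (source eps \_ I01) (x / y)) s =
  (amplitude eps)%:C%C * cexp (s * (ln y)%:C%C).
Proof.
move=> hz s0 s1 zs /andP[y0 y1].
have sn0 : s != 0 by apply: contraTneq s0 => ->; rewrite /= ltxx.
have sn1 : s - 1 != 0 by rewrite subr_eq0.
pose c k : R := (moebius k.+1)%:~R * phi k.+1 eps.
pose f k x : R := frac_part (y / k.+1%:R / x).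
pose h k x := (c k * f k x * expR (- ln x))%:C%C * cexp (s * (ln x)%:C%C).
pose N := n eps; have mDy := measurable_itv `]0, y[.
have yk0 k : 0 < y / k.+1%:R by rewrite divr_gt0.
have yky k : y / k.+1%:R <= y by rewrite ler_pdivrMr// ler_peMr ?ler1n// ltW.
have mf k : measurable_fun (`]0, y[%classic : set RR) (f k).
  by apply: measurable_frac_div; exact: yk0.
have ih (k : nat) (d : R) : cintegrable mu (`]0, y[%classic : set RR)
    (fun x : RR => (d * f k x * expR (- ln x))%:C%C * cexp (s * (ln x)%:C%C)).
  apply: lap_integrable; first exact: mDy.
  - apply: measurable_funM; first exact: measurable_funM.
    apply: measurable_funTS; exact: measurable_expRN_ln.
  - by apply: measurable_funTS; exact: measurable_ln.
  - apply: (@mellin_bounded_integrable _ _ _ `|d|) => //.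
      by apply: measurable_funM; [exact: measurable_cst|exact: mf].
    move=> x _; rewrite normrM ler_piMr//.
    have /andP[h0 /ltW h1] := frac_part_itv (y / k.+1%:R / x).
    by rewrite ger0_norm.
have E1 : mellin 1 (fun x => (source eps \_ I01) (x / y)) s =
    cint mu (`]0, y[%classic : set RR) (fun x => series (fun k => h k x) N).
  have AI : `]0, y[%classic `<=` I01.
    by move=> x /=; rewrite !in_itv/= => /andP[-> xy]; exact: lt_le_trans y1.
  have key x : I01 x -> ((source eps \_ I01) (x / y) * expR (- ln x))%:C%C * cexp (s * (ln x)%:C%C) =
      (if x \in `]0, y[%classic then series (fun k => h k x) N else 0).
    rewrite /= in_itv/= => /andP[x0 x1].
    rewrite patchE !mem_setE !in_itv/= divr_gt0//= ltr_pdivrMr// mul1r x0/=.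
    case: ifPn => xy; last by rewrite mul0r mul0r.
    rewrite /source /series/= big_add1/= mulr_suml rmorph_sum/= mulr_suml.
    apply: eq_bigr => k _; rewrite /h /c /f /vphi; congr (((_ * frac_part _) * _)%:C%C * _).
    by field; rewrite ?gt_eqF// ?ltr0n.
  rewrite /mellin/lap.
  rewrite (@eq_cint _ RR _ mu (I01 : set RR) _ _ key).
  by apply: complex_eq; rewrite ?Re_cint ?Im_cint -[in RHS](setIidr AI) Rintegral_mkcondr;
    apply: eq_Rintegral => x _; rewrite patchE; case: ifP.
have [_ E2] := @cint_series _ RR _ mu _ h N mDy (fun k => ih k (c k)).
rewrite E1 E2 /series/= mulr_sumr /amplitude big_add1/= rmorph_sum/= mulr_suml.
apply: eq_bigr => k _.
have -> : cint mu `]0, y[ (h k) = (c k)%:C%C * mellin y (f k) s.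
  rewrite /mellin/lap -(@cintZ _ RR)//.
    by apply: eq_cint => x _; rewrite /h -mulrA realCM -mulrA.
  by have := ih k 1; congr (cintegrable _ _ _); apply/funext => x; rewrite mul1r.
have := frac_mellin (yk0 k) (yky k) hz s0 s1.
rewrite zs mulr0 subr0 -!mulrA => /(mulfI sn0) E.
rewrite mulrCA E.
have -> : (y / k.+1%:R)%:C%C * cexp ((s - 1) * (ln y)%:C%C) =
    (k.+1%:R^-1)%:C%C * cexp (s * (ln y)%:C%C) :> R[i].
  rewrite -{1}[y]lnK ?posrE// mulrC realCM -cexpR mulrA -cexpD mulrC.
  by congr (_ * cexp _); ring.
by rewrite [LHS]mulrA -realCM /c !mulrA.
Qed.

(** The regularization is a superposition of dilates, so that by Fubini's theorem
    it multiplies the Mellin transform by the moment of the kernel. *)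
Lemma net_mellin (zeta : R[i] -> R[i]) (s : R[i]) (eps : R) : is_riemann_zeta zeta ->
  0 < complex.Re s -> s != 1 -> zeta s = 0 -> 0 < eps ->
  (s - 1) * mellin 1 (moebius_net psi phi n eps) s =
  (amplitude eps)%:C%C * lap mu `]0, +oo[ (kernel eps) (@ln R) s.
Proof.
move=> hz s0 s1 zs e0.
have sn1 : s - 1 != 0 by rewrite subr_eq0.
have [iq _] := kernel_int e0; have [K HK] := source_bound eps.
have mD : measurable (`]0, +oo[%classic : set RR) by exact: measurable_itv.
have mI : measurable (I01 : set RR) by exact: measurable_itv.
pose w x := (1 * expR (- ln (x : R)))%:C%C * cexp (s * (ln x)%:C%C).
have mE (g : R -> R) : mellin 1 g s = ((\int[mu]_(x in I01) (g x * complex.Re (w x))) +i*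
    (\int[mu]_(x in I01) (g x * complex.Im (w x))))%C.
  by apply: complex_eq; rewrite ?Re_mk ?Im_mk; apply: eq_Rintegral => x _;
    rewrite /w ?Re_realM ?Im_realM mul1r mulrA.
have iw : cintegrable mu (I01 : set RR) (w : RR -> R[i]).
  apply: lap_integrable; first exact: mI.
  - apply: measurable_funM => //; apply: measurable_funTS.
    exact: measurable_expRN_ln.
  - by apply: measurable_funTS; exact: measurable_ln.
  - by apply: (@mellin_bounded_integrable _ _ _ 1) => // x _; rewrite normr1.
pose k (z : R * R) := (source eps \_ I01) (z.1 * expR (- ln z.2)).
have mk : measurable_fun setT (k : RR * RR -> R).
  apply: (measurableT_comp (measurable_source eps)); apply: measurable_funM => //.
  exact: (measurableT_comp (@measurable_expRN_ln R) measurable_snd).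
have kE x y : `]0, +oo[%classic y -> k (x, y) = (source eps \_ I01) (x / y).
  by rewrite /= in_itv/= andbT => y0; rewrite /k/= expRN lnK.
have FE : mellin 1 (moebius_net psi phi n eps) s = cint mu (`]0, +oo[%classic : set RR)
    (fun y : RR => (kernel eps y)%:C%C * mellin 1 (fun x => (source eps \_ I01) (x / y)) s).
  rewrite mE; under [in RHS]eq_cint do rewrite mE.
  apply: complex_eq; rewrite ?Re_cint ?Im_cint.
    have := Fubini_bounded mI mD iw.1 iq mk (fun z => HK _).
    under eq_Rintegral do under eq_Rintegral => y /set_mem Dy do rewrite kE//.
    move=> H; rewrite Re_mk.
    under eq_Rintegral do rewrite netE mulrC.
    rewrite H.
    apply: eq_Rintegral => y /set_mem Dy; rewrite Re_realM Re_mk; congr (_ * _).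
    by apply: eq_Rintegral => x _; rewrite kE.
  have := Fubini_bounded mI mD iw.2 iq mk (fun z => HK _).
  under eq_Rintegral do under eq_Rintegral => y /set_mem Dy do rewrite kE//.
  move=> H; rewrite Im_mk.
  under eq_Rintegral do rewrite netE mulrC.
  rewrite H.
  apply: eq_Rintegral => y /set_mem Dy; rewrite Im_realM Im_mk; congr (_ * _).
  by apply: eq_Rintegral => x _; rewrite kE.
rewrite FE.
transitivity ((s - 1) * cint mu (`]0, +oo[%classic : set RR)
    (fun y : RR => ((s - 1)^-1 * (amplitude eps)%:C%C) *
       ((kernel eps y)%:C%C * cexp (s * (ln y)%:C%C)))).
  congr (_ * _); apply: eq_cint => y; rewrite /= in_itv/= andbT => y0.
  have [/andP[ye y1]|yn] := boolP (expR (- eps) <= y <= 1); last first.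
    by rewrite kernel_out// !mul0r mulr0.
  have := @source_mellin _ s eps y hz s0 s1 zs; rewrite y0 y1 => /(_ isT) E.
  rewrite [RHS]mulrCA -[X in _ = _ * X]mulrA -E.
  by rewrite mulKf.
rewrite (@cintZ _ RR)//; last exact: kernel_lap_integrable.
by rewrite mulrA mulrA divff// mul1r.
Qed.

(** Measurability comes from the smoothness contained in moderateness. *)
Lemma net_square_integrable : moderate (moebius_net psi phi n) ->
  (exists M : R, forall eps : R, 0 < eps <= 1 ->
           (L2norm01 (moebius_net psi phi n eps) <= M%:E)%E) ->
  exists M, forall eps, 0 < eps <= 1 -> square_integrable (moebius_net psi phi n eps) M.
Proof.
move=> [sm _] [M HM]; exists (M ^+ 2) => eps e01.
set F := moebius_net _ _ _ _.
have cF x : I01 x -> {for x, continuous F}.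
  by move=> xI; apply/differentiable_continuous/derivable1_diffP; exact: (sm eps e01 0%N x xI).
have mF : measurable_fun (I01 : set RR) F.
  apply: open_continuous_measurable_fun; first exact: interval_open.
  by move=> x /set_mem; exact: cF.
have := HM _ e01; rewrite /L2norm01 -/F => NM.
have M0 : 0 <= M by rewrite -lee_fin (le_trans _ NM)// Lnorm_ge0.
pose J := (\int[mu]_(x in I01) (F x ^+ 2)%:E)%E.
have J0 : (0 <= J)%E by apply: integral_ge0 => x _; rewrite lee_fin sqr_ge0.
have NE : (Lnorm mu 2%:E (fun x => ((F \_ I01) x)%:E) = J `^ 2^-1)%E.
  rewrite unlock /=; congr (poweR _ _).
  rewrite /J [RHS]integral_mkcond; apply: eq_integral => x _.
  rewrite !patchE; case: ifP => _ /=; last by rewrite normr0 powR0// pnatr_eq0.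
  by rewrite powR_mulrn// real_normK// num_real.
rewrite NE in NM.
have JM : (J <= (M ^+ 2)%:E)%E.
  move: NM J0; clear NE; case: J => [r| |]//=; last by rewrite invr_eq0 pnatr_eq0.
  rewrite !lee_fin => rM r0.
  have : (r `^ 2^-1) ^+ 2 <= M ^+ 2 by rewrite ler_pXn2r// ?nnegrE ?powR_ge0.
  by rewrite -powR_mulrn ?powR_ge0// -powRrM mulVf ?pnatr_eq0// powRr1.
split => //.
- apply/integrableP; split; first by apply/measurable_EFinP; exact: measurable_funX.
  apply: le_lt_trans (ltry (M ^+ 2)); apply: le_trans JM.
  rewrite /J le_eqVlt; apply/orP; left; apply/eqP; apply: eq_integral => x _ /=.
  by rewrite ger0_norm// sqr_ge0.
- rewrite /Rintegral -lee_fin fineK//; apply/fin_numPlt.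
  by rewrite (lt_le_trans (ltNyr 0) J0) (le_lt_trans JM (ltry _)).
Qed.

Hypothesis hmod : moderate (moebius_net psi phi n).
Hypothesis hassoc : associated (moebius_net psi phi n) (fun eps x => - iota_net psi chi eps x).
Hypothesis hL2 : exists M : R, forall eps : R, 0 < eps <= 1 ->
           (L2norm01 (moebius_net psi phi n eps) <= M%:E)%E.

Let F_ (j : nat) := moebius_net psi phi n j.+1%:R^-1.

Let epsj (j : nat) : 0 < (j.+1%:R^-1 : R) <= 1.
Proof. by rewrite invr_gt0 ltr0n invf_le1// ler1n. Qed.

(** On the support of the test function, the regularization of chi is 1 as soon as
    eps < d. *)
Lemma net_test t d : 0 < d -> 4 * d < t -> t <= 1 ->
  exists phi : R -> R, plateau t d phi /\
  (fun j => \int[mu]_(x in I01) (F_ j x * phi x)) @ \oo --> - \int[mu]_(x in I01) phi x.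
Proof.
move=> d0 dt t1; exists (ramp_bump t d); split; first exact: ramp_bump_plateau.
have [mb b01 _ _] := ramp_bump_plateau d0 dt.
have [M sqF] := net_square_integrable hmod hL2.
have H := hassoc (ramp_bump_test d0 dt t1).
have L : (fun j : nat => \int[mu]_(x in I01) ((F_ j x - - iota_net psi chi j.+1%:R^-1 x) * ramp_bump t d x))
    @ \oo --> (0 : R).
  apply: ((cvg_at_rightP _ _ _).1 H (fun j => j.+1%:R^-1)); split; last exact: cvg_harmonic.
  by move=> j; rewrite invr_gt0 ltr0n.
have L' : (fun j : nat => \int[mu]_(x in I01) ((F_ j x - - iota_net psi chi j.+1%:R^-1 x) * ramp_bump t d x)
    - \int[mu]_(x in I01) ramp_bump t d x) @ \oo --> 0 - \int[mu]_(x in I01) ramp_bump t d x.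
  by apply: cvgB; [exact: L|exact: cvg_cst].
rewrite sub0r in L'; apply: cvg_trans L'; apply: near_eq_cvg.
exists (Num.truncn d^-1).+1 => // j /= nj.
have ejd : j.+1%:R^-1 < d.
  rewrite -[ltRHS]invrK ltf_pV2 ?posrE ?ltr0n ?invr_gt0//.
  by rewrite (lt_le_trans (truncnS_gt _))// ler_nat (leq_trans nj).
have [e0 _] := andP (epsj j).
have ib : mu.-integrable I01 (EFin \o ramp_bump t d).
  apply: (@bounded_integrable _ _ _ 1); [exact: measurable_itv|exact: mu01| |].
    exact: measurable_funTS.
  by move=> x _; have /andP[k0 k1] := b01 x; rewrite ger0_norm.
have ib2 : mu.-integrable I01 (EFin \o (fun x => ramp_bump t d x ^+ 2)).
  apply: (@bounded_integrable _ _ _ 1); [exact: measurable_itv|exact: mu01| |].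
    by apply: measurable_funX; exact: measurable_funTS.
  by move=> x _; have /andP[k0 k1] := b01 x; rewrite ger0_norm ?sqr_ge0// exprn_ile1.
have [iFb _] := @sqint_mul _ I01 (F_ j) M (ramp_bump t d) 1 (sqF _ (epsj j)) (measurable_itv _)
  (fun x h => h) ltr01 (measurable_funTS mb) ib2.
rewrite (_ : \int[mu]_(x in I01) ((F_ j x - - iota_net psi chi j.+1%:R^-1 x) * ramp_bump t d x) =
  \int[mu]_(x in I01) (F_ j x * ramp_bump t d x) + \int[mu]_(x in I01) ramp_bump t d x); first by rewrite addrK.
rewrite -(@RintegralD _ RR)//.
apply: eq_Rintegral => x /set_mem; rewrite memI => /andP[x0 x1].
have [/andP[_ xt]|xn] := boolP (d <= x <= t - d); last first.
  by rewrite ramp_bump_supp// !mulr0 addr0.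
rewrite opprK /iota_net (mollify_chi e0 x0) ?mulrDl ?mul1r//.
have h := expR_ge1Dx (- j.+1%:R^-1 : R).
by apply: lt_le_trans h; move: ejd; move: (j.+1%:R^-1) => z *; lra.
Qed.

(** The numbers (s - 1) times the Mellin transform of the net are real multiples of
    moments tending to 1, and tend to (1 - s) / s. Proportionality over the reals
    is expressed by the vanishing of Im u Re v - Re u Im v, which passes to the
    limit although the amplitudes are not known to converge. Hence s is real, and
    [zeta_real_neq0] concludes. *)
Theorem net_zeta_neq0 (zeta : R[i] -> R[i]) (s : R[i]) : is_riemann_zeta zeta ->
  2^-1 < complex.Re s -> s != 1 -> zeta s = 0 -> False.
Proof.
move=> hz s2 s1 zs.
have s0 : 0 < complex.Re s by rewrite (lt_trans _ s2)// invr_gt0.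
have sn0 : s != 0 by apply: contraTneq s0 => ->; rewrite /= ltxx.
have [M sqF] := net_square_integrable hmod hL2.
have T := mellin_weak (fun j => sqF _ (epsj j)) net_test s2.
have m1 := kernel_moment s.
have w1 := ccvgM (ccvg_cst (s - 1)) T.
have E j := net_mellin hz s0 s1 zs (andP (epsj j)).1.
move/ccvg_ReIm : w1 => [w1 w2]; move/ccvg_ReIm : m1 => [m1 m2].
have cross j : complex.Im ((s - 1) * mellin 1 (F_ j) s) *
    complex.Re (lap mu `]0, +oo[ (kernel (j.+1%:R^-1)) (@ln R) s) -
    complex.Re ((s - 1) * mellin 1 (F_ j) s) *
    complex.Im (lap mu `]0, +oo[ (kernel (j.+1%:R^-1)) (@ln R) s) = 0.
  by rewrite E Re_realM Im_realM; ring.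
have I0 : complex.Im ((s - 1) * (- s^-1)) = 0.
  have U : complex.Im ((s - 1) * (- s^-1)) * complex.Re (1 : R[i]) -
     complex.Re ((s - 1) * (- s^-1)) * complex.Im (1 : R[i]) = 0.
    have lim : (fun=> 0 : R) @ \oo --> complex.Im ((s - 1) * (- s^-1)) * complex.Re (1 : R[i]) -
        complex.Re ((s - 1) * (- s^-1)) * complex.Im (1 : R[i]).
      rewrite -(funext cross : _ = (fun=> 0)).
      by apply: cvgB; [exact: (cvgM w2 m1)|exact: (cvgM w1 m2)].
    exact: cst_lim lim.
  by rewrite /= in U *; rewrite mulr1 mulr0 subr0 in U.
have I1 : complex.Im s^-1 = 0.
  have : (s - 1) * (- s^-1) = s^-1 - 1 by rewrite mulrN mulrBl mulfV// mul1r opprB.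
  by move=> e; rewrite e ImD ImN subr0 in I0.
have sE : s = ((complex.Re s^-1)^-1)%:C%C.
  rewrite fmorphV/= -[s in LHS]invrK; congr (_^-1).
  by apply: complex_eq; rewrite ?I1.
have := zeta_real_neq0 hz (x := complex.Re s) s0.
have sR : s = (complex.Re s)%:C%C by rewrite sE.
rewrite -sR zs eqxx => h; have : complex.Re s != 1.
  by apply: contraNneq s1 => e; rewrite sR e.
by move=> /h.
Qed.

End Net.
End Mollifier.

(** * The Gamma function *)

Section ExpDecay.
Context {R : realType}.
Local Notation mu := (@lebesgue_measure R).
Local Notation RR := (measurableTypeR R).

Lemma near_ubound (x : R) : \forall n \near \oo, - n.+1%:R <= x <= n.+1%:R.
Proof.
exists (Num.truncn `|x|).+1 => // n /= nn.
rewrite -ler_norml (le_trans (ltW (truncnS_gt _)))// ler_nat.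
exact: leq_trans nn _.
Qed.

Lemma cvg_expN (c : R) : 0 < c -> (fun n : nat => expR (- c * n.+1%:R)) @ \oo --> (0 : R).
Proof.
move=> c0; have h : `|expR (- c)| < 1 by rewrite ger0_norm ?expR_ge0// expR_lt1 oppr_lt0.
have := cvg_expr h; rewrite -cvg_shiftS; apply: cvg_trans; apply: near_eq_cvg.
by near=> n; rewrite /= -expRM_natr.
Unshelve. all: by end_near. Qed.

(** The derivative of the logistic function 1 / (1 + exp (- c u)) is an integrable
    majorant, up to the factor 4 / c. *)
Lemma integrable_exp_abs (c : R) : 0 < c ->
  mu.-integrable setT (EFin \o (fun u : R => expR (- c * `|u|))).
Proof.
move=> c0.
pose F (u : R) : R := (1 + expR (- c * u))^-1.
pose f (u : R) : R := c * expR (- c * u) * F u ^+ 2.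
have e0 u : 0 < 1 + expR (- c * u) by rewrite addr_gt0 ?expR_gt0.
have dF (u : R) : setT u -> is_derive u 1 F (f u).
  move=> _; have en : 1 + expR (- c * u) != 0 by rewrite gt_eqF.
  have E : is_derive u 1 (fun u => 1 + expR (- c * u)) (- c * expR (- c * u)).
    by apply: is_derive_eq; rewrite /GRing.scale/=; ring.
  have := @is_deriveV _ (fun u : R => 1 + expR (- c * u)) _ _ _ en E; congr is_derive.
  by rewrite /f /F /GRing.scale/= exprVn; ring.
have cF u : {for u, continuous F}.
  by have [+ _] := dF u I => /derivable1_diffP/differentiable_continuous.
have cf (u : R) : setT u -> {for u, continuous f}.
  move=> _; apply: cvgM; last by rewrite /f expr2; apply: cvgM; exact: cF.
  apply: cvgM; first exact: cvg_cst.
  apply: (@continuous_comp _ _ _ (fun u => - c * u) expR u); last exact: continuous_expR.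
  by apply: cvgM; [exact: cvg_cst|exact: cvg_id].
have Fa : F (- n.+1%:R) @[n --> \oo] --> (0 : R).
  apply: (@squeeze_cvgr _ _ _ _ (fun=> 0) (fun n => expR (- c * n.+1%:R))); [|exact: cvg_cst|exact: cvg_expN].
  apply: nearW => n; rewrite /F invr_ge0 (ltW (e0 _))/= mulrNN mulNr expRN lef_pV2 ?posrE ?expR_gt0//.
  by rewrite lerDr.
have FN u : F u = 1 - F (- u).
  by rewrite /F mulrNN mulNr expRN; field; rewrite !gt_eqF ?addr_gt0 ?expR_gt0.
have Fb : F n.+1%:R @[n --> \oo] --> (1 : R).
  have H : (fun n : nat => 1 - F (- n.+1%:R)) @ \oo --> (1 - 0 : R).
    by apply: cvgB; [exact: cvg_cst|exact: Fa].
  by rewrite subr0 in H; under eq_fun do rewrite FN.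
have f0 u : 0 <= f u by rewrite /f mulr_ge0 ?sqr_ge0// mulr_ge0 ?expR_ge0// ltW.
have mf : measurable_fun (setT : set RR) f.
  by apply: continuous_measurable_fun => u; exact: cf.
have i_f : mu.-integrable setT (EFin \o f).
  apply: (@improper_FTC_integrable _ setT f F (fun n => - n.+1%:R) (fun n => n.+1%:R) 0 1) => //.
  - by move=> n; rewrite -subr_gt0 opprK addr_gt0.
  - by move=> x _; exact: near_ubound.
  - by move=> n m nm; rewrite lerN2 ler_nat.
  - by move=> n m nm; rewrite ler_nat.
have mT : measurable (setT : set RR) by exact: measurableT.
apply: (le_integrable_R mT _ _ (integrableZ_R (4 / c) mT i_f)).
  apply: measurableT_comp => //; apply: measurable_funM => //; exact: measurableT_comp.
move=> u _; rewrite (ger0_norm (expR_ge0 _)) /f /F.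
have -> : 4 / c * (c * expR (- c * u) * (1 + expR (- c * u))^-1 ^+ 2) =
    4 * expR (- c * u) / (1 + expR (- c * u)) ^+ 2.
  by field; rewrite !gt_eqF.
rewrite ler_pdivlMr ?exprn_gt0//.
have [u0|u0] := leP 0 u.
  rewrite ger0_norm// mulrC ler_wpM2r ?expR_ge0//.
  have x1 : expR (- c * u) <= 1 by rewrite expR_le1 mulNr oppr_le0 mulr_ge0// ltW.
  have := expR_ge0 (- c * u); move: (expR _) x1 => x x1 x0.
  have : 0 <= (1 - x) * (3 + x) by rewrite mulr_ge0 ?subr_ge0// addr_ge0.
  by rewrite -subr_ge0; congr (0 <= _); ring.
rewrite ltr0_norm// mulrN mulNr opprK expRN -[c * u]opprK expRN -mulNr.
have x1 : 1 <= expR (- c * u) by rewrite -expR0 ler_expR mulNr -mulrN mulr_ge0 ?oppr_ge0// ltW.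
have x0 := expR_gt0 (- c * u); move: (expR _) x1 x0 => x x1 x0.
rewrite ler_pdivrMl//.
have : 0 <= (x - 1) * (3 * x + 1).
  by rewrite mulr_ge0 ?subr_ge0// addr_ge0// mulr_ge0// ltW.
by move=> H; rewrite !invrK -subr_ge0; move: H; congr (0 <= _); ring.
Qed.

Lemma exp_decay_integrable (h : R -> R) (c K : R) : 0 < c -> measurable_fun (setT : set RR) h ->
  (forall u, `|h u| <= K * expR (- c * `|u|)) -> mu.-integrable setT (EFin \o h).
Proof.
move=> c0 mh hK; have mT : measurable (setT : set RR) by exact: measurableT.
apply: (le_integrable_R mT mh _ (integrableZ_R K mT (integrable_exp_abs c0))).
by move=> u _; exact: hK.
Qed.

(** The bound with k = 0 serves for u < 0, where the exponential weight provides the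
    decay, and one with k > 2 c for u >= 0. *)
Lemma fast_decay (h : R -> R) (B : nat -> R) (c : R) : 0 < c ->
  (forall u, 0 <= h u) ->
  (forall k u, h u <= B k * expR (- (k%:R * (2 * u)))) ->
  exists K, forall u, `|h u * expR (c * u)| <= K * expR (- (c / 2) * `|u|).
Proof.
move=> c0 h0 hB; pose k := (Num.truncn (2 * c)).+1.
have B0 j : 0 <= B j by have := le_trans (h0 0) (hB j 0); rewrite !mulr0 oppr0 expR0 mulr1.
exists (B 0%N + B k) => u; rewrite ger0_norm ?mulr_ge0 ?expR_ge0//.
have [u0|u0] := leP 0 u.
  rewrite ger0_norm// (@le_trans _ _ (B k * expR (- (k%:R * (2 * u))) * expR (c * u)))//.
    by rewrite ler_wpM2r ?expR_ge0.
  rewrite -mulrA -expRD; apply: ler_pM; rewrite ?expR_ge0//; first by rewrite lerDr.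
  rewrite ler_expR mulrA -mulNr -mulrDl ler_wpM2r//.
  have : 2 * c < k%:R by exact: truncnS_gt.
  by move: (k%:R) => z; lra.
rewrite ltr0_norm// (@le_trans _ _ (B 0%N * expR (c * u)))//.
  by rewrite ler_wpM2r ?expR_ge0// (le_trans (hB 0%N u))// mul0r oppr0 expR0 mulr1.
apply: ler_pM; rewrite ?expR_ge0//; first by rewrite lerDl.
rewrite ler_expR mulrNN ler_wnM2r ?(ltW u0)//; lra.
Qed.

Definition gker (u : R) : R := expR (- (pi * expR (2 * u))).
Definition dbl (u : R) : R := 2 * u.
(** With x = pi exp (2 u), this is pi^-w Gamma (w) / 2. *)
Definition Gam (w : R[i]) : R[i] := lap mu setT gker dbl w.

Lemma gker_bound k u : gker u <= k`!%:R / pi ^+ k * expR (- (k%:R * (2 * u))).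
Proof.
have p0 := @pi_gt0 R.
have x0 : 0 < pi * expR (2 * u) :> R by rewrite mulr_gt0// expR_gt0.
have -> : k`!%:R / pi ^+ k * expR (- (k%:R * (2 * u))) = ((pi * expR (2 * u)) ^+ k / k`!%:R)^-1 :> R.
  by rewrite exprMn -expRM_natl expRN; field; rewrite ?gt_eqF ?expR_gt0 ?exprn_gt0 ?ltr0n ?fact_gt0.
rewrite /gker expRN lef_pV2 ?posrE ?expR_gt0 ?divr_gt0 ?exprn_gt0 ?ltr0n ?fact_gt0//.
by apply: exp_coeff_le_expR; exact: ltW.
Qed.

Lemma measurable_gker : measurable_fun (setT : set RR) gker.
Proof.
apply: measurableT_comp => //; apply: measurableT_comp => //.
by apply: measurable_funM => //; apply: measurableT_comp => //; exact: measurable_funM.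
Qed.

Lemma measurable_dbl : measurable_fun (setT : set RR) dbl.
Proof. exact: measurable_funM. Qed.

Lemma gker_decay c : 0 < c -> exists K, forall u, `|gker u * expR (c * dbl u)| <= K * expR (- c * `|u|).
Proof.
move=> c0; have c20 : 0 < 2 * c by rewrite mulr_gt0.
have [K HK] := fast_decay c20 (fun u => expR_ge0 _) gker_bound.
exists K => u; have := HK u; rewrite (_ : 2 * c / 2 = c); last by field.
move=> H.
by rewrite /dbl mulrA (mulrC c).
Qed.

Lemma gker_integrable c : 0 < c ->
  mu.-integrable setT (EFin \o (fun u => gker u * expR (c * dbl u))).
Proof.
move=> c0; have [K HK] := gker_decay c0; apply: (exp_decay_integrable c0 _ HK).
apply: measurable_funM; first exact: measurable_gker.
by apply: measurableT_comp => //; apply: measurable_funM => //; exact: measurable_dbl.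
Qed.

Lemma Gam_integrable (w : R[i]) : 0 < complex.Re w ->
  cintegrable mu (setT : set RR) (fun u : RR => (gker u)%:C%C * cexp (w * (dbl u)%:C%C)).
Proof.
move=> w0; apply: lap_integrable; [exact: measurableT|exact: measurable_gker|exact: measurable_dbl|].
exact: gker_integrable.
Qed.

Lemma is_cderiveD (F G : R -> R[i]) (x : R) d e : is_cderive F x d -> is_cderive G x e ->
  is_cderive (fun x => F x + G x) x (d + e).
Proof.
move=> [d1 d2] [e1 e2]; split.
  rewrite ReD (_ : (fun x => _) = (fun x => complex.Re (F x)) + (fun x => complex.Re (G x))).
    exact: is_deriveD.
  by apply/funext => y; rewrite ReD.
rewrite ImD (_ : (fun x => _) = (fun x => complex.Im (F x)) + (fun x => complex.Im (G x))).
  exact: is_deriveD.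
by apply/funext => y; rewrite ImD.
Qed.

Lemma is_derive_dbl (u : R) : is_derive u 1 dbl 2.
Proof. by apply: is_derive_eq; rewrite /GRing.scale/= ?mulr1 ?mulr0 ?add0r ?addr0. Qed.

Lemma is_derive_gker (u : R) : is_derive u 1 gker (- (2 * pi * expR (2 * u)) * gker u).
Proof.
rewrite /gker; apply: is_derive_eq.
by rewrite /GRing.scale/=; ring.
Qed.

Lemma gker_cderive (w : R[i]) (u : R) :
  is_cderive (fun u => (gker u)%:C%C * cexp (w * (dbl u)%:C%C)) u
   ((- 2 * pi)%:C%C * ((gker u)%:C%C * cexp ((w + 1) * (dbl u)%:C%C)) +
    (2 * w) * ((gker u)%:C%C * cexp (w * (dbl u)%:C%C))).
Proof.
have := is_cderiveMr (is_derive_gker u) (is_cderive_cexp w (is_derive_dbl u)).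
congr is_cderive.
have -> : cexp ((w + 1) * (dbl u)%:C%C) = cexp (w * (dbl u)%:C%C) * (expR (2 * u))%:C%C.
  by rewrite mulrDl mul1r cexpD cexpR.
have n2 : (2 : R)%:C%C = 2 :> R[i] by rewrite rmorph_nat.
have e1 : (- (2 * pi * expR (2 * u)) * gker u)%:C%C =
    - (2 * (pi : R)%:C%C * (expR (2 * u))%:C%C) * (gker u)%:C%C :> R[i].
  by rewrite realCM [X in X * _]rmorphN/= !realCM n2.
have e2 : (- 2 * pi : R)%:C%C = - 2 * (pi : R)%:C%C :> R[i] by rewrite realCM [X in X * _]rmorphN/= n2.
by rewrite e1 e2 n2; ring.
Qed.

(** Integration by parts: the derivative of the integrand has integral 0. *)
Lemma GamS (w : R[i]) : 0 < complex.Re w -> (pi : R)%:C%C * Gam (w + 1) = w * Gam w.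
Proof.
move=> w0; have w10 : 0 < complex.Re (w + 1) by rewrite ReD addr_gt0//= ltr01.
have mT : measurable (setT : set RR) by exact: measurableT.
have i1 := Gam_integrable w10; have i0 := Gam_integrable w0.
pose F (u : R) := (gker u)%:C%C * cexp (w * (dbl u)%:C%C).
have [K HK] := gker_decay w0.
have lim (u : nat -> R) : (forall n, `|u n| = n.+1%:R) -> ccvg (fun n => F (u n)) 0.
  move=> un; apply: (@ccvg0_squeeze _ _ (fun n => K * expR (- complex.Re w * n.+1%:R))).
    move=> n; rewrite cabs_lap_integrand (le_trans _ (le_trans (HK (u n)) _))//.
      by rewrite normrM [X in _ <= _ * X]ger0_norm// expR_ge0.
    by rewrite un.
  rewrite (_ : 0 = K * 0); last by rewrite mulr0.
  by apply: cvgM; [exact: cvg_cst|exact: cvg_expN].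
have La := lim (fun n => - n.+1%:R) (fun n => etrans (normrN _) (normr_nat _ _)).
have Lb := lim (fun n => n.+1%:R) (fun n => normr_nat _ _).
pose f (u : R) := (- 2 * pi)%:C%C * ((gker u)%:C%C * cexp ((w + 1) * (dbl u)%:C%C)) +
    (2 * w) * ((gker u)%:C%C * cexp (w * (dbl u)%:C%C)).
have i1' := @cintegrableZ _ RR _ mu _ (- 2 * pi)%:C%C _ mT i1.
have i0' := @cintegrableZ _ RR _ mu _ (2 * w) _ mT i0.
have fE : cint mu (setT : set RR) f = 0 - 0.
  apply: (@cint_improper_FTC _ setT f F (fun n => - n.+1%:R) (fun n => n.+1%:R) 0 0 mT).
  - by move=> n; rewrite -subr_gt0 opprK addr_gt0.
  - by [].
  - by move=> x _; exact: near_ubound.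
  - by move=> x _; exact: gker_cderive.
  - move=> x _; eexists; apply: is_cderiveD; apply: is_cderiveZ; exact: gker_cderive.
  - exact: La.
  - exact: Lb.
  - exact: (@cintegrableD _ RR _ mu _ _ _ mT i1' i0').
move: fE; rewrite /f (@cintD _ RR _ mu _ _ _ mT i1' i0') !(@cintZ _ RR)//.
rewrite subr0 -/(lap mu setT gker dbl (w + 1)) -/(lap mu setT gker dbl w) -/(Gam _) -/(Gam _).
have -> : (- 2 * pi : R)%:C%C = - 2 * (pi : R)%:C%C :> R[i].
  by rewrite realCM [X in X * _]rmorphN/= rmorph_nat.
move=> H; apply/eqP; rewrite -subr_eq0; apply/eqP.
have n2 : (- 2 : R[i]) != 0 by rewrite oppr_eq0 pnatr_eq0.
by apply: (mulfI n2); rewrite mulr0 -H; ring.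
Qed.

Definition RGam (a : R) : R := \int[mu]_u (gker u * expR (a * dbl u)).

Lemma RGamS a : 0 < a -> pi * RGam (a + 1) = a * RGam a.
Proof.
move=> a0; have := @GamS a%:C%C a0 => /(congr1 (@complex.Re R)).
rewrite !Re_realM -[a%:C%C + 1](_ : (a + 1)%:C%C = _); last by rewrite rmorphD rmorph1.
by rewrite /Gam !Re_lap_real.
Qed.

Lemma RGam_rec a : 0 < a -> RGam (a + 1) = a / pi * RGam a.
Proof.
move=> a0; have pn0 : pi != 0 :> R by rewrite gt_eqF// pi_gt0.
by apply: (mulfI pn0); rewrite RGamS// mulrA mulrCA divff// mulr1.
Qed.

Lemma variance_identity (a p c g : R) : 0 < a -> 0 < p ->
  c / (a / p) ^+ 2 * ((a + 1) / p * (a / p * g)) + (c * (- 2 / (a / p)) * (a / p * g) + c * g) = c * g / a.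
Proof. by move=> a0 p0; field; rewrite (gt_eqF a0) (gt_eqF p0). Qed.

Lemma RGam_gt0 a : 0 < a -> 0 < RGam a.
Proof.
move=> a0; have ig := gker_integrable a0.
pose d := expR (- (pi * expR (2 * 1))) : R.
have d0 : 0 < d by exact: expR_gt0.
have i01 := @integrableS _ RR _ mu _ `]0, 1[%classic _ measurableT (measurable_itv _) (@subsetT _ _) ig.
apply: (@lt_le_trans _ _ (\int[mu]_(u in `]0, 1[) (d * 1))).
  rewrite (@RintegralZl _ RR)//; first by rewrite lint_itv// subr0 mulr1.
  by apply: (@bounded_integrable _ _ _ 1) => //; [exact: mu01|move=> x _; rewrite normr1].
apply: (@le_trans _ _ (\int[mu]_(u in `]0, 1[) (gker u * expR (a * dbl u)))).
  apply: (@le_Rintegral _ RR) => //.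
    by apply: (@bounded_integrable _ _ _ `|d * 1|) => //; exact: mu01.
  move=> u /=; rewrite in_itv/= => /andP[u0 u1].
  apply: ler_pM => //; first exact: ltW.
    rewrite /d /gker ler_expR lerN2 ler_wpM2l ?(ltW (pi_gt0 _))// ler_expR.
    by rewrite ler_wpM2l// ltW.
  by rewrite -expR0 ler_expR !mulr_ge0// ltW.
rewrite /RGam /Rintegral fine_le//.
- by apply: (@integrable_fin_num _ RR _ mu _ (measurable_itv _) _ i01).
- by apply: (@integrable_fin_num _ RR _ mu _ measurableT _ ig).
- apply: (@ge0_subset_integral _ RR) => //.
  + by case/integrableP : ig.
  + by move=> u _; rewrite lee_fin mulr_ge0// expR_ge0.
Qed.

Lemma deriv_le (f df : R -> R) (a b : R) : a <= b ->
  (forall x, a <= x <= b -> is_derive x 1 f (df x)) ->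
  (forall x, a <= x <= b -> 0 <= df x) -> f a <= f b.
Proof.
move=> ab dfx df0.
have [||c] := @MVT_segment _ f df a b ab.
- by move=> x; rewrite in_itv/= => /andP[/ltW ax /ltW xb]; apply: dfx; rewrite ax.
- apply: derivable_within_continuous => x; rewrite in_itv/= => axb.
  by have [] := dfx _ axb.
- rewrite in_itv/= => acb E; rewrite -subr_ge0 E mulr_ge0 ?subr_ge0//; exact: df0.
Qed.

Lemma normr_sin_le (x : R) : `|sin x| <= `|x|.
Proof.
wlog x0 : x / 0 <= x.
  move=> H; have [/H//|/ltW xn] := leP 0 x.
  by rewrite -normrN -sinN -[leRHS]normrN; apply: H; rewrite oppr_ge0.
rewrite (ger0_norm x0); apply/ler_normlP; split.
  have := @deriv_le (fun x => x + sin x) (fun x => 1 + cos x) 0 x x0.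
  rewrite sin0 addr0 => H; rewrite lerNl -subr_ge0 opprK addrC; apply: H.
  by move=> y _; have := cos_geN1 y; lra.
have := @deriv_le (fun x => x - sin x) (fun x => 1 - cos x) 0 x x0.
rewrite sin0 subr0 => H; rewrite -subr_ge0; apply: H.
by move=> y _; have := cos_le1 y; lra.
Qed.

Lemma one_sub_cos_le (x : R) : 1 - cos x <= x ^+ 2 / 2.
Proof.
have E : 1 - cos x = 2 * sin (x / 2) ^+ 2.
  have -> : cos x = cos ((x / 2) *+ 2) by congr cos; rewrite -mulr_natr; field.
  rewrite cos_mulr2n sin2cos2 -mulr_natr; ring.
rewrite E; have := normr_sin_le (x / 2); rewrite -ler_sqr ?nnegrE// !real_normK ?num_real// => h.
rewrite (_ : x ^+ 2 / 2 = 2 * (x / 2) ^+ 2); last by field.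
by rewrite ler_wpM2l.
Qed.

Lemma ln_le_sub1 (x : R) : 0 < x -> ln x <= x - 1.
Proof.
move=> x0; have := @le_ln1Dx _ (x - 1); have -> : 1 + (x - 1) = x by ring.
by apply; lra.
Qed.

(** For x >= 1/2 one has |ln x| <= 2 |x - 1|, whence the term 2 t^2; for x < 1/2
    the left side is at most 2 and (x - 1)^2 >= 1/4, whence the term 8. *)
Lemma cos_dist (t x : R) : 0 < x -> 1 - cos (t * ln x) <= (2 * t ^+ 2 + 8) * (x - 1) ^+ 2.
Proof.
move=> x0; have q0 : 0 <= (x - 1) ^+ 2 by exact: sqr_ge0.
have [x2|x2] := leP 2^-1 x; last first.
  have c1 := cos_geN1 (t * ln x).
  have : 0 <= (2^-1 - x) * (3 / 2 - x) by rewrite mulr_ge0//; lra.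
  have : 0 <= 2 * t ^+ 2 * (x - 1) ^+ 2.
    by rewrite mulr_ge0 ?sqr_ge0// mulr_ge0// sqr_ge0.
  move: (cos _) c1 => c c1 h1 h2.
  have -> : (2 * t ^+ 2 + 8) * (x - 1) ^+ 2 = 2 * t ^+ 2 * (x - 1) ^+ 2 + 2 + 8 * ((2^-1 - x) * (3 / 2 - x)).
    by field.
  lra.
have L : ln x ^+ 2 <= 4 * (x - 1) ^+ 2.
  have -> : 4 * (x - 1) ^+ 2 = (2 * (x - 1)) ^+ 2 by ring.
  rewrite -ler_sqrt ?sqr_ge0// !sqrtr_sqr.
  have [x1|x1] := leP 1 x.
    rewrite !ger0_norm ?mulr_ge0 ?subr_ge0 ?ln_ge0//.
    have := ln_le_sub1 x0; lra.
  rewrite ler0_norm ?ln_le0 ?(ltW x1)// ler0_norm; last by lra.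
  have xi : 1 < x^-1 by rewrite invf_gt1.
  have H : - ln x <= x^-1 - 1 by rewrite -lnV ?posrE// ln_le_sub1// invr_gt0.
  apply: (le_trans H); rewrite -subr_ge0.
  have -> : - (2 * (x - 1)) - (x^-1 - 1) = (2 * x - 1) * (x^-1 - 1).
    by field; rewrite gt_eqF.
  by apply: mulr_ge0; lra.
rewrite (le_trans (one_sub_cos_le _))// exprMn.
have := ler_wpM2l (sqr_ge0 t) L.
have : 0 <= 8 * (x - 1) ^+ 2 by rewrite mulr_ge0.
move: (ln x ^+ 2) ((x - 1) ^+ 2) (t ^+ 2) => X Y Z h1 h2.
rewrite ler_pdivrMr//.
have -> : (2 * Z + 8) * Y * 2 = Z * (4 * Y) + 2 * (8 * Y) by ring.
by rewrite (le_trans h2)// lerDl mulr_ge0.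
Qed.

(** By the functional equation, a zero w makes all the w + n zeros. At
    w + n = a + i t with a large, the real part of the integral, after a rotation,
    is that of the density of parameter a against cos (t ln (x / m)), where x has
    the mean m. As 1 - cos is at most C (x / m - 1)^2 by [cos_dist], and the
    variance of x / m is 1 / a, this integral is positive as soon as a > C. *)
Lemma Gam_neq0 (w : R[i]) : 0 < complex.Re w -> Gam w != 0.
Proof.
move=> w0; apply/eqP => Gw.
have Gn n : Gam (w + n%:R) = 0.
  elim: n => [|n IH]; first by rewrite addr0.
  have wn : 0 < complex.Re (w + n%:R) by rewrite ReD Re_nat ltr_pwDl.
  have := GamS wn; rewrite IH mulr0 -addrA -natr1 => /eqP; rewrite mulf_eq0 => /orP[|/eqP//].
  by move=> /eqP h; have := @pi_gt0 R; rewrite (@complexI R pi 0 h) ltxx.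
pose t := complex.Im w.
have [n Hn] : exists n : nat, 2 * t ^+ 2 + 8 < complex.Re w + n%:R.
  exists (Num.truncn (2 * t ^+ 2 + 8)).+1.
  by rewrite (lt_trans (truncnS_gt _))// ltrDr.
pose a := complex.Re w + n%:R; have a0 : 0 < a by rewrite ltr_pwDl.
have p0 := @pi_gt0 R.
pose m : R := a / pi; have m0 : 0 < m by rewrite divr_gt0.
pose p (b u : R) : R := gker u * expR (b * dbl u).
have ip b : 0 < b -> mu.-integrable (setT : set RR) (EFin \o p b) by exact: gker_integrable.
have mT : measurable (setT : set RR) by exact: measurableT.
have pc : mu.-integrable (setT : set RR) (EFin \o (fun u => p a u * cos (t * (dbl u - ln m)))).
  apply: (le_integrable_R mT _ _ (ip a a0)).
    apply: measurable_funM; first by apply/measurable_EFinP; exact: (measurable_int mu (ip a a0)).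
    apply: measurableT_comp; first exact: (continuous_measurable_fun (@continuous_cos R)).
    by apply: measurable_funM => //; apply: measurable_funB => //; exact: measurable_dbl.
  move=> u _; rewrite normrM ger0_norm ?mulr_ge0 ?expR_ge0// ler_piMr ?mulr_ge0 ?expR_ge0//.
  exact: cos_max.
have a1 : 0 < a + 1 by rewrite addr_gt0.
have a2 : 0 < a + 1 + 1 by rewrite addr_gt0.
have zero : \int[mu]_u (p a u * cos (t * (dbl u - ln m))) = 0.
  pose k : R[i] := (0 +i* (- (t * ln m)))%C.
  have iw : 0 < complex.Re (w + n%:R) by rewrite ReD Re_nat.
  have := @cintZ _ RR _ mu _ (cexp k) _ mT (Gam_integrable iw).
  rewrite -/(lap mu setT gker dbl (w + n%:R)) -/(Gam _) Gn mulr0 => /(congr1 (@complex.Re R)).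
  rewrite Re_cint => H; rewrite -[RHS]H; apply: eq_Rintegral => u _.
  rewrite mulrCA -cexpD Re_realM /p -mulrA; congr (_ * _).
  rewrite /cexp/= ; congr (expR _ * cos _).
    by rewrite [RHS]ReD Re_mulR ReD Re_nat add0r.
  by rewrite [RHS]ImD Im_mulR ImD Im_nat addr0 -/t /k /=; ring.
pose C := 2 * t ^+ 2 + 8.
pose q u := C / m ^+ 2 * p (a + 1 + 1) u + (C * (- 2 / m) * p (a + 1) u + C * p a u).
have iq2 := integrableZ_R (C / m ^+ 2) mT (ip _ a2).
have iq1 := integrableZ_R (C * (- 2 / m)) mT (ip _ a1).
have iq0 := integrableZ_R C mT (ip _ a0).
have iq10 := integrableD_R mT iq1 iq0.
have iq := integrableD_R mT iq2 iq10.
have Q : \int[mu]_u q u = C * RGam a / a.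
  rewrite /q (@RintegralD _ RR)// (@RintegralD _ RR)// !(@RintegralZl _ RR)//; try exact: ip.
  rewrite -/(RGam (a + 1 + 1)) -/(RGam (a + 1)) -/(RGam a).
  have e2 : RGam (a + 1 + 1) = (a + 1) / pi * RGam (a + 1).
    exact: RGam_rec.
  have e1 : RGam (a + 1) = a / pi * RGam a.
    exact: RGam_rec.
  by rewrite e2 e1 /m; exact: variance_identity.
have : \int[mu]_u (p a u - p a u * cos (t * (dbl u - ln m))) <= \int[mu]_u q u.
  apply: (@le_Rintegral _ RR) => //.
    have := integrableD_R mT (ip a a0) (integrableZ_R (-1) mT pc).
    by congr (integrable _ _ _); apply/funext => u /=; rewrite mulN1r.
  move=> u _.
  have T0 : 0 < expR (dbl u) / m by rewrite divr_gt0 ?expR_gt0.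
  have := cos_dist t T0; rewrite ln_div ?posrE ?expR_gt0// expRK => H.
  rewrite -[X in X - _]mulr1 -mulrBr.
  apply: (le_trans (ler_wpM2l _ H)); first by rewrite mulr_ge0 ?expR_ge0.
  rewrite le_eqVlt; apply/orP; left; apply/eqP.
  rewrite /q /p !mulrDl !mul1r !expRD -/C.
  by field; rewrite gt_eqF.
rewrite (@RintegralB _ RR) ?zero ?subr0 ?Q//; last exact: ip.
rewrite -/(RGam a) -mulrA (mulrC _ a^-1) mulrA -[leLHS]mul1r ler_pM2r ?RGam_gt0//.
by rewrite ler_pdivlMr// mul1r leNgt Hn.
Qed.

End ExpDecay.

(** * The Fourier transform of the Gaussian *)

Section GaussTransform.
Context {R : realType}.
Local Notation mu := (@lebesgue_measure R).
Local Notation RR := (measurableTypeR R).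

(** With z^2 = - z0^2 + 2 z0 z + (z - z0)^2, the last factor is a power series in
    even powers of z - z0, and the other ones are exponentials of linear
    functions. *)
Lemma canal_cexp_sq (k z0 : R[i]) : canal (fun z => cexp (z ^+ 2 * k)) z0.
Proof.
have H : canal (fun z => cexp ((z - z0) ^+ 2 * k)) z0.
  have [B HB] := cexp_series_bound (8 * k).
  pose a n := if odd n then 0 else k ^+ n./2 / (n./2)`!%:R.
  exists a, 1, B; split; first exact: ltr01.
    move=> n; rewrite expr1n mulr1 /a.
    have B0 : 0 <= B.
      by have := HB 0%N; rewrite expr0 mulr1; apply: le_trans; exact: cabs_ge0.
    case: ifPn => [_|nodd]; first by rewrite cabs0 mulr_ge0// expr8_ge0.
    have nE : n = (n./2 + n./2)%N by rewrite addnn halfK (negbTE nodd) subn0.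
    have := HB n./2; rewrite exprMn -mulrA cabsM cabsX cabs_nat => h.
    rewrite [in leRHS]nE exprD mulrA.
    have e8 : 0 < 8 ^+ n./2 :> R by rewrite exprn_gt0.
    by rewrite [X in _ <= _ * X]exprVn ler_pdivlMr// mulrC.
  move=> h _; have -> : (z0 + h - z0) ^+ 2 * k = k * h ^+ 2 by rewrite [z0 + h]addrC addrK mulrC.
  have E n : series (fun n => a n * h ^+ n) n =
      series (fun n => (k * h ^+ 2) ^+ n / n`!%:R) (uphalf n).
    elim: n => [|n IH]; first by rewrite /series/= !big_geq.
    rewrite /series/= in IH *; rewrite big_nat_recr//= IH /a uphalf_half.
    have [nodd|nodd] := boolP (odd n); first by rewrite /= mul0r addr0.
    rewrite add0n [RHS]big_nat_recr//=; congr (_ + _).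
    by rewrite exprMn -exprM mul2n halfK (negbTE nodd) subn0 mulrAC.
  have := cexp_series (k * h ^+ 2) => /ccvgP S; apply/ccvgP => e e0.
  have [N HN] := S e e0; exists N.*2 => n Nn; rewrite E; apply: HN.
  by rewrite uphalf_half -[N]doubleK (leq_trans (half_leq Nn))// leq_addl.
have -> : (fun z => cexp (z ^+ 2 * k)) =
    (fun z => cexp (- (z0 ^+ 2 * k)) * cexp (z * (2 * z0 * k)) * cexp ((z - z0) ^+ 2 * k)).
  by apply/funext => z; rewrite -!cexpD; congr cexp; ring.
apply: canalM; last exact: H.
by apply: canalM; [exact: canal_cst|exact: canal_cexp].
Qed.

Section Gauss.
Variable tau : R.
Hypothesis tau0 : 0 < tau.

Definition gauss (x : R) : R := expR (- (pi * tau * x ^+ 2)).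

Lemma is_derive_gauss (x : R) : is_derive x 1 gauss (- (2 * pi * tau * x) * gauss x).
Proof.
rewrite /gauss; apply: is_derive_eq.
by rewrite /GRing.scale/= ?expr1; ring.
Qed.

Lemma measurable_gauss : measurable_fun (setT : set RR) gauss.
Proof.
apply: measurableT_comp => //; apply: measurableT_comp => //.
by apply: measurable_funM => //; exact: measurable_funX.
Qed.

(** Completing the square makes the integrand a multiple of the normal density of
    mean c / (2 pi tau) and variance 1 / (2 pi tau). *)
Lemma gauss_square (c : R) : mu.-integrable setT (EFin \o (fun x => gauss x * expR (c * x))) /\
  \int[mu]_x (gauss x * expR (c * x)) = Num.sqrt tau^-1 * expR (c ^+ 2 / (4 * pi * tau)).
Proof.
have p0 := @pi_gt0 R; have pt0 : 0 < pi * tau by rewrite mulr_gt0.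
pose m : R := c / (2 * pi * tau); pose sg : R := Num.sqrt ((2 * pi * tau)^-1).
have sg0 : 0 < sg by rewrite sqrtr_gt0 invr_gt0 -mulrA mulr_gt0.
have sgn0 : sg != 0 by rewrite gt_eqF.
have sg2 : sg ^+ 2 = (2 * pi * tau)^-1.
  by rewrite sqr_sqrtr// invr_ge0 -mulrA mulr_ge0// ltW.
pose K := expR (c ^+ 2 / (4 * pi * tau)) / normal_peak sg.
have pk : normal_peak sg != 0 by rewrite gt_eqF// normal_peak_gt0.
have E x : gauss x * expR (c * x) = K * normal_pdf m sg x.
  rewrite normal_pdfE// /K mulrA divfK// /gauss /normal_fun -!expRD; congr expR.
  rewrite -[sg ^+ 2 *+ 2]mulr_natr sg2 /m; move: (pi : R) p0 => p p0; field.
  by rewrite (gt_eqF tau0) (gt_eqF p0).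
have ip := integrable_normal_pdf m sg.
split.
  have := @integrableZl _ RR _ mu _ measurableT K _ ip; congr (integrable _ _ _).
  by apply/funext => x /=; rewrite E EFinM.
under eq_Rintegral do rewrite E.
rewrite (@RintegralZl _ RR)// /Rintegral integral_normal_pdf mulr1 /K mulrC /normal_peak invrK.
congr (Num.sqrt _ * _); rewrite -mulr_natr sg2; move: (pi : R) p0 => p p0; field.
by rewrite (gt_eqF tau0) (gt_eqF p0).
Qed.

Definition gaussL (s : R[i]) := lap mu setT gauss id s.

(** Both sides are entire in s and agree on the real axis by [gauss_square]; the
    points 1 / (j + 1) suffice. *)
Lemma gaussLE (s : R[i]) : gaussL s = (Num.sqrt tau^-1)%:C%C * cexp (s ^+ 2 * ((4 * pi * tau)^-1)%:C%C).
Proof.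
pose f s := gaussL s - (Num.sqrt tau^-1)%:C%C * cexp (s ^+ 2 * ((4 * pi * tau)^-1)%:C%C).
suff : f (0 + s) = 0 by rewrite add0r => /eqP; rewrite subr_eq0 => /eqP.
have fan z : canal f z.
  apply: canalB.
    apply: (@lap_analytic _ RR _ mu setT gauss id (complex.Re z - 1) (complex.Re z + 1)).
    - exact: measurableT.
    - exact: measurable_gauss.
    - exact: measurable_id.
    - exact: (gauss_square _).1.
    - exact: (gauss_square _).1.
    - by apply/andP; split; lra.
  apply: canalM; first exact: canal_cst.
  exact: canal_cexp_sq.
apply: identity_segment; first by move=> t _; exact: fan.
apply: (@canal_zero _ f 0 (fun j => (j.+1%:R^-1)%:C%C)); first exact: fan.
- by move=> j; rewrite -cabs_gt0 cabsR gtr0_norm invr_gt0 ltr0n.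
- rewrite (_ : (fun _ => _) = (fun j => j.+1%:R^-1)); first exact: cvg_harmonic.
  by apply/funext => j; rewrite cabsR ger0_norm// invr_ge0.
move=> j; rewrite add0r /f; set x : R := _^-1.
have -> : gaussL x%:C%C = (\int[mu]_y (gauss y * expR (x * y)))%:C%C.
  apply: complex_eq; first by rewrite /gaussL Re_lap_real.
  rewrite /gaussL Im_cint /=.
  transitivity (\int[mu]_y (0 : R)); last by rewrite /Rintegral integral0.
  apply: eq_Rintegral => y _.
  rewrite /=; have -> : x * 0 + 0 * y = 0 by ring.
  by rewrite sin0 !mulr0 mul0r addr0.
rewrite (gauss_square x).2 realCM -cexpR realCM rmorphXn/= subrr//.
Qed.

Lemma gauss_cos (y : R) : \int[mu]_x (gauss x * cos (2 * pi * y * x)) =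
  Num.sqrt tau^-1 * expR (- (pi * y ^+ 2 / tau)).
Proof.
have := congr1 (@complex.Re R) (gaussLE (0 +i* (2 * pi * y))%C).
rewrite Re_realM [complex.Re (cexp _)](_ : _ = expR (- (pi * y ^+ 2 / tau))); last first.
  have -> : ((0 +i* (2 * pi * y))%C : R[i]) ^+ 2 * ((4 * pi * tau)^-1)%:C%C = (- (pi * y ^+ 2 / tau))%:C%C.
    apply: complex_eq; rewrite ?Re_mulR ?Im_mulR expr2 ?ReM ?ImM /=.
      have := @pi_gt0 R; move: (pi : R) => p p0; field.
      by rewrite (gt_eqF tau0) (gt_eqF p0).
    by rewrite mul0r mulr0 addr0 mul0r.
  by rewrite cexpR.
move=> <-; apply: eq_Rintegral => x _.
by rewrite Re_realM /cexp/= !mul0r !mulr0 !subr0 expR0 mul1r add0r.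
Qed.

Lemma even_half (f : R -> R) : continuous f -> (forall x, 0 <= f x) -> (forall x, f (- x) = f x) ->
  mu.-integrable setT (EFin \o f) ->
  \int[mu]_(x in `]0, +oo[) f x = 2^-1 * \int[mu]_x f x.
Proof.
move=> cf f0 fe i_f.
have i0 : mu.-integrable `[0, +oo[ (EFin \o f).
  by apply: (@integrableS _ RR _ mu setT `[0, +oo[%classic _ measurableT (measurable_itv _) _ i_f).
have i0' : mu.-integrable `]0, +oo[ (EFin \o f).
  by apply: (@integrableS _ RR _ mu setT `]0, +oo[%classic _ measurableT (measurable_itv _) _ i_f).
rewrite Rintegral_itv_obnd_cbnd//.
have := @ge0_symfun_integralT R f f0 cf (fun x => esym (fe x)).
have -> : [set x : R | 0 <= x] = `[0, +oo[%classic by rewrite set_itvcy.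
rewrite /Rintegral => ->; rewrite fineM//=; first by rewrite mulrA mulVf// mul1r.
exact: (@integrable_fin_num _ RR _ mu _ (measurable_itv _) _ i0).
Qed.

Lemma gauss_cos_half (y : R) :
  mu.-integrable `]0, +oo[ (EFin \o (fun x => gauss x * cos (2 * pi * y * x))) /\
  \int[mu]_(x in `]0, +oo[) (gauss x * cos (2 * pi * y * x)) =
  2^-1 * (Num.sqrt tau^-1 * expR (- (pi * y ^+ 2 / tau))).
Proof.
have mT : measurable (setT : set RR) by exact: measurableT.
have mD : measurable (`]0, +oo[%classic : set RR) by exact: measurable_itv.
have ig : mu.-integrable setT (EFin \o gauss).
  have := (gauss_square 0).1; congr (integrable _ _ _); apply/funext => x /=.
  by rewrite mul0r expR0 mulr1.
pose h x := gauss x * cos (2 * pi * y * x).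
have mh : measurable_fun (setT : set RR) h.
  apply: measurable_funM; first exact: measurable_gauss.
  apply: (measurableT_comp (continuous_measurable_fun (@continuous_cos R))).
  exact: measurable_funM.
have ih : mu.-integrable setT (EFin \o h).
  apply: (le_integrable_R mT mh _ ig) => x _.
  by rewrite normrM ger0_norm ?expR_ge0// ler_piMr ?expR_ge0// cos_max.
have cg : continuous gauss.
  move=> x; apply/differentiable_continuous/derivable1_diffP.
  by have [] := is_derive_gauss x.
have ch : continuous h.
  move=> x; apply: cvgM; first exact: cg.
  apply: (@continuous_comp _ _ _ (fun x => 2 * pi * y * x) cos x); last exact: continuous_cos.
  by apply: cvgM; [exact: cvg_cst|exact: cvg_id].
have ge x : gauss (- x) = gauss x by rewrite /gauss sqrrN.
have he x : h (- x) = h x by rewrite /h ge mulrN cosN.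
have ihD := @integrableS _ RR _ mu setT `]0, +oo[%classic _ mT mD (@subsetT _ _) ih.
have igD := @integrableS _ RR _ mu setT `]0, +oo[%classic _ mT mD (@subsetT _ _) ig.
split => //.
have H1 := even_half cg (fun x => expR_ge0 _) ge ig.
have igh := integrableD_R mT ig ih.
have cgh : continuous (fun x => gauss x + h x) by move=> x; apply: cvgD; [exact: cg|exact: ch].
(* the halving of the integral is available for nonnegative even functions:
   it is applied to gauss and to gauss + h *)
have gh0 x : 0 <= gauss x + h x.
  have -> : gauss x + h x = gauss x * (1 + cos (2 * pi * y * x)) by rewrite /h; ring.
  by rewrite mulr_ge0 ?expR_ge0//; have := cos_geN1 (2 * pi * y * x); lra.
have ghe x : gauss (- x) + h (- x) = gauss x + h x by rewrite ge he.
have := even_half cgh gh0 ghe igh.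
rewrite (@RintegralD _ RR)// (@RintegralD _ RR)// H1 mulrDr => /addrI ->.
by rewrite -gauss_cos.
Qed.

End Gauss.
End GaussTransform.

(** * The Fourier series of the sawtooth *)

Section Sawtooth.
Context {R : realType}.
Local Notation mu := (@lebesgue_measure R).
Local Notation RR := (measurableTypeR R).

Lemma sin_natpi (k : nat) : sin (pi * k%:R : R) = 0.
Proof.
elim: k => [|k IH]; first by rewrite mulr0 sin0.
by rewrite -natr1 mulrDr mulr1 sinDpi IH oppr0.
Qed.

(** Halving the angle: sin y = 2 sin (y/2) cos (y/2), where
    sin (y/2) >= (y/2) cos (y/2) and cos (y/2)^2 >= 1/2. *)
Lemma sin_ge_half (y : R) : 0 <= y <= pi / 2 -> y / 2 <= sin y.
Proof.
move=> /andP[y0 y2].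
have z0 : 0 <= y / 2 by rewrite divr_ge0.
have zc (z : R) : 0 <= z <= pi -> z * cos z <= sin z.
  move=> /andP[z0' zp].
  have := @deriv_le _ (fun z => sin z - z * cos z) (fun z => z * sin z) 0 z z0'.
  rewrite sin0 mul0r subr0 subr_ge0; apply.
    by move=> x _; apply: is_derive_eq; rewrite /GRing.scale/=; ring.
  move=> x /andP[x0 xz]; rewrite mulr_ge0// sin_ge0_pi// x0.
  exact: le_trans zp.
have yE : y = (y / 2) *+ 2 by rewrite -mulr_natr; field.
have cy : 0 <= cos y.
  by rewrite cos_ge0_pihalf// y2 andbT (le_trans _ y0)// oppr_le0 divr_ge0// pi_ge0.
have c2 : cos y = cos (y / 2) ^+ 2 * 2 - 1 by rewrite [in LHS]yE cos_mulr2n -mulr_natr.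
have s2 : sin y = cos (y / 2) * sin (y / 2) * 2 by rewrite [in LHS]yE sin_mulr2n -mulr_natr.
have z2 : y / 2 <= pi / 2 by rewrite ler_pM2r// (le_trans y2)// ler_piMr ?pi_ge0//; lra.
have c0 : 0 <= cos (y / 2).
  by rewrite cos_ge0_pihalf// z2 andbT (le_trans _ z0)// oppr_le0 divr_ge0// pi_ge0.
have zp : y / 2 <= pi by rewrite (le_trans z2)// ler_piMr ?pi_ge0//; lra.
have H : y / 2 * cos (y / 2) <= sin (y / 2) by apply: zc; rewrite z0.
have := ler_wpM2l c0 H; rewrite s2.
have : y / 4 <= y / 2 * cos (y / 2) ^+ 2.
  have h : 2^-1 <= cos (y / 2) ^+ 2 by lra.
  by rewrite (_ : y / 4 = y / 2 * 2^-1); [rewrite ler_wpM2l|field].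
have -> : cos (y / 2) * (y / 2 * cos (y / 2)) = y / 2 * cos (y / 2) ^+ 2 by ring.
lra.
Qed.

(** The partial sums of the Fourier series of 1/2 - x on (0, 1). *)
Definition sawser (N : nat) (x : R) : R :=
  \sum_(0 <= k < N) sin (2 * pi * k.+1%:R * x) / (pi * k.+1%:R).

(** The Dirichlet kernel. *)
Definition dirk (N : nat) (x : R) : R :=
  1 + \sum_(0 <= k < N) 2 * cos (2 * pi * k.+1%:R * x).

Lemma dirk_sin N x : dirk N x * sin (pi * x) = sin ((2 * N%:R + 1) * pi * x).
Proof.
elim: N => [|N IH].
  by rewrite /dirk big_geq// addr0 mul1r mulr0 add0r mul1r.
rewrite /dirk big_nat_recr//= addrA -/(dirk N x) mulrDl IH.
set A := 2 * pi * N.+1%:R * x; set B := pi * x.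
have -> : (2 * N%:R + 1) * pi * x = A - B by rewrite /A /B -natr1; ring.
have -> : (2 * N.+1%:R + 1) * pi * x = A + B by rewrite /A /B; ring.
rewrite sinB sinD; ring.
Qed.

Lemma is_derive_sawser N (x : R) : is_derive x 1 (sawser N) (dirk N x - 1).
Proof.
elim: N => [|N IH].
  have -> : sawser 0 = cst 0 by apply/funext => y; rewrite /sawser big_geq.
  by rewrite /dirk big_geq// addr0 subrr; exact: is_derive_cst.
have -> : sawser N.+1 = (fun x => sawser N x + sin (2 * pi * N.+1%:R * x) / (pi * N.+1%:R)).
  by apply/funext => y; rewrite /sawser big_nat_recr.
rewrite /dirk big_nat_recr//= addrA -/(dirk N x).
have pn : pi * N.+1%:R != 0 :> R by rewrite mulf_neq0 ?pnatr_eq0// gt_eqF ?pi_gt0.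
apply: is_derive_eq; rewrite /GRing.scale/=.
move: (cos _) => c; move: (dirk N x) => d; move: pn; rewrite mulf_eq0 negb_or => /andP[].
by move: (pi : R) (N.+1%:R : R) (sin _) => p m s p0 m0; field; rewrite p0 m0.
Qed.

Lemma sawser_half N : sawser N 2^-1 = 0.
Proof.
rewrite /sawser big1// => k _.
by rewrite (_ : 2 * pi * k.+1%:R / 2 = pi * k.+1%:R); [rewrite sin_natpi mul0r|field].
Qed.

(** Let c = (2 N + 1) pi and U y = 1 / (c sin (pi y)). Adding cos (c y) U y to the
    error gives a function V with V' = cos (c y) U': the Dirichlet kernel cancels.
    Since U decreases on (0, 1/2], both U - V and U + V decrease, and V vanishes at
    1/2; so |V| <= U, and the error is at most 2 U. *)
Lemma sawser_approx N x : 0 < x <= 2^-1 ->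
  `|sawser N x - (2^-1 - x)| <= ((2 * N%:R + 1) * x)^-1.
Proof.
move=> /andP[x0 x2]; have p0 := @pi_gt0 R.
pose n : R := 2 * N%:R + 1; have n0 : 0 < n by rewrite ltr_wpDl// mulr_ge0.
pose c := n * pi; have c0 : 0 < c by rewrite mulr_gt0.
pose V y := sawser N y - (2^-1 - y) + cos (c * y) / (c * sin (pi * y)).
pose U y := (c * sin (pi * y))^-1.
have py (y : R) : x <= y <= 2^-1 -> 0 <= pi * y <= pi / 2.
  by move=> /andP[xy y2]; rewrite mulr_ge0 ?(ltW p0) ?(le_trans (ltW x0) xy)//= ler_pM2l.
have sy (y : R) : x <= y <= 2^-1 -> 0 < sin (pi * y).
  move=> xy; apply: lt_le_trans (sin_ge_half (py y xy)).
  by rewrite divr_gt0// mulr_gt0// (lt_le_trans x0)//; case/andP: xy.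
have cy (y : R) : x <= y <= 2^-1 -> 0 <= cos (pi * y).
  move=> /py/andP[h1 h2]; rewrite cos_ge0_pihalf// h2 andbT (le_trans _ h1)//.
  by rewrite oppr_le0 divr_ge0// ltW.
have dU (y : R) : x <= y <= 2^-1 ->
    is_derive y 1 U (- (pi / c) * cos (pi * y) / sin (pi * y) ^+ 2).
  move=> xy; have s0 := lt0r_neq0 (sy y xy).
  have E : is_derive y 1 (fun y => c * sin (pi * y)) (c * (pi * cos (pi * y))).
    by apply: is_derive_eq; rewrite /GRing.scale/=; ring.
  have cs0 : c * sin (pi * y) != 0 by rewrite mulf_neq0// gt_eqF.
  have := @is_deriveV _ (fun y : R => c * sin (pi * y)) _ _ _ cs0 E.
  congr is_derive; rewrite /GRing.scale/=; move: s0 (gt_eqF c0).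
  move: (pi : R) (c) (cos _) (sin _) => p c' k s s0 /negbT cn0.
  by field; rewrite s0 cn0.
have dV (y : R) : x <= y <= 2^-1 ->
    is_derive y 1 V (cos (c * y) * (- (pi / c) * cos (pi * y) / sin (pi * y) ^+ 2)).
  move=> xy; have s0 := lt0r_neq0 (sy y xy).
  have dUy := dU y xy; have dSy := is_derive_sawser N y.
  have -> : V = (fun y => sawser N y - (2^-1 - y) + cos (c * y) * U y) by [].
  apply: is_derive_eq; rewrite /GRing.scale/= /U.
  have := dirk_sin N y; rewrite -/n -mulrA mulrA -/c => H.
  have -> : dirk N y = sin (c * y) / sin (pi * y) by rewrite -H mulfK.
  move: s0 (gt_eqF c0).
  move: (pi : R) (c) (sin (c * y)) (cos (c * y)) (sin (pi * y)) (cos (pi * y)) => p c' s' k' s k s0 /negbT cn0.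
  by field; rewrite s0 cn0.
have nonneg (y : R) : x <= y <= 2^-1 -> 0 <= (pi / c) * cos (pi * y) / sin (pi * y) ^+ 2.
  move=> xy; rewrite !mulr_ge0 ?cy// ?invr_ge0 ?exprn_ge0 ?(ltW (sy y xy))//; exact: ltW.
have h2 : x <= (2^-1 : R) <= 2^-1 by rewrite x2 lexx.
have V2 : V 2^-1 = 0.
  rewrite /V sawser_half subrr subr0 add0r.
  rewrite (_ : c / 2 = pi * N%:R + pi / 2); last by rewrite /c /n; field.
  by rewrite cosDpihalf sin_natpi oppr0 mul0r.
have U2 : 0 <= U 2^-1 by rewrite invr_ge0 mulr_ge0 ?(ltW c0)// ltW// sy.
have up : V x <= U x.
  have := @deriv_le _ (fun y => V y - U y) (fun y => (1 - cos (c * y)) * ((pi / c) * cos (pi * y) / sin (pi * y) ^+ 2)) x 2^-1 x2.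
  rewrite V2 sub0r => H; rewrite -subr_le0 (le_trans (H _ _))// ?oppr_le0//.
    move=> y xy; have := is_deriveB (dV y xy) (dU y xy); congr is_derive; ring.
  by move=> y xy; rewrite mulr_ge0 ?nonneg// subr_ge0 cos_le1.
have lo : - U x <= V x.
  have := @deriv_le _ (fun y => - V y - U y) (fun y => (1 + cos (c * y)) * ((pi / c) * cos (pi * y) / sin (pi * y) ^+ 2)) x 2^-1 x2.
  rewrite V2 oppr0 sub0r => H; rewrite lerNl -subr_le0 (le_trans (H _ _))// ?oppr_le0//.
    move=> y xy; have := is_deriveB (is_deriveN (dV y xy)) (dU y xy); congr is_derive; ring.
  by move=> y xy; rewrite mulr_ge0 ?nonneg//; have := cos_geN1 (c * y); lra.
have xx : x <= x <= 2^-1 by rewrite lexx.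
have U0 : 0 <= U x by rewrite invr_ge0 mulr_ge0 ?(ltW c0)// ltW// sy.
have UB : 2 * U x <= (n * x)^-1.
  have sh := sin_ge_half (py x xx).
  have -> : 2 * U x = (c * (sin (pi * x) / 2))^-1.
    rewrite /U; have := lt0r_neq0 (sy x xx); move: (sin _) => s s0.
    by field; rewrite s0 (gt_eqF c0).
  rewrite lef_pV2 ?posrE ?mulr_gt0 ?divr_gt0 ?sy// /c -mulrA ler_pM2l//.
  have p2 := pi_ge2 R.
  have h : pi * x / 2 <= sin (pi * x) by [].
  apply: (@le_trans _ _ (pi * (pi * x / 2 / 2))); last first.
    by rewrite ler_pM2l// ler_pM2r.
  have : 0 <= x * (pi - 2) * (pi + 2) by apply: mulr_ge0; [apply: mulr_ge0; [exact: ltW|rewrite subr_ge0]|rewrite addr_ge0// ltW].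
  move=> H; rewrite -subr_ge0.
  have -> : pi * (pi * x / 2 / 2) - x = x * (pi - 2) * (pi + 2) / 4 by move: (pi : R) => p; field.
  by rewrite divr_ge0.
apply: le_trans UB; have -> : sawser N x - (2^-1 - x) = V x - cos (c * x) * U x by rewrite /V addrK.
rewrite (le_trans (ler_normB _ _))// mulr_natl mulr2n lerD//.
  by rewrite ler_norml lo up.
by rewrite normrM (ger0_norm U0) ler_piMl// cos_max.
Qed.

Lemma sawser_small N x : 0 <= x -> `|sawser N x| <= 2 * N%:R * x.
Proof.
move=> x0; rewrite (le_trans (ler_norm_sum _ _ _))//.
rewrite (@le_trans _ _ (\sum_(0 <= k < N) (2 * x)))//; last first.
  by rewrite sumr_const_nat subn0 -[X in X <= _]mulr_natr mulrAC.
apply: ler_sum => k _; have p0 : 0 < pi * k.+1%:R :> R by rewrite mulr_gt0 ?pi_gt0.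
rewrite normrM (gtr0_norm (_ : 0 < _^-1)) ?invr_gt0// ler_pdivrMr//.
rewrite (le_trans (normr_sin_le _))// ger0_norm; last first.
  by rewrite mulr_ge0// -mulrA mulr_ge0// ltW.
by rewrite le_eqVlt; apply/orP; left; apply/eqP; ring.
Qed.

(** For (2 N + 1) x >= 1 this is [sawser_approx]; otherwise the partial sum is at
    most 2 N x < 1 term by term. *)
Lemma sawser_bound_half N x : 0 < x <= 2^-1 -> `|sawser N x - (2^-1 - x)| <= 2.
Proof.
move=> x02; have /andP[x0 x2] := x02.
have n0 : 0 < 2 * N%:R + 1 :> R by rewrite ltr_wpDl// mulr_ge0.
have [h|h] := leP 1 ((2 * N%:R + 1) * x).
  rewrite (le_trans (sawser_approx N x02))// (@le_trans _ _ 1) ?ler1n//.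
  by rewrite invf_le1// mulr_gt0.
have := sawser_small N (ltW x0); move: h; rewrite mulrDl mul1r.
move: (2 * N%:R * x) (sawser N x) => z s h /ler_normlP[s1 s2].
by apply/ler_normlP; split; lra.
Qed.

(** The value 0 at the integers is the mean of the one-sided limits, and the sum of
    the Fourier series. *)
Definition saw (x : R) : R := if frac_part x == 0 then 0 else 2^-1 - frac_part x.

Lemma sawser_shift N x (n : nat) : sawser N (x + n%:R) = sawser N x.
Proof.
apply: eq_bigr => k _; congr (_ / _).
have -> : 2 * pi * k.+1%:R * (x + n%:R) = 2 * pi * k.+1%:R * x + (pi *+ 2) *+ (k.+1 * n) :> R.
  by rewrite -[(pi *+ 2) *+ _]mulr_natr -[pi *+ 2]mulr_natr natrM; ring.
exact: (periodicn (@sinD2pi R)).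
Qed.

Lemma sawserN N x : sawser N (- x) = - sawser N x.
Proof. by rewrite /sawser -sumrN; apply: eq_bigr => k _; rewrite mulrN sinN mulNr. Qed.

Lemma frac_part_nat (x : R) : 0 <= x -> exists n : nat, x = frac_part x + n%:R.
Proof.
move=> x0; exists `|Num.floor x|%N; rewrite /frac_part.
have h : 0 <= Num.floor x by rewrite floor_ge0.
by rewrite pmulrn gez0_abs// subrK.
Qed.

Lemma sawser0 N : sawser N 0 = 0.
Proof. by rewrite /sawser big1// => k _; rewrite mulr0 sin0 mul0r. Qed.

(** By periodicity and oddness. *)
Lemma saw_reduce x : 0 <= x -> (saw x = 0 /\ forall N, sawser N x = 0) \/
  exists e y : R, [/\ `|e| = 1, 0 < y <= 2^-1, saw x = e * (2^-1 - y) &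
     forall N, sawser N x = e * sawser N y].
Proof.
move=> x0; have [n xE] := frac_part_nat x0; have /andP[f0 f1] := frac_part_itv x.
rewrite /saw; have [fz|fn] := eqVneq (frac_part x) 0.
  by left; split => // N; rewrite xE sawser_shift fz sawser0.
right; have fp : 0 < frac_part x by rewrite lt0r fn.
have [f2|f2] := leP (frac_part x) 2^-1.
  exists 1, (frac_part x); rewrite normr1 !mul1r fp f2; split => // N.
  by rewrite mul1r [in LHS]xE sawser_shift.
exists (-1), (1 - frac_part x); rewrite normrN1; split => //.
- by apply/andP; split; lra.
- by move: (frac_part x) => f; field.
- move=> N; rewrite [in LHS]xE sawser_shift mulN1r -sawserN opprB.
  by rewrite -[in RHS](sawser_shift N _ 1) subrK.
Qed.

Lemma sawser_cvg x : 0 <= x -> (fun N => sawser N x) @ \oo --> saw x.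
Proof.
move=> /saw_reduce[[-> h]|[e [y [e1 y02 -> h]]]].
  by under eq_fun do rewrite h; exact: cvg_cst.
under eq_fun do rewrite h; apply: cvgM; first exact: cvg_cst.
have /andP[y0 _] := y02.
apply/cvgrPdist_le => d d0.
exists (Num.truncn (y^-1 / d)).+1 => // N /= Nn; rewrite distrC (le_trans (sawser_approx N y02))//.
rewrite invfM -ler_pdivlMr ?invr_gt0// invrK -[leRHS]invrK lef_pV2 ?posrE ?invr_gt0 ?mulr_gt0//.
  have h1 : y^-1 / d < N%:R by rewrite (lt_le_trans (truncnS_gt _))// ler_nat.
  have h2 : 0 <= N%:R :> R by [].
by rewrite invfM; move: h1; rewrite mulrC; move: (d^-1 * y^-1) (N%:R : R) h2 => z m; lra.
Qed.

Lemma sawser_bound N x : 0 <= x -> `|sawser N x| <= 3.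
Proof.
move=> /saw_reduce[[_ ->]|[e [y [e1 y02 _ ->]]]]; first by rewrite normr0.
rewrite normrM e1 mul1r; have /andP[y0 y2] := y02.
have := sawser_bound_half N y02; move: (sawser N y) => s /ler_normlP[s1 s2].
by apply/ler_normlP; split; lra.
Qed.

(** The value at the jump is the mean 1/2, so that the sum of these steps matches
    the value of [saw] at the integers. *)
Definition hstep (m : nat) (x : R) : R := 2^-1 * ((m.+1%:R <= x)%R%:R + (m.+1%:R < x)%R%:R).

Lemma hstep_bound N x : 0 <= x -> 0 <= \sum_(0 <= m < N) hstep m x <= x.
Proof.
move=> x0; apply/andP; split.
  by apply: sumr_ge0 => m _; rewrite mulr_ge0// addr_ge0.
suff : \sum_(0 <= m < N) hstep m x <= x /\ \sum_(0 <= m < N) hstep m x <= N%:R by case.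
elim: N => [|N [I1 I2]]; first by rewrite big_geq.
rewrite big_nat_recr//=; have [h|h] := leP N.+1%:R x.
  have b : hstep N x <= 1.
    have b1 (b : bool) : (b%:R : R) <= 1 by case: b.
    have := b1 (N.+1%:R <= x); have := b1 (N.+1%:R < x); rewrite /hstep.
    by move: (_%:R) (_%:R) => u v; lra.
  move: h; rewrite -natr1 => h; split; last exact: lerD.
  by rewrite (le_trans (lerD I2 b)).
have -> : hstep N x = 0 by rewrite /hstep leNgt h ltNge (ltW h) addr0 mulr0.
by rewrite !addr0; split => //; rewrite (le_trans I2)// ler_nat.
Qed.

(** The sum of the steps is floor x away from the integers and x - 1/2 at the
    positive integers. *)
Lemma hstep_cvg x : 0 < x -> (fun N => \sum_(0 <= m < N) hstep m x) @ \oo --> x - 2^-1 + saw x.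
Proof.
move=> x0.
have L1 := floor_count (ltW x0).
have L2 : (fun N => \sum_(0 <= m < N) (m.+1%:R < x :> R)%R%:R : R) @ \oo -->
   (if frac_part x == 0 then x - 1 else x - frac_part x).
  have [n xE] := frac_part_nat (ltW x0); have /andP[f0 f1] := frac_part_itv x.
  have [fz|fn] := eqVneq (frac_part x) 0.
    rewrite fz add0r in xE; move: xE; case: n => [h|n xE]; first by rewrite h ltxx in x0.
    have x1 : x - 1 = n%:R by rewrite xE -natr1 addrK.
    have x10 : 0 <= x - 1 by rewrite x1.
    have := floor_count x10.
    have -> : Num.floor (x - 1) = n.
      by apply: floor_def; rewrite x1 -pmulrn lexx/= intrD1 -pmulrn ltrDl.
    rewrite -pmulrn -x1; apply: cvg_trans; apply: near_eq_cvg; near=> N.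
    by apply: eq_bigr => m _; rewrite x1 xE ler_nat ltr_nat ltnS.
  have -> : x - frac_part x = (Num.floor x)%:~R by rewrite /frac_part subKr.
  apply: cvg_trans L1; apply: near_eq_cvg; near=> N.
  apply: eq_bigr => m _; rewrite lt_neqAle; case: eqVneq => //= mx.
  have : frac_part x = 0.
    rewrite /frac_part (_ : Num.floor x = m.+1) -?pmulrn ?mx ?subrr//.
    by apply: floor_def; rewrite -mx -pmulrn lexx/= intrD1 -pmulrn ltrDl.
  by move/eqP; rewrite (negbTE fn).
have -> : x - 2^-1 + saw x = 2^-1 * ((Num.floor x)%:~R + (if frac_part x == 0 then x - 1 else x - frac_part x)).
  have fE : (Num.floor x)%:~R = x - frac_part x by rewrite /frac_part subKr.
  by rewrite fE /saw; case: eqVneq => [->|_]; field.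
have -> : (fun N => \sum_(0 <= m < N) hstep m x) =
    (fun N => 2^-1 * (\sum_(0 <= m < N) (m.+1%:R <= x :> R)%R%:R + \sum_(0 <= m < N) (m.+1%:R < x :> R)%R%:R)).
  by apply/funext => N; rewrite -big_split/= mulr_sumr.
by apply: cvgM; [exact: cvg_cst|apply: cvgD].
Unshelve. all: by end_near. Qed.

End Sawtooth.

(** * Jacobi's identity for the theta function *)

Section Theta.
Context {R : realType}.
Local Notation mu := (@lebesgue_measure R).
Local Notation RR := (measurableTypeR R).
Local Notation D0 := (`]0, +oo[%classic : set R).

Lemma FTC_ray (f F : R -> R) (a : R) : mu.-integrable `[a, +oo[ (EFin \o f) ->
  (forall x : R, is_derive x 1 F (f x)) -> continuous f ->
  (fun n : nat => F (a + n.+1%:R)) @ \oo --> (0 : R) ->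
  \int[mu]_(x in `]a, +oo[) f x = - F a.
Proof.
move=> i_f dF cf Foo.
rewrite Rintegral_itv_obnd_cbnd; last first.
  by apply: (@integrableS _ RR _ mu `[a, +oo[%classic _ _ (measurable_itv _) (measurable_itv _) _ i_f) => x /=;
    rewrite !in_itv/= !andbT => /ltW.
have ca : (fun _ : nat => F a) @ \oo --> F a by exact: cvg_cst.
rewrite (@improper_FTC _ `[a, +oo[%classic f F (fun=> a) (fun n => a + n.+1%:R) (F a) 0) ?sub0r//.
- by move=> n; rewrite ltrDl.
- by move=> n x /andP[ax _]; rewrite /= in_itv/= andbT.
- move=> x; rewrite /= in_itv/= andbT => ax; have [N _ HN] := near_ubound (x - a).
  by exists N => // n Nn; have /= /andP[_ h] := HN n Nn; rewrite ax/= -lerBlDl.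
- by move=> x _; exact: cf.
Qed.

Section Fixed.
Variable tau : R.
Hypothesis tau0 : 0 < tau.
Local Notation g := (gauss tau).

Definition dgauss (x : R) : R := - (2 * pi * tau * x) * g x.

Lemma gauss_le_exp : exists C, forall x, g x <= C * expR (- x).
Proof.
exists (expR ((4 * pi * tau)^-1)) => x; rewrite -expRD ler_expR.
have pt0 : 0 < pi * tau by rewrite mulr_gt0 ?pi_gt0.
rewrite -subr_ge0 /gauss.
have -> : (4 * pi * tau)^-1 - x - - (pi * tau * x ^+ 2) = (pi * tau) * (x - (2 * (pi * tau))^-1) ^+ 2.
  rewrite -mulrA; move: (pi * tau) pt0 => p /lt0r_neq0 p0; field.
  exact: p0.
by rewrite mulr_ge0 ?sqr_ge0// ltW.
Qed.

Lemma gauss_lim (u : nat -> R) (h : R -> R) (K : R) : (forall n, n.+1%:R <= u n) ->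
  (forall x, 0 <= x -> `|h x| <= K * (1 + x)) ->
  (fun n => h (u n) * g (u n)) @ \oo --> (0 : R).
Proof.
move=> un hK; have [C HC] := gauss_le_exp.
have K0 : 0 <= K by have := hK 0 (lexx 0); rewrite addr0 mulr1; apply: le_trans.
have C0 : 0 <= C by have := le_trans (expR_ge0 _) (HC 0); rewrite oppr0 expR0 mulr1.
apply/cvgr0Pnorm_le => e e0.
have c2 : 0 < 2^-1 :> R by [].
have L : (fun n : nat => 2 * K * C * expR (- 2^-1 * n.+1%:R)) @ \oo --> 2 * K * C * 0.
  by apply: cvgM; [exact: cvg_cst|exact: (cvg_expN c2)].
rewrite mulr0 in L; move/cvgr0Pnorm_le : L => /(_ _ e0)[N _ HN]; exists N => // n Nn /=.
have := HN n Nn; rewrite /= ger0_norm; last by rewrite mulr_ge0 ?expR_ge0// mulr_ge0// mulr_ge0.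
apply: le_trans; have u0 : 0 <= u n by exact: le_trans (un n).
rewrite normrM (ger0_norm (expR_ge0 _)).
apply: (@le_trans _ _ (K * (1 + u n) * (C * expR (- u n)))).
  by apply: ler_pM; rewrite ?expR_ge0//; [exact: hK|exact: HC].
have h2 : 1 + u n <= 2 * expR (2^-1 * u n).
  by have := expR_ge1Dx (2^-1 * u n); lra.
apply: (@le_trans _ _ (K * (2 * expR (2^-1 * u n)) * (C * expR (- u n)))).
  by apply: ler_wpM2r; [rewrite mulr_ge0 ?expR_ge0|rewrite ler_wpM2l].
have -> : K * (2 * expR (2^-1 * u n)) * (C * expR (- u n)) = 2 * K * C * expR (- 2^-1 * u n).
  have -> : expR (- 2^-1 * u n) = expR (2^-1 * u n) * expR (- u n) by rewrite -expRD; congr expR; field.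
  by ring.
by rewrite ler_wpM2l ?mulr_ge0// ler_expR ler_wnM2l ?oppr_le0.
Qed.

Definition gmaj (x : R) : R := 6 * pi * tau * (g x * expR (1 * x)).

Lemma gmaj_integrable (A : set R) : measurable (A : set RR) -> mu.-integrable A (EFin \o gmaj).
Proof.
move=> mA; apply: integrableZ_R => //.
by apply: (@integrableS _ RR _ mu setT _ _ measurableT mA (@subsetT _ _) (gauss_square tau0 1).1).
Qed.

Lemma dgauss_maj (x : R) : 0 <= x -> `|dgauss x| * (1 + x) <= gmaj x.
Proof.
move=> x0; rewrite /dgauss /gmaj; have pt0 : 0 <= pi * tau by rewrite mulr_ge0 ?pi_ge0// ltW.
rewrite normrM (ger0_norm (expR_ge0 _)) normrN ger0_norm; last first.
  by rewrite mulr_ge0// -mulrA mulr_ge0.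
have e1 := exp_coeff_le_expR 1 x0; have e2 := exp_coeff_le_expR 2 x0.
rewrite expr1 divr1 in e1.
have E : x * (1 + x) <= 3 * expR x.
  have : x ^+ 2 <= 2 * expR x by move: e2; rewrite ler_pdivrMr// mulrC.
  rewrite mulrDr mulr1 -expr2; lra.
rewrite mul1r; have g0 : 0 <= g x by exact: expR_ge0.
have -> : 2 * pi * tau * x * g x * (1 + x) = 2 * (pi * tau) * g x * (x * (1 + x)) by ring.
have -> : 6 * pi * tau * (g x * expR x) = 2 * (pi * tau) * g x * (3 * expR x) by ring.
apply: ler_wpM2l => //; apply: mulr_ge0 => //; exact: mulr_ge0.
Qed.

Lemma is_derive_dgauss (x : R) : is_derive x 1 dgauss (- (2 * pi * tau) * g x - 2 * pi * tau * x * dgauss x).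
Proof.
have dg := is_derive_gauss tau x.
by apply: is_derive_eq; rewrite /dgauss /GRing.scale/=; ring.
Qed.

Lemma dgauss_continuous : continuous dgauss.
Proof.
by move=> x; apply/differentiable_continuous/derivable1_diffP; have [] := is_derive_dgauss x.
Qed.

Lemma gauss_continuous : continuous g.
Proof.
by move=> x; apply/differentiable_continuous/derivable1_diffP; have [] := is_derive_gauss tau x.
Qed.

Lemma dgauss_integrable (A : set R) (h : R -> R) (K : R) : measurable (A : set RR) ->
  (forall x, A x -> 0 <= x) -> measurable_fun (A : set RR) h ->
  (forall x, A x -> `|h x| <= K * (1 + x)) ->
  mu.-integrable A (EFin \o (fun x => dgauss x * h x)).
Proof.
move=> mA A0 mh hK.
apply: (le_integrable_R mA _ _ (integrableZ_R K mA (gmaj_integrable mA))).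
  apply: measurable_funM => //; apply: measurable_funTS.
  exact: (continuous_measurable_fun dgauss_continuous).
move=> x Ax; have x0 := A0 x Ax.
have K0 : 0 <= K by rewrite -(pmulr_lge0 _ (_ : 0 < 1 + x)) ?ltr_pwDl// (le_trans _ (hK x Ax)).
rewrite normrM (le_trans (ler_wpM2l (normr_ge0 _) (hK x Ax)))// mulrCA.
by rewrite ler_wpM2l// dgauss_maj.
Qed.

Let mray (a : R) : measurable (`[a, +oo[%classic : set RR). Proof. exact: measurable_itv. Qed.
Let mray' (a : R) : measurable (`]a, +oo[%classic : set RR). Proof. exact: measurable_itv. Qed.

Lemma ray0 (a x : R) : 0 <= a -> `[a, +oo[%classic x -> 0 <= x.
Proof. by move=> a0; rewrite /= in_itv/= andbT; exact: le_trans. Qed.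

Lemma D0_ge0 (x : R) : D0 x -> 0 <= x.
Proof. by rewrite /= in_itv/= andbT => /ltW. Qed.

Lemma dgauss_int1 (a : R) : 0 <= a -> \int[mu]_(x in `]a, +oo[) dgauss x = - g a.
Proof.
move=> a0; apply: FTC_ray.
- have := @dgauss_integrable _ (fun=> 1) 1 (mray a) (fun x => ray0 a0) (measurable_cst _).
  rewrite (_ : (fun x => dgauss x * 1) = dgauss); last by apply/funext => x; rewrite mulr1.
  by apply => x /(ray0 a0) x0; rewrite normr1 mul1r lerDl.
- by move=> x; exact: is_derive_gauss.
- exact: dgauss_continuous.
- have := @gauss_lim (fun n => a + n.+1%:R) (fun=> 1) 1.
  under eq_fun do rewrite mul1r; apply.
    by move=> n; rewrite lerDr.
  by move=> x x0; rewrite normr1 mul1r lerDl.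
Qed.

Lemma gauss_int : mu.-integrable D0 (EFin \o g) /\ \int[mu]_(x in D0) g x = 2^-1 * Num.sqrt tau^-1.
Proof.
have [] := gauss_cos_half tau0 0.
rewrite expr2 mul0r mulr0 mul0r oppr0 expR0 mulr1.
have -> : (fun x => g x * cos (2 * pi * 0 * x)) = g.
  by apply/funext => x; rewrite mulr0 mul0r cos0 mulr1.
by move=> i1 <-; split => //; apply: eq_Rintegral => x _; rewrite mulr0 mul0r cos0 mulr1.
Qed.

Lemma dgauss_intx : \int[mu]_(x in D0) (dgauss x * x) = - (2^-1 * Num.sqrt tau^-1).
Proof.
have [ig eg] := gauss_int.
have iD : mu.-integrable D0 (EFin \o (fun x => dgauss x * x)).
  apply: (@dgauss_integrable _ id 1 (mray' 0)) => //; first exact: D0_ge0.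
  by move=> x /D0_ge0 x0; rewrite ger0_norm// mul1r lerDr.
have iray : mu.-integrable `[0, +oo[ (EFin \o (fun x => dgauss x * x)).
  apply: (@dgauss_integrable _ id 1 (mray 0)) => //; first by move=> x; exact: ray0.
  by move=> x /(ray0 (lexx 0)) x0; rewrite ger0_norm// mul1r lerDr.
have igray : mu.-integrable `[0, +oo[ (EFin \o g).
  have := (gauss_square tau0 0).1; under eq_fun do rewrite mul0r expR0 mulr1.
  exact: (@integrableS _ RR _ mu setT _ _ measurableT (mray 0) (@subsetT _ _)).
have := @FTC_ray (fun x => g x + dgauss x * x) (fun x => x * g x) 0
  (integrableD_R (mray 0) igray iray).
rewrite mul0r oppr0 (@RintegralD _ RR)// eg => H.
apply/eqP; rewrite -addr_eq0 addrC; apply/eqP; apply: H.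
- move=> x; have dg := is_derive_gauss tau x.
  by apply: is_derive_eq; rewrite /dgauss /GRing.scale/=; ring.
- move=> x; apply: cvgD; first exact: gauss_continuous.
  by apply: cvgM; [exact: dgauss_continuous|exact: cvg_id].
- under eq_fun do rewrite add0r.
  apply: (@gauss_lim _ id 1) => // x x0; by rewrite ger0_norm// mul1r lerDr.
Qed.

(** Integration by parts reduces this to the cosine transform of the Gaussian. *)
Lemma dgauss_sin (y : R) : \int[mu]_(x in D0) (dgauss x * sin (2 * pi * y * x)) =
  - (pi * y) * (Num.sqrt tau^-1 * gauss tau^-1 y).
Proof.
have [ig eg] := gauss_cos_half tau0 y.
pose f x := dgauss x * sin (2 * pi * y * x) + 2 * pi * y * (g x * cos (2 * pi * y * x)).
have ms : measurable_fun (setT : set RR) (fun x => sin (2 * pi * y * x)).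
  by apply: (measurableT_comp (continuous_measurable_fun (@continuous_sin R))); exact: measurable_funM.
have b (x : R) : 0 <= x -> `|sin (2 * pi * y * x)| <= 1 * (1 + x).
  by move=> x0; rewrite mul1r (le_trans (sin_max _))// lerDl.
have iD : mu.-integrable D0 (EFin \o (fun x => dgauss x * sin (2 * pi * y * x))).
  apply: (@dgauss_integrable _ _ 1 (mray' 0)); first exact: D0_ge0.
    exact: measurable_funTS.
  by move=> x /D0_ge0; exact: b.
have iray : mu.-integrable `[0, +oo[ (EFin \o (fun x => dgauss x * sin (2 * pi * y * x))).
  apply: (@dgauss_integrable _ _ 1 (mray 0)); first by move=> x; exact: ray0.
    exact: measurable_funTS.
  by move=> x /(ray0 (lexx 0)); exact: b.
have igray : mu.-integrable `[0, +oo[ (EFin \o (fun x => g x * cos (2 * pi * y * x))).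
  have := @integrableS _ RR _ mu setT _ _ measurableT (mray 0) (@subsetT _ _) (gauss_square tau0 0).1.
  apply: (le_integrable_R (mray 0)).
    apply: measurable_funTS; apply: measurable_funM; first exact: measurable_gauss.
    by apply: (measurableT_comp (continuous_measurable_fun (@continuous_cos R))); exact: measurable_funM.
  by move=> x _; rewrite mul0r expR0 mulr1 normrM ger0_norm ?expR_ge0// ler_piMr ?expR_ge0// cos_max.
have c1 : continuous (fun x => 2 * pi * y * x : R).
  by move=> x; apply: cvgM; [exact: cvg_cst|exact: cvg_id].
have ic := integrableZ_R (2 * pi * y) (mray' 0) ig.
have := @FTC_ray f (fun x => g x * sin (2 * pi * y * x)) 0
  (integrableD_R (mray 0) iray (integrableZ_R (2 * pi * y) (mray 0) igray)).
rewrite /f (@RintegralD _ RR)// (@RintegralZl _ RR)// eg mulr0 sin0 mulr0 oppr0 => H.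
have {}H := H _ _ _.
have -> : gauss tau^-1 y = expR (- (pi * y ^+ 2 / tau)) by rewrite /gauss mulrAC.
apply/eqP; rewrite mulNr -addr_eq0; apply/eqP.
rewrite -[RHS]H; last 3 first.
- move=> x; have dg := is_derive_gauss tau x.
  by apply: is_derive_eq; rewrite /dgauss /GRing.scale/=; ring.
- move=> x; apply: cvgD.
    apply: cvgM; first exact: dgauss_continuous.
    by apply: (@continuous_comp _ _ _ (fun x => 2 * pi * y * x) sin x); [exact: c1|exact: continuous_sin].
  apply: cvgM; first exact: cvg_cst; apply: cvgM; first exact: gauss_continuous.
  by apply: (@continuous_comp _ _ _ (fun x => 2 * pi * y * x) cos x); [exact: c1|exact: continuous_cos].
- under eq_fun do rewrite add0r mulrC.
  exact: (@gauss_lim _ (fun x => sin (2 * pi * y * x)) 1).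
by congr (_ + _); field.
Qed.

(** The Fourier series of the sawtooth is integrated term by term, which is allowed
    because its partial sums are bounded. *)
Lemma fourier_side : mu.-integrable D0 (EFin \o (fun x => dgauss x * saw x)) /\
  (fun N => Num.sqrt tau^-1 * \sum_(0 <= k < N) gauss tau^-1 k.+1%:R) @ \oo -->
  - \int[mu]_(x in D0) (dgauss x * saw x).
Proof.
have ms N : measurable_fun (setT : set RR) (sawser N).
  apply: continuous_measurable_fun => x.
  by apply/differentiable_continuous/derivable1_diffP; have [] := is_derive_sawser N x.
have mF N : measurable_fun (D0 : set RR) (fun x => dgauss x * sawser N x).
  apply: measurable_funTS; apply: measurable_funM => //.
  exact: (continuous_measurable_fun dgauss_continuous).
have b (h x : R) : 0 <= x -> `|h| <= 3 -> `|dgauss x * h| <= 3 * gmaj x.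
  move=> x0 h3; rewrite normrM mulrC; apply: ler_pM => //.
  by apply: le_trans (dgauss_maj x0); rewrite ler_peMr// lerDl.
have ig := integrableZ_R 3 (mray' 0) (gmaj_integrable (mray' 0)).
have [i_s L] := @Rintegral_cvg _ RR _ mu D0 _ (fun x => dgauss x * saw x) _ (mray' 0) mF ig
  (fun N x Dx => b _ _ (D0_ge0 Dx) (sawser_bound N (D0_ge0 Dx)))
  (fun x Dx => cvgM (cvg_cst _) (sawser_cvg (D0_ge0 Dx))).
split => //.
have E N : \int[mu]_(x in D0) (dgauss x * sawser N x) =
    - (Num.sqrt tau^-1 * \sum_(0 <= k < N) gauss tau^-1 k.+1%:R).
  elim: N => [|N IH].
    rewrite big_geq// mulr0 oppr0 /Rintegral; under eq_integral do rewrite /sawser big_geq// mulr0.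
    by rewrite integral0.
  have iN (n : nat) : mu.-integrable D0 (EFin \o (fun x => dgauss x * sawser n x)).
    apply: (le_integrable_R (mray' 0) (mF n) _ ig) => x /D0_ge0 x0.
    by apply: b => //; exact: sawser_bound.
  have isN : mu.-integrable D0 (EFin \o (fun x => dgauss x * sin (2 * pi * N.+1%:R * x))).
    apply: (@dgauss_integrable _ _ 1 (mray' 0)); first exact: D0_ge0.
      apply: measurable_funTS.
      by apply: (measurableT_comp (continuous_measurable_fun (@continuous_sin R))); exact: measurable_funM.
    by move=> x /D0_ge0 x0; rewrite mul1r (le_trans (sin_max _))// lerDl.
  have isN' := integrableZ_R (pi * N.+1%:R)^-1 (mray' 0) isN.
  transitivity (\int[mu]_(x in D0) (dgauss x * sawser N x +
     (pi * N.+1%:R)^-1 * (dgauss x * sin (2 * pi * N.+1%:R * x)))).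
    apply: eq_Rintegral => x _; rewrite /sawser big_nat_recr//= mulrDr; congr (_ + _).
    by rewrite mulrA mulrC.
  rewrite (@RintegralD _ RR)// (@RintegralZl _ RR)// IH dgauss_sin big_nat_recr//=.
  rewrite mulrDr opprD; congr (_ + _); rewrite mulNr mulrN mulKf//.
  by rewrite mulf_neq0 ?pnatr_eq0// gt_eqF ?pi_gt0.
rewrite (_ : (fun N => _ * _) = (fun N => - \int[mu]_(x in D0) (dgauss x * sawser N x))).
  by apply: cvgN; exact: L.
by apply/funext => N; rewrite E opprK.
Qed.

Lemma hstepE m (x : R) : hstep m x = 2^-1 * (\1_(`[m.+1%:R, +oo[%classic : set R) x + \1_(`]m.+1%:R, +oo[%classic : set R) x).
Proof. by rewrite /hstep !indicE !mem_setE !in_itv/= !andbT. Qed.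

Lemma measurable_hstep m : measurable_fun (setT : set RR) (@hstep R m).
Proof.
rewrite (_ : @hstep R m = fun x => 2^-1 * (\1_(`[m.+1%:R, +oo[%classic : set R) x + \1_(`]m.+1%:R, +oo[%classic : set R) x)); last first.
  by apply/funext => x; exact: hstepE.
apply: measurable_funM => //; apply: measurable_funD; apply: measurable_indic.
  exact: (mray m.+1%:R).
exact: (mray' m.+1%:R).
Qed.

Lemma dgauss_hstep m : mu.-integrable D0 (EFin \o (fun x => dgauss x * hstep m x)) /\
  \int[mu]_(x in D0) (dgauss x * hstep m x) = - g m.+1%:R.
Proof.
pose A1 : set R := `[m.+1%:R, +oo[%classic; pose A2 : set R := `]m.+1%:R, +oo[%classic.
have m0 : 0 <= m.+1%:R :> R by [].
have S1 : A1 `<=` D0 by move=> x; rewrite /A1/= !in_itv/= !andbT; apply: lt_le_trans.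
have S2 : A2 `<=` D0 by move=> x; rewrite /A2/= !in_itv/= !andbT; apply: lt_trans.
have i1 (A : set R) : measurable (A : set RR) -> mu.-integrable D0 (EFin \o (fun x => dgauss x * \1_A x)).
  move=> mA; apply: (@dgauss_integrable _ _ 1 (mray' 0)); first exact: D0_ge0.
    by apply: measurable_funTS; exact: measurable_indic.
  move=> x /D0_ge0 x0; rewrite mul1r indicE; case: (_ \in _); rewrite ?normr1 ?normr0 ?lerDl//.
  by rewrite addr_ge0.
have E (A : set R) : measurable (A : set RR) -> A `<=` D0 ->
    \int[mu]_(x in D0) (dgauss x * \1_A x) = \int[mu]_(x in A) dgauss x.
  move=> mA AD; rewrite -[in RHS](setIidr AD) Rintegral_mkcondr; apply: eq_Rintegral => x _.
  by rewrite indicE patchE; case: ifP => _; rewrite ?mulr1 ?mulr0.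
have e2 := E A2 (mray' _) S2; rewrite dgauss_int1// in e2.
have e1 := E A1 (mray _) S1.
rewrite -Rintegral_itv_obnd_cbnd ?dgauss_int1// in e1; last first.
  have := @dgauss_integrable _ (fun=> 1) 1 (mray' m.+1%:R) _ (measurable_cst _).
  rewrite (_ : (fun x => dgauss x * 1) = dgauss); last by apply/funext => x; rewrite mulr1.
  apply => x; rewrite /= in_itv/= andbT => /ltW mx; first exact: le_trans mx.
  by rewrite normr1 mul1r lerDl (le_trans _ mx).
have hE : (fun x => dgauss x * hstep m x) = (fun x => 2^-1 * (dgauss x * \1_A1 x + dgauss x * \1_A2 x)).
  by apply/funext => x; rewrite hstepE; ring.
have j1 := i1 A1 (mray _); have j2 := i1 A2 (mray' _).
have j12 := integrableD_R (mray' 0) j1 j2.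
rewrite hE; split; first exact: (integrableZ_R 2^-1 (mray' 0) j12).
by rewrite (@RintegralZl _ RR)// (@RintegralD _ RR)// e1 e2; field.
Qed.

(** Euler-Maclaurin summation: the derivative of the Gaussian is integrated against
    both sides of [hstep_cvg], and each step contributes a value of the
    Gaussian. *)
Lemma sum_side : (fun N => \sum_(0 <= k < N) g k.+1%:R) @ \oo -->
  2^-1 * Num.sqrt tau^-1 - 2^-1 - \int[mu]_(x in D0) (dgauss x * saw x).
Proof.
have [is_ _] := fourier_side.
have mF N : measurable_fun (D0 : set RR) (fun x => dgauss x * \sum_(0 <= m < N) hstep m x).
  apply: measurable_funTS; apply: measurable_funM.
    exact: (continuous_measurable_fun dgauss_continuous).
  by apply: measurable_sum => m; exact: measurable_hstep.
have b N (x : R) : D0 x -> `|dgauss x * \sum_(0 <= m < N) hstep m x| <= gmaj x.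
  move=> /D0_ge0 x0; have /andP[h0 h1] := hstep_bound N x0.
  apply: le_trans (dgauss_maj x0); rewrite normrM (ger0_norm h0) ler_wpM2l//.
  by rewrite (le_trans h1)// lerDr.
have ig := gmaj_integrable (mray' 0).
have Hc x : D0 x -> (fun N => dgauss x * \sum_(0 <= m < N) hstep m x) @ \oo -->
    dgauss x * (x - 2^-1 + saw x).
  rewrite /= in_itv/= andbT => x0; apply: cvgM; first exact: cvg_cst.
  exact: hstep_cvg.
have [_ L] := @Rintegral_cvg _ RR _ mu D0 _ _ _ (mray' 0) mF ig b Hc.
have E N : \int[mu]_(x in D0) (dgauss x * \sum_(0 <= m < N) hstep m x) =
    - \sum_(0 <= k < N) g k.+1%:R.
  elim: N => [|N IH].
    rewrite big_geq// oppr0 /Rintegral; under eq_integral do rewrite big_geq// mulr0.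
    by rewrite integral0.
  have iN : mu.-integrable D0 (EFin \o (fun x => dgauss x * \sum_(0 <= m < N) hstep m x)).
    exact: (le_integrable_R (mray' 0) (mF N) (b N) ig).
  have [ih eh] := dgauss_hstep N.
  rewrite big_nat_recr//= opprD -IH -eh -(@RintegralD _ RR)//.
  by apply: eq_Rintegral => x _; rewrite big_nat_recr//= mulrDr.
have iD : mu.-integrable D0 (EFin \o (fun x => dgauss x * x)).
  apply: (@dgauss_integrable _ id 1 (mray' 0)) => //; first exact: D0_ge0.
  by move=> x /D0_ge0 x0; rewrite ger0_norm// mul1r lerDr.
have i1 : mu.-integrable D0 (EFin \o dgauss).
  have := @dgauss_integrable _ (fun=> 1) 1 (mray' 0) D0_ge0 (measurable_cst _).
  rewrite (_ : (fun x => dgauss x * 1) = dgauss); last by apply/funext => x; rewrite mulr1.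
  by apply => x /D0_ge0 x0; rewrite normr1 mul1r lerDl.
have i1' := integrableZ_R (- 2^-1) (mray' 0) i1.
have iD1 := integrableD_R (mray' 0) iD i1'.
have V : \int[mu]_(x in D0) (dgauss x * (x - 2^-1 + saw x)) =
    - (2^-1 * Num.sqrt tau^-1) + 2^-1 + \int[mu]_(x in D0) (dgauss x * saw x).
  transitivity (\int[mu]_(x in D0) ((dgauss x * x + - 2^-1 * dgauss x) + dgauss x * saw x)).
    by apply: eq_Rintegral => x _; ring.
  rewrite (@RintegralD _ RR)// (@RintegralD _ RR)// (@RintegralZl _ RR)// dgauss_intx dgauss_int1//.
  by rewrite /gauss expr2 mul0r mulr0 oppr0 expR0 mulrNN mulr1.
rewrite V in L; have L' := cvgN L.
rewrite (_ : _ - _ = - (- (2^-1 * Num.sqrt tau^-1) + 2^-1 + \int[mu]_(x in D0) (dgauss x * saw x))); last by ring.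
rewrite (_ : (fun N => \sum_(_ <= _ < _) _) = (fun N => - \int[mu]_(x in D0) (dgauss x * \sum_(0 <= m < N) hstep m x))).
  by apply: cvgN; exact: L.
by apply/funext => N; rewrite E opprK.
Qed.

End Fixed.

Definition theta (tau : R) : R := limn (fun N => \sum_(0 <= k < N) gauss tau k.+1%:R).

Lemma theta_cvg tau : 0 < tau -> (fun N => \sum_(0 <= k < N) gauss tau k.+1%:R) @ \oo --> theta tau.
Proof. by move=> t0; rewrite /theta; have h := sum_side t0; rewrite (cvg_lim _ h). Qed.

(** By [sum_side] and [fourier_side], both sides are the integral of the derivative
    of the Gaussian against the sawtooth, up to elementary terms. *)
Theorem theta_eq tau : 0 < tau -> theta tau + 2^-1 = Num.sqrt tau^-1 * (theta tau^-1 + 2^-1).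
Proof.
move=> t0.
have ti0 : 0 < tau^-1 by rewrite invr_gt0.
have h1 := sum_side t0; have [_ h2] := fourier_side t0.
have h3 : (fun N => Num.sqrt tau^-1 * \sum_(0 <= k < N) gauss tau^-1 k.+1%:R) @ \oo --> Num.sqrt tau^-1 * theta tau^-1.
  by apply: cvgM; [exact: cvg_cst|exact: theta_cvg].
have e1 : theta tau = 2^-1 * Num.sqrt tau^-1 - 2^-1 - \int[mu]_(x in D0) (dgauss tau x * saw x).
  exact: (cvg_unique _ (theta_cvg t0) h1).
have e2 := cvg_unique _ h3 h2.
rewrite e1 mulrDr e2; last exact: Rhausdorff.
ring.
Qed.

End Theta.

(** * The functional equation of zeta *)

Section FunctionalEquation.
Context {R : realType}.
Local Notation mu := (@lebesgue_measure R).
Local Notation RR := (measurableTypeR R).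
Local Notation P := (`[0, +oo[%classic : set R).
Local Notation gker := (@gker R).
Local Notation dbl := (@dbl R).

Let mT : measurable (setT : set RR). Proof. exact: measurableT. Qed.
Let mP : measurable (P : set RR). Proof. exact: measurable_itv. Qed.

(** The theta series in the coordinate u for which the inversion becomes u |-> - u. *)
Definition Om (u : R) : R := theta (expR (2 * u)).

Lemma gkerE (u : R) (k : nat) : gker (u + ln k.+1%:R) = gauss (expR (2 * u)) k.+1%:R.
Proof.
rewrite /gker /gauss mulrDr expRD -mulrA; congr expR; congr (- (_ * (_ * _))).
by rewrite expRM_natl lnK// posrE.
Qed.

Lemma Om_cvg u : (fun N => \sum_(0 <= k < N) gker (u + ln k.+1%:R)) @ \oo --> Om u.
Proof.
under eq_fun do under eq_bigr do rewrite gkerE.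
by apply: theta_cvg; exact: expR_gt0.
Qed.

Lemma mul_transfer (e e' a b : R) : e * e' = 1 -> a = e' * b -> e * a = b.
Proof. by move=> h ->; rewrite mulrA h mul1r. Qed.

Lemma Om_refl u : Om (- u) = expR u * Om u + 2^-1 * expR u - 2^-1.
Proof.
have := @theta_eq R _ (expR_gt0 (2 * u)).
rewrite -/(Om u) -expRN -mulrN -/(Om (- u)).
have -> : Num.sqrt (expR (2 * - u)) = expR (- u) :> R.
  have -> : expR (2 * - u) = expR (- u) ^+ 2 :> R by rewrite -expRM_natl.
  by rewrite sqrtr_sqr ger0_norm// expR_ge0.
move=> H; have e1 : expR u * expR (- u) = 1 by rewrite -expRD subrr expR0.
have H2 := mul_transfer e1 H.
by rewrite -[LHS](addrK 2^-1) -H2 mulrDr [expR u * 2^-1]mulrC.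
Qed.

Lemma Om_ge0 u : 0 <= Om u.
Proof.
have L := @Om_cvg u; rewrite -(cvg_lim _ L)//; apply: limr_ge; first by apply/cvg_ex; exists (Om u).
by apply: nearW => N; apply: sumr_ge0 => k _; exact: expR_ge0.
Qed.

Lemma measurable_Om : measurable_fun (setT : set RR) Om.
Proof.
apply: (@measurable_fun_cvg _ RR R setT (fun N (u : R) => \sum_(0 <= k < N) gker (u + ln k.+1%:R))).
  move=> N; apply: measurable_sum => k; apply: (measurableT_comp measurable_gker).
  exact: measurable_funD.
by move=> u _; exact: Om_cvg.
Qed.

Lemma sum_inv_sq N : \sum_(0 <= k < N) (k.+1%:R ^+ 2)^-1 <= 2 :> R.
Proof.
case: N => [|N]; first by rewrite big_geq.
suff : \sum_(0 <= k < N.+1) (k.+1%:R ^+ 2)^-1 <= 2 - N.+1%:R^-1 :> R.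
  by move=> /le_trans; apply; rewrite gerDl oppr_le0.
elim: N => [|N IH]; first by rewrite big_nat1 expr1n invr1; lra.
rewrite big_nat_recr//= (le_trans (lerD IH (lexx _)))// -lerBrDr lerBlDr -subr_ge0.
have -> : 2 - N.+2%:R^-1 - (N.+2%:R ^+ 2)^-1 + N.+1%:R^-1 - 2 = (N.+1%:R * N.+2%:R ^+ 2)^-1 :> R.
  rewrite -[N.+2%:R]natr1; have : N.+1%:R != 0 :> R by []; have : N.+1%:R + 1 != 0 :> R by rewrite natr1.
  by move: (N.+1%:R : R) => m h1 h2; field; rewrite h1 h2.
by rewrite invr_ge0 mulr_ge0.
Qed.

(** Each term is bounded by [gker_bound] at the exponent k + 1, which leaves at
    least the convergent series of the inverse squares. *)
Lemma Om_bound k u : Om u <= 2 * (k.+1`!%:R / pi ^+ k.+1) * expR (- (k.+1%:R * (2 * u))).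
Proof.
have L := @Om_cvg u; rewrite -(cvg_lim _ L)//; apply: limr_le; first by apply/cvg_ex; exists (Om u).
apply: nearW => N; set B := _ / _; have B0 : 0 <= B :> R by rewrite divr_ge0// exprn_ge0// pi_ge0.
apply: (@le_trans _ _ (\sum_(0 <= j < N) (B * expR (- (k.+1%:R * (2 * u))) * (j.+1%:R ^+ 2)^-1))).
  apply: ler_sum => j _; rewrite (le_trans (gker_bound k.+1 _))// -/B -mulrA ler_wpM2l//.
  have j0 : 0 < j.+1%:R :> R by [].
  rewrite mulrDr mulrDr opprD expRD ler_wpM2l ?expR_ge0//.
  have -> : (j.+1%:R ^+ 2)^-1 = expR (- (2 * ln j.+1%:R)) :> R.
    by rewrite expRN expRM_natl lnK// posrE.
  by rewrite ler_expR lerN2 ler_peMl ?ler1n// mulr_ge0// ln_ge0// ler1n.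
rewrite -mulr_sumr (_ : 2 * B * expR _ = B * expR (- (k.+1%:R * (2 * u))) * 2); last by ring.
apply: ler_wpM2l; last exact: sum_inv_sq.
by rewrite mulr_ge0 ?expR_ge0.
Qed.

Lemma Om_integrable_P c : mu.-integrable P (EFin \o (fun u => Om u * expR (c * u))).
Proof.
pose k := Num.truncn `|c|.
pose B : R := 2 * (k.+1`!%:R / pi ^+ k.+1).
have i1 := integrableZ_R B mT (@integrable_exp_abs R 1 ltr01).
have i2 := @integrableS _ RR _ mu setT P _ mT mP (@subsetT _ _) i1.
apply: (le_integrable_R mP _ _ i2).
  apply: measurable_funTS; apply: measurable_funM; first exact: measurable_Om.
  by apply: measurableT_comp => //; exact: measurable_funM.
move=> u; rewrite /= in_itv/= andbT => u0.
rewrite ger0_norm ?mulr_ge0 ?Om_ge0 ?expR_ge0//.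
rewrite (le_trans (ler_wpM2r (expR_ge0 _) (Om_bound k u)))// -/B -mulrA.
have B0 : 0 <= B by rewrite mulr_ge0// divr_ge0// exprn_ge0// pi_ge0.
rewrite ler_wpM2l// -expRD ler_expR ger0_norm// mulrA -mulNr -mulrDl ler_wpM2r//.
have : `|c| < k.+1%:R by exact: truncnS_gt.
have : 1 <= k.+1%:R :> R by rewrite ler1n.
have : c <= `|c| by exact: ler_norm.
move: (k.+1%:R) `|c| => m d; lra.
Qed.

Lemma Om_integrable c : 2 < c -> mu.-integrable setT (EFin \o (fun u => Om u * expR (c * u))).
Proof.
move=> c2; have c0 : 0 < c - 2 by rewrite subr_gt0.
pose B k : R := 2 * (k.+1`!%:R / pi ^+ k.+1).
have h0 u : 0 <= Om u * expR (2 * u) by rewrite mulr_ge0 ?Om_ge0 ?expR_ge0.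
have hB k u : Om u * expR (2 * u) <= B k * expR (- (k%:R * (2 * u))).
  rewrite (le_trans (ler_wpM2r (expR_ge0 _) (Om_bound k u)))// -/(B k) -mulrA -expRD.
  by rewrite -natr1 mulrDl mul1r opprD subrK.
have [K HK] := fast_decay c0 h0 hB.
apply: (exp_decay_integrable (divr_gt0 c0 (ltr0n _ 2))).
  apply: measurable_funM; first exact: measurable_Om.
  by apply: measurableT_comp => //; exact: measurable_funM.
move=> u; apply: le_trans (HK u).
by rewrite -mulrA -expRD -mulrDl addrC subrK.
Qed.

Lemma lap_gker (s : R[i]) : Gam (s / 2) = lap mu (setT : set RR) gker id s.
Proof.
apply: eq_cint => u _; congr (_ * cexp _); by rewrite /dbl realCM rmorph_nat mulrA divfK// pnatr_eq0.
Qed.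

(** By translation invariance, the shift by ln (k + 1) multiplies the Laplace
    transform by (k + 1)^-s. *)
Lemma lap_gker_shift (s : R[i]) k : 0 < complex.Re s ->
  lap mu (setT : set RR) (fun u => gker (u + ln k.+1%:R)) id s = dirichlet_term s k.+1 * Gam (s / 2).
Proof.
move=> s0; set a : R := ln _; rewrite lap_gker.
pose f (u : R) := (gker u)%:C%C * cexp (s * u%:C%C).
have sh0 : 0 < complex.Re s / 2 by rewrite divr_gt0.
have [K HK] := gker_decay sh0; set c := complex.Re s / 2 in sh0 HK.
have K0 : 0 <= K.
  have := HK 0; rewrite normr0 mulr0 expR0 mulr1; exact: le_trans.
have cf (u : R) : cabs (f u) <= K * expR (- c * `|u|).
  rewrite cabs_lap_integrand (le_trans _ (HK u))// normrM [X in _ <= _ * X]ger0_norm ?expR_ge0//.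
  by rewrite ler_wpM2l// ler_expR /dbl /c le_eqVlt; apply/orP; left; apply/eqP; field.
have mf : cmeas (setT : set RR) (f : RR -> R[i]).
  apply: cmeasM; first by apply: cmeas_real; exact: measurable_gker.
  apply: cmeas_cexp => //; apply: cmeasM; first exact: cmeas_cst.
  by apply: cmeas_real; exact: measurable_id.
have ms : measurable_fun (setT : set RR) (fun u : R => u + a : RR) by exact: measurable_funD.
have mfs : cmeas (setT : set RR) (fun u : RR => f (u + a)).
  by split; [exact: (measurableT_comp mf.1 ms)|exact: (measurableT_comp mf.2 ms)].
have ifs : cintegrable mu (setT : set RR) (fun u : RR => f (u + a)).
  apply: (@cintegrable_le _ RR _ mu _ _ (fun u => K * expR (c * `|a|) * expR (- c * `|u|)) mT mfs).
    by apply: integrableZ_R => //; exact: integrable_exp_abs.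
  move=> u _; rewrite (le_trans (cf _))// -mulrA ler_wpM2l// -expRD ler_expR.
  have h : `|u| <= `|u + a| + `|a| by rewrite -{1}[u](addrK a) ler_normB.
  have := ler_wpM2l (ltW sh0) h; rewrite mulrDr !mulNr => h'.
  by move: h'; move: (c * _) (c * _) (c * _) => x y z; lra.
have E1 : cint mu (setT : set RR) (fun u : RR => f (u + a)) = cint mu (setT : set RR) f.
  apply: complex_eq.
    exact: (@Rintegral_shift R a setT (fun u => complex.Re (f u)) mT mf.1 ifs.1).
  exact: (@Rintegral_shift R a setT (fun u => complex.Im (f u)) mT mf.2 ifs.2).
rewrite (_ : lap mu (setT : set RR) gker id s = cint mu (setT : set RR) (fun u : RR => f (u + a))); last by rewrite E1.
rewrite /dirichlet_term -/a -(@cintZ _ RR _ mu _ _ _ mT ifs); apply: eq_cint => u _.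
rewrite /f mulrCA -cexpD; congr (_ * cexp _).
by rewrite [(u + a)%:C%C]rmorphD/=; ring.
Qed.

Lemma zeta_Om (zeta : R[i] -> R[i]) (s : R[i]) : is_riemann_zeta zeta -> 2 < complex.Re s ->
  zeta s * Gam (s / 2) = lap mu (setT : set RR) Om id s.
Proof.
move=> hz s2; have s0 : 0 < complex.Re s by rewrite (lt_trans _ s2).
have s1 : 1 < complex.Re s by rewrite (lt_trans _ s2)// ltr1n.
have hz1 : ccvg (series (fun n => dirichlet_term s n.+1)) (zeta s) by exact: hz.1.
have L1 := ccvgM hz1 (ccvg_cst (Gam (s / 2))).
have L2 := @lap_series _ RR _ mu setT (fun k u => gker (u + ln k.+1%:R)) Om id s mT.
apply: (ccvg_unique L1); apply: (ccvg_eq (L2 _ _ _ _ _)).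
- move=> k; apply: (measurableT_comp measurable_gker); exact: measurable_funD.
- exact: measurable_id.
- by move=> k u _; exact: expR_ge0.
- by move=> u _; exact: Om_cvg.
- exact: Om_integrable.
move=> N; rewrite /series/= mulr_suml; apply: eq_bigr => k _.
exact: lap_gker_shift.
Qed.

(** The two halves of the line are folded onto the half line, where the theta
    series decays faster than any exponential: the function is entire, and the
    exchange of the two terms is the symmetry s |-> 1 - s. *)
Definition Eside (s : R[i]) : R[i] := lap mu (P : set RR) Om id s +
  lap mu (P : set RR) (fun u => Om u * expR u) (fun u => - u) s.

(** Riemann's xi function: see [xi_zeta], where the Gamma factor is
    pi^(-s/2) Gamma (s/2) / 2. *)
Definition xi (s : R[i]) : R[i] := s * (s - 1) * Eside s + 2^-1.

Lemma xi_sym s : xi (1 - s) = xi s.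
Proof.
have E : Eside (1 - s) = Eside s.
  rewrite /Eside addrC; congr (_ + _); apply: eq_cint => u _.
    rewrite realCM -mulrA -cexpR -cexpD; congr (_ * cexp _).
    by rewrite rmorphN/=; ring.
  rewrite realCM -mulrA -cexpR -cexpD; congr (_ * cexp _).
  by rewrite rmorphN/=; ring.
by rewrite /xi E; congr (_ * _ + _); ring.
Qed.

Lemma Eside_analytic s : canal Eside s.
Proof.
apply: canalD.
  apply: (@lap_analytic _ RR _ mu P Om id (complex.Re s - 1) (complex.Re s + 1)).
  - exact: mP.
  - by apply: measurable_funTS; exact: measurable_Om.
  - exact: measurable_id.
  - exact: Om_integrable_P.
  - exact: Om_integrable_P.
  - by apply/andP; split; lra.
have h c : mu.-integrable P (EFin \o (fun u => Om u * expR u * expR (c * - u))).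
  have := Om_integrable_P (1 - c); congr (integrable _ _ _); apply/funext => u /=.
  by rewrite -mulrA -expRD; congr (EFin (_ * expR _)); ring.
apply: (@lap_analytic _ RR _ mu P _ _ (complex.Re s - 1) (complex.Re s + 1)).
- exact: mP.
- apply: measurable_funTS; apply: measurable_funM; first exact: measurable_Om.
  exact: measurable_expR.
- by apply: measurable_funTS; under eq_fun do rewrite -mulN1r; exact: measurable_funM.
- exact: h.
- exact: h.
- by apply/andP; split; lra.
Qed.

Lemma lap_exp (w : R[i]) : 0 < complex.Re w ->
  cintegrable mu (P : set RR) (fun u : RR => cexp (- w * u%:C%C)) /\
  cint mu (P : set RR) (fun u : RR => cexp (- w * u%:C%C)) = w^-1.
Proof.
move=> w0; have wn0 : w != 0 by apply: contraTneq w0 => ->; rewrite /= ltxx.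
have ca (u : R) : cabs (cexp (- w * u%:C%C)) = expR (- complex.Re w * u).
  by rewrite cabs_cexp Re_mulR ReN.
have i_e : cintegrable mu (P : set RR) (fun u : RR => cexp (- w * u%:C%C)).
  have i1 := @integrableS _ RR _ mu setT P _ mT mP (@subsetT _ _) (integrable_exp_abs w0).
  apply: (@cintegrable_le _ RR _ mu _ _ _ mP _ i1).
    apply: cmeas_cexp => //; apply: cmeasM; first exact: cmeas_cst.
    by apply: cmeas_real; exact: measurable_id.
  by move=> u; rewrite /= in_itv/= andbT => u0; rewrite ca ger0_norm.
split => //.
pose F (u : R) := - w^-1 * cexp (- w * u%:C%C).
have dF (u : R) : is_cderive F u (cexp (- w * u%:C%C)).
  have := is_cderiveZ (- w^-1) (is_cderive_cexp (- w) (is_derive_id u 1)).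
  congr is_cderive; rewrite mulr1 mulrA mulrNN mulVf// mul1r.
  by [].
have La : ccvg (fun _ : nat => F 0) (- w^-1).
  have -> : - w^-1 = F 0 by rewrite /F mulr0 cexp0 mulr1.
  exact: ccvg_cst.
have Lb : ccvg (fun n : nat => F n.+1%:R) 0.
  apply: (@ccvg0_squeeze _ _ (fun n => cabs (- w^-1) * expR (- complex.Re w * n.+1%:R))).
    by move=> n; rewrite /F cabsM ca.
  rewrite (_ : 0 = cabs (- w^-1) * 0); last by rewrite mulr0.
  by apply: cvgM; [exact: cvg_cst|exact: cvg_expN].
rewrite (@cint_improper_FTC _ P (fun u : R => cexp (- w * u%:C%C)) F (fun=> 0) (fun n => n.+1%:R) _ _
  mP _ _ _ _ _ La Lb i_e) ?sub0r ?opprK//.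
- by move=> n x /andP[h _]; rewrite /= in_itv/= andbT.
- move=> x; rewrite /= in_itv/= andbT => x0; have [N _ HN] := near_ubound x.
  by exists N => // n Nn; have /= /andP[_ ->] := HN n Nn; rewrite x0.
- move=> x _; eexists; exact: (is_cderive_cexp (- w) (is_derive_id x 1)).
Qed.

Lemma Rintegral_reflect (f : R -> R) : measurable_fun (setT : set RR) f ->
  mu.-integrable setT (EFin \o f) -> mu.-integrable P (EFin \o (fun u => f (- u))) ->
  \int[mu]_u f u = \int[mu]_(u in P) f u + \int[mu]_(u in P) f (- u).
Proof.
move=> mf i_f ifn.
pose N : set R := `]-oo, 0[%classic.
have mN : measurable (N : set RR) by exact: measurable_itv.
have TE : (setT : set RR) = N `|` P.
  apply/seteqP; split => x // _; have [x0|x0] := leP 0 x; [right|left]; by rewrite /N/= in_itv/= ?x0.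
have dis : [disjoint N & P].
  by apply/disj_setPS => x [/=]; rewrite /N/= !in_itv/= andbT => h1 h2; move: (lt_le_trans h1 h2); rewrite ltxx.
rewrite [in LHS]TE (@Rintegral_setU _ RR)//; last by rewrite -TE.
rewrite addrC; congr (_ + _).
have mD : measurable (`]0, +oo[%classic : set RR) by exact: measurable_itv.
have mopp : measurable_fun (setT : set RR) (fun u : R => f (- u)).
  have mo : measurable_fun (setT : set RR) (fun u : R => - u : RR).
    rewrite (_ : (fun u : R => - u) = (fun u => -1 * u)); first exact: measurable_funM.
    by apply/funext => u; rewrite mulN1r.
  exact: (measurableT_comp mf mo).
have SE : [set x : R | `]0, +oo[%classic (- x)] = N.
  by apply/seteqP; split => x; rewrite /N/= !in_itv/= andbT oppr_gt0.
have := @Rintegral_opp R `]0, +oo[%classic (fun u => f (- u)) mD mopp.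
rewrite SE; under eq_fun do rewrite opprK.
move=> H; rewrite -Rintegral_itv_obnd_cbnd; last first.
  by apply: (@integrableS _ RR _ mu P _ _ mP mD _ ifn) => x /=; rewrite !in_itv/= !andbT => /ltW.
by apply: H; exact: (@integrableS _ RR _ mu setT N _ mT mN (@subsetT _ _) i_f).
Qed.

(** On the negative half line [Om_refl] applies; its two exponential terms produce
    the poles at 0 and 1. *)
Lemma Om_split (s : R[i]) : 2 < complex.Re s ->
  lap mu (setT : set RR) Om id s = Eside s + 2^-1 * (s - 1)^-1 - 2^-1 * s^-1.
Proof.
move=> s2; have s0 : 0 < complex.Re s by rewrite (lt_trans _ s2).
have s10 : 0 < complex.Re (s - 1).
  by rewrite ReD ReN (_ : complex.Re (1 : R[i]) = 1)// subr_gt0 (lt_trans _ s2)// ltr1n.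
pose f (u : R) := (Om u)%:C%C * cexp (s * u%:C%C).
have i_f : cintegrable mu (setT : set RR) (f : RR -> R[i]).
  apply: (@lap_integrable _ RR _ mu setT Om id s mT measurable_Om (@measurable_id _ _ _)).
  exact: Om_integrable.
have mf := @cintegrable_cmeas _ RR _ mu _ _ i_f.
pose f1 (u : R) := (Om u * expR u)%:C%C * cexp (s * (- u)%:C%C).
have i1 : cintegrable mu (P : set RR) (f1 : RR -> R[i]).
  apply: (@lap_integrable _ RR _ mu P (fun u => Om u * expR u) (fun u => - u) s mP).
  - apply: measurable_funTS; apply: measurable_funM; first exact: measurable_Om.
    exact: measurable_expR.
  - by apply: measurable_funTS; under eq_fun do rewrite -mulN1r; exact: measurable_funM.
  - have := Om_integrable_P (1 - complex.Re s); congr (integrable _ _ _); apply/funext => u /=.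
    by rewrite -mulrA -expRD; congr (EFin (_ * expR _)); ring.
have [i2 e2] := lap_exp s10; have [i3 e3] := lap_exp s0.
have i2' := @cintegrableZ _ RR _ mu _ 2^-1 _ mP i2.
have i3' := @cintegrableZ _ RR _ mu _ (- 2^-1) _ mP i3.
have i23 := @cintegrableD _ RR _ mu _ _ _ mP i2' i3'.
have i123 := @cintegrableD _ RR _ mu _ _ _ mP i1 i23.
have fN (u : R) : f (- u) = f1 u + (2^-1 * cexp (- (s - 1) * u%:C%C) + - 2^-1 * cexp (- s * u%:C%C)).
  have h2 : (2^-1 : R)%:C%C = 2^-1 :> R[i] by rewrite fmorphV/= rmorph_nat.
  rewrite /f Om_refl rmorphB/= rmorphD/= !realCM h2 /f1 realCM.
  have -> : cexp (- (s - 1) * u%:C%C) = (expR u)%:C%C * cexp (s * (- u)%:C%C).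
    by rewrite -cexpR -cexpD; congr cexp; rewrite rmorphN/=; ring.
  have -> : cexp (- s * u%:C%C) = cexp (s * (- u)%:C%C) by congr cexp; rewrite rmorphN/=; ring.
  ring.
have iN : cintegrable mu (P : set RR) (fun u : RR => f (- u)).
  by move: i123; congr (cintegrable _ _ _); apply/funext => u; rewrite fN.
have -> : lap mu (setT : set RR) Om id s = cint mu (P : set RR) f + cint mu (P : set RR) (fun u : RR => f (- u)).
  apply: complex_eq; rewrite ?ReD ?ImD !(Re_cint, Im_cint).
    exact: (Rintegral_reflect mf.1 i_f.1 iN.1).
  exact: (Rintegral_reflect mf.2 i_f.2 iN.2).
rewrite (@eq_cint _ RR _ mu (P : set RR) _ _ (fun u _ => fN u)).
rewrite (@cintD _ RR _ mu _ _ _ mP i1 i23) (@cintD _ RR _ mu _ _ _ mP i2' i3').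
rewrite !(@cintZ _ RR)// e2 e3 /Eside /lap mulNr !addrA//.
Qed.

Lemma xi_zeta (zeta : R[i] -> R[i]) (s : R[i]) : is_riemann_zeta zeta -> 2 < complex.Re s ->
  s * (s - 1) * zeta s * Gam (s / 2) = xi s.
Proof.
move=> hz s2; rewrite -mulrA (zeta_Om hz s2) Om_split// /xi.
have s0 : s != 0 by apply: contraTneq s2 => ->; rewrite /= -leNgt.
have s1 : s - 1 != 0.
  rewrite subr_eq0; apply: contraTneq s2 => ->; rewrite /= -leNgt.
  by rewrite ler1n.
by field; rewrite s0 s1.
Qed.

Lemma Gam_shift (w : R[i]) M : 0 < complex.Re w ->
  (pi : R)%:C%C ^+ M * Gam (w + M%:R) = \prod_(j < M) (w + j%:R) * Gam w.
Proof.
move=> w0; elim: M => [|M IH]; first by rewrite expr0 big_ord0 !mul1r addr0.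
have wM : 0 < complex.Re (w + M%:R) by rewrite ReD Re_nat ltr_pwDl.
rewrite exprSr -mulrA -natr1 addrA GamS// mulrCA IH big_ord_recr/=; ring.
Qed.

(** The value of [Gam] at s / 2 + M + 1, in a form that is visibly analytic for
    Re s > - 2 (M + 1). *)
Definition Gshift M (s : R[i]) : R[i] :=
  lap mu (setT : set RR) (fun u => gker u * expR (M.+1%:R * dbl u)) id s.

Lemma GshiftE M s : Gshift M s = Gam (s / 2 + M.+1%:R).
Proof.
apply: eq_cint => u _; rewrite realCM -mulrA -cexpR -cexpD; congr (_ * cexp _).
rewrite realCM rmorph_nat [RHS]mulrDl addrC; congr (_ + _).
by rewrite /dbl realCM rmorph_nat mulrA divfK// pnatr_eq0.
Qed.

Lemma Gshift_analytic M s : - (2 * M.+1%:R) < complex.Re s -> canal (Gshift M) s.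
Proof.
move=> sM; pose a : R := (complex.Re s - 2 * M.+1%:R) / 2.
have h c : - (2 * M.+1%:R) < c -> mu.-integrable setT (EFin \o (fun u => gker u * expR (M.+1%:R * dbl u) * expR (c * u))).
  move=> cM; have c0 : 0 < M.+1%:R + c / 2 by move: cM; move: (M.+1%:R : R) => m; lra.
  have := gker_integrable c0; congr (integrable _ _ _); apply/funext => u /=.
  by rewrite -mulrA -expRD; congr (EFin (_ * expR _)); rewrite /dbl; field.
apply: (@lap_analytic _ RR _ mu setT _ _ a (complex.Re s + 1)).
- exact: mT.
- apply: measurable_funM; first exact: measurable_gker.
  by apply: measurableT_comp => //; apply: measurable_funM => //; exact: measurable_dbl.
- exact: measurable_id.
- by apply: h; rewrite /a; move: sM; move: (M.+1%:R : R) => m; lra.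
- by apply: h; move: sM; move: (M.+1%:R : R) => m; lra.
- by apply/andP; split; rewrite /a; move: sM; move: (M.+1%:R : R) => m; lra.
Qed.

(** [xi_zeta] after multiplication by the linear factors that clear the poles of
    Gamma: both sides are then analytic for Re s > - 2 (M + 1), s <> 1, and the
    identity extends from Re s > 2. *)
Theorem zeta_xi (zeta : R[i] -> R[i]) M (s : R[i]) : is_riemann_zeta zeta ->
  - (2 * M.+1%:R) < complex.Re s -> s != 1 ->
  2 * (s - 1) * zeta s * ((pi : R)%:C%C ^+ M.+1 * Gshift M s) =
  \prod_(j < M) (s / 2 + j.+1%:R) * xi s.
Proof.
move=> hz sM s1.
pose f s := 2 * (s - 1) * zeta s * ((pi : R)%:C%C ^+ M.+1 * Gshift M s) -
  \prod_(j < M) (s / 2 + j.+1%:R) * xi s.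
suff : f s = 0 by move=> /eqP; rewrite subr_eq0 => /eqP.
apply: (@identity_halfplane _ f (- (2 * M.+1%:R)) 2) => //.
  move=> z zM z1; apply: canalB.
    apply: canalM.
      apply: canalM; last by apply: analytic_canal; exact: hz.2.
      by apply: canalM; [exact: canal_cst|apply: canalB; [exact: canal_id|exact: canal_cst]].
    by apply: canalM; [exact: canal_cst|exact: Gshift_analytic].
  apply: canalM.
    apply: (@canal_prod _ M (fun j z => z / 2 + j.+1%:R)) => j; apply: canalD; last exact: canal_cst.
    by apply: canalM; [exact: canal_id|exact: canal_cst].
  apply: canalD; last exact: canal_cst.
  apply: canalM; last exact: Eside_analytic.
  by apply: canalM; [exact: canal_id|apply: canalB; [exact: canal_id|exact: canal_cst]].
move=> z z2; have z0 : 0 < complex.Re z by rewrite (lt_trans _ z2).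
have z20 : 0 < complex.Re (z / 2).
  have -> : z / 2 = (2^-1 : R)%:C%C * z by rewrite mulrC fmorphV/= rmorph_nat.
  by rewrite Re_realM mulr_gt0.
rewrite /f GshiftE Gam_shift// -(xi_zeta hz z2) big_ord_recl/= addr0.
rewrite (eq_bigr (fun j : 'I_M => z / 2 + j.+1%:R))//.
by field.
Qed.

End FunctionalEquation.

(** * The Riemann hypothesis *)

Theorem proposition6p1 (R : realType) (psi : R -> R)
  (hpsi : is_mollifier psi)
  (phi : nat -> R -> R) (n : R -> nat)
  (hn : n eps @[eps --> 0^'+] --> \oo)
  (hmod : moderate (moebius_net psi phi n))
  (hassoc : associated (moebius_net psi phi n)
              (fun eps x => - iota_net psi chi eps x))
  (hL2 : exists M : R, forall eps : R, 0 < eps <= 1 ->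
           (L2norm01 (moebius_net psi phi n eps) <= M%:E)%E) :
  riemann_hypothesis R.
Proof.
move=> zeta hz s s1 zs ntriv.
have right (z : R[i]) : 2^-1 < complex.Re z -> z != 1 -> zeta z <> 0.
  by move=> z2 z1 z0; apply: (net_zeta_neq0 hpsi hmod hassoc hL2 hz z2 z1 z0).
have [sl|sr|//] := ltgtP (complex.Re s) 2^-1; last by have := right s sr s1 zs.
exfalso.
(* the half plane of [zeta_xi] has to contain s *)
pose M := Num.truncn `|complex.Re s|.
have sM : - (2 * M.+1%:R) < complex.Re s.
  have h1 : `|complex.Re s| < M.+1%:R by exact: truncnS_gt.
  have h2 : - `|complex.Re s| <= complex.Re s by rewrite lerNl -normrN ler_norm.
  have h3 : 0 <= `|complex.Re s| by [].
  by move: (complex.Re s) `|complex.Re s| (M.+1%:R : R) h1 h2 h3 => x y m; lra.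
have := zeta_xi hz sM s1; rewrite zs mulr0 mul0r => /esym/eqP; rewrite mulf_eq0 => /orP[/prodf_eq0|/eqP xs].
  (* the zeros of the linear factors are the trivial ones *)
  move=> [j _]; rewrite addr_eq0 => /eqP h; apply: ntriv; exists j.
  have : s = - j.+1%:R * 2 by rewrite -h divfK// pnatr_eq0.
  by rewrite natrM mulNr mulrC.
have s0 : s != 0.
  apply: contra_eq_neq xs => ->; rewrite /xi !mul0r add0r invr_eq0 pnatr_eq0//.
(* xi vanishes at s, hence at 1 - s; there Gamma does not vanish, so zeta would
   vanish to the right of the critical line *)
have s11 : 1 - s != 1 by rewrite -subr_eq0 addrAC subrr add0r oppr_eq0.
have sr : 2^-1 < complex.Re (1 - s).
  by rewrite ReD ReN (_ : complex.Re (1 : R[i]) = 1)//; lra.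
have s0M : - (2 * 1%:R) < complex.Re (1 - s) by rewrite (lt_trans _ sr)//; lra.
have := zeta_xi hz s0M s11; rewrite xi_sym xs mulr0 => /eqP.
have G0 : Gshift 0 (1 - s) != 0.
  rewrite GshiftE; apply: Gam_neq0.
  have -> : (1 - s) / 2 = (2^-1 : R)%:C%C * (1 - s) by rewrite mulrC fmorphV/= rmorph_nat.
  rewrite ReD Re_realM Re_nat; move: sr; lra.
have p0 : (pi : R)%:C%C != 0 :> R[i] by rewrite (inj_eq (@complexI R)) gt_eqF ?pi_gt0.
rewrite !mulf_eq0 (negbTE G0) expr1 (negbTE p0) !orbF pnatr_eq0/=.
rewrite addrAC subrr add0r oppr_eq0 (negbTE s0)/= => /eqP.
exact: right.
Qed.
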